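(* (1) For $0<\alpha<1$ and $a,b\in\mathbb{R}$ with $b>0$, the equation $$\frac{d^\alpha\varphi}{dz^\alpha}=a\varphi+\frac b\alpha z\frac{d\varphi}{dz},\qquad z>0,$$ has as a solution $$\varphi(z)=c_1H^{1,0}_{1,1}\left[\frac{z^{-\alpha}}{b}\,\Big|\,\begin{array}{c}(1,\alpha)\\(-\bar s,1)\end{array}\right],$$ where $\bar s=-\frac ab$ and $c_1$ is an arbitrary constant. (2) For $0<\alpha<2$ and $a,b,c\in\mathbb{R}$ with $c>0$, the equation $$\frac{d^\alpha\varphi}{dz^\alpha}=a\varphi+\frac b\alpha z\frac{d\varphi}{dz}+\frac c{\alpha^2}z^2\frac{d^2\varphi}{dz^2},\qquad z>0,$$ has as a solution $$\varphi(z)=c_1H^{2,0}_{1,2}\left[\frac{z^{-\alpha}}{c}\,\Big|\,\begin{array}{c}(1,\alpha)\\(-s_1,1),(-s_2,1)\end{array}\right],$$ where $s_{1,2}=\frac12\left(\frac1\alpha-\frac bc\pm\sqrt D\right)$, $D=\frac1{\alpha^2}-\frac{2b}{\alpha c}+\frac{b^2}{c^2}-\frac{4a}{c}$, and $c_1$ is an arbitrary constant. (3) For $0<\alpha<1$ and $a_1,a_2,b_1,b_2\in\mathbb{R}$ with $b_1b_2>0$, the system $$\begin{cases}\dfrac{d^\alpha\varphi}{dz^\alpha}=a_1\psi+\dfrac{b_1}{\alpha}z\dfrac{d\psi}{dz},\\[2mm]\dfrac{d^\alpha\psi}{dz^\alpha}=a_2\varphi+\dfrac{b_2}{\alpha}z\dfrac{d\varphi}{dz},\end{cases}\qquad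 z>0,$$ has as a solution $$\begin{cases}\varphi(z)=c_1\operatorname{sgn}(b_1)H^{2,0}_{1,2}\left[\dfrac{z^{-2\alpha}}{4b_1b_2}\,\Big|\,\begin{array}{c}(1,2\alpha)\\\left(\frac12-\frac{\tilde s_1}{2},1\right),\left(-\frac{\tilde s_2}{2},1\right)\end{array}\right],\\ \psi(z)=c_1\sqrt{\dfrac{b_2}{b_1}}\,H^{2,0}_{1,2}\left[\dfrac{z^{-2\alpha}}{4b_1b_2}\,\Big|\,\begin{array}{c}(1,2\alpha)\\\left(-\frac{\tilde s_1}{2},1\right),\left(\frac12-\frac{\tilde s_2}{2},1\right)\end{array}\right],\end{cases}$$ where $\tilde s_1=-\frac{a_1}{b_1}$, $\tilde s_2=-\frac{a_2}{b_2}$, and $c_1$ is an arbitrary constant.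
   Context: $\operatorname{sgn}(x)=1$ for $x>0$ and $-1$ for $x<0$. Riemann-Liouville derivative: for $\alpha=n\in\mathbb{N}$, $\frac{d^\alpha}{dz^\alpha}\varphi=\frac{d^n}{dz^n}\varphi$; for $\alpha\in(n-1,n)$ with $n\in\mathbb{N}=\{1,2,\dots\}$, $\frac{d^\alpha}{dz^\alpha}\varphi(z)=\frac{1}{\Gamma(n-\alpha)}\frac{d^n}{dz^n}\int_0^z(z-s)^{n-\alpha-1}\varphi(s)\,ds$. Fox H-function with $l=0$, for $m\ge1$, $\alpha_i,\beta_j>0$ and $A_i,B_j\in\mathbb{C}$: $$H^{m,0}_{p,q}\left[w\,\Big|\,\begin{array}{c}(A_i,\alpha_i)_{1,p}\\(B_j,\beta_j)_{1,q}\end{array}\right]=\frac{1}{2\pi i}\int_{\gamma-i\infty}^{\gamma+i\infty}\frac{\prod_{j=1}^m\Gamma(B_j-\beta_js)}{\prod_{i=1}^p\Gamma(A_i-\alpha_is)\prod_{j=m+1}^q\Gamma(1-B_j+\beta_js)}\,w^s\,ds,$$ where $\gamma$ is a real number such that all poles of $\Gamma(B_j-\beta_js)$, $1\le j\le m$, lie to the right of the line $\Re s=\gamma$ (empty products are $1$); $(A_i,\alpha_i)_{1,p}$ denotes the list $(A_1,\alpha_1),\dots,(A_p,\alpha_p)$. The integral converges when $\mu=\sum_{j=1}^m\beta_j-\sum_{j=m+1}^q\beta_j-\sum_{i=1}^p\alpha_i>0$ and $|\arg w|<\pi\mu/2$. In (2), $\sqrt D$ is a complex square root if $D<0$. *)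

(* Defs.v *)
From mathcomp Require Import all_boot all_order all_algebra.
From mathcomp Require Import complex.
From mathcomp Require Import all_classical all_reals all_analysis.

Set Implicit Arguments.
Unset Strict Implicit.
Unset Printing Implicit Defensive.

Import Order.TTheory GRing.Theory Num.Theory.
Import numFieldNormedType.Exports.

Local Open Scope classical_set_scope.
Local Open Scope ring_scope.
Local Open Scope complex_scope.

Definition Cexp (R : realType) (z : R[i]) : R[i] :=
  (expR (complex.Re z))%:C *
  (cos (complex.Im z) +i* sin (complex.Im z)).

(* Principal argument, in ]-pi, pi] for w != 0. *)
Definition Carg (R : realType) (w : R[i]) : R :=
  let theta := acos (complex.Re w / complex.Re `|w|) in
  if 0 <= complex.Im w then theta else - theta.

(* Principal branch of w ^ s; meaningful for w != 0 only. *)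
Definition Cpow (R : realType) (w s : R[i]) : R[i] :=
  Cexp (s * (ln (complex.Re `|w|) +i* Carg w)).

(* Integrability, integral and derivatives of a function R -> R[i] are taken
   componentwise; integrals are Lebesgue integrals. *)
Definition Cintegrable (R : realType) (D : set R) (f : R -> R[i]) : Prop :=
  (@lebesgue_measure R).-integrable D (fun t => (complex.Re (f t))%:E) /\
  (@lebesgue_measure R).-integrable D (fun t => (complex.Im (f t))%:E).

Definition Cintegral (R : realType) (D : set R) (f : R -> R[i]) : R[i] :=
  (\int[@lebesgue_measure R]_(t in D) complex.Re (f t)) +i*
  (\int[@lebesgue_measure R]_(t in D) complex.Im (f t)).

Definition Cderive (R : realType) (n : nat) (f : R -> R[i]) (z : R) : R[i] :=
  derive1n n (fun t => complex.Re (f t)) z +i*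
  derive1n n (fun t => complex.Im (f t)) z.

(* f is n times differentiable at every point of the half-line z > 0. *)
Definition Cderivable_pos (R : realType) (n : nat) (f : R -> R[i]) : Prop :=
  forall k : nat, (k < n)%N -> forall z : R, 0 < z ->
    derivable (derive1n k (fun t => complex.Re (f t))) z 1 /\
    derivable (derive1n k (fun t => complex.Im (f t))) z 1.

(* Euler's integral for Re z > 0, continued by
   Gamma z = Gamma (z + n) / (z (z + 1) ... (z + n - 1)).
   At the poles 0, -1, -2, ... division by zero makes the value 0, so that
   (Gamma z)^-1 vanishes there, as the entire function 1 / Gamma does. *)
Definition Gamma_int (R : realType) (z : R[i]) : R[i] :=
  Cintegral `]0, +oo[
    (fun t : R => Cpow t%:C (z - 1) * (expR (- t))%:C).

Definition Gamma (R : realType) (z : R[i]) : R[i] :=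
  if 0 < complex.Re z then Gamma_int z
  else let n := (Num.truncn (- complex.Re z)).+1 in
       Gamma_int (z + n%:R) / \prod_(k < n) (z + k%:R).

(* H^{m,0}_{p,q} with parameter lists A = (A_i, alpha_i)_{1,p} and
   B = (B_j, beta_j)_{1,q}, where p = size A and q = size B. *)
Definition FoxH_integrand (R : realType) (m : nat) (A B : seq (R[i] * R))
    (w s : R[i]) : R[i] :=
  (\prod_(b <- take m B) Gamma (b.1 - b.2%:C * s)) /
  ((\prod_(a <- A) Gamma (a.1 - a.2%:C * s)) *
   (\prod_(b <- drop m B) Gamma (1 - b.1 + b.2%:C * s))) *
  Cpow w s.

(* All poles of Gamma (B_j - beta_j s), 1 <= j <= m, lie to the right of the
   line Re s = gamma. *)
Definition FoxH_line (R : realType) (m : nat) (B : seq (R[i] * R))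
    (gamma : R) : Prop :=
  forall b : R[i] * R, b \in take m B ->
  forall (k : nat) (s : R[i]), b.1 - b.2%:C * s = - k%:R ->
    gamma < complex.Re s.

Definition FoxH_cvg (R : realType) (m : nat) (A B : seq (R[i] * R))
    (gamma : R) (w : R[i]) : Prop :=
  Cintegrable setT (fun t : R => FoxH_integrand m A B w (gamma +i* t)).

(* 0 +i* 1 is the imaginary unit; its second occurrence is the Jacobian of s = gamma + i t. *)
Definition FoxH (R : realType) (m : nat) (A B : seq (R[i] * R))
    (gamma : R) (w : R[i]) : R[i] :=
  (2 * pi%:C * (0 +i* 1))^-1 *
  ((0 +i* 1) * Cintegral setT
          (fun t : R => FoxH_integrand m A B w (gamma +i* t))).

Definition RL_integrand (R : realType) (r : R) (f : R -> R[i]) (z s : R) :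
    R[i] := (powR (z - s) r)%:C * f s.

(* Riemann-Liouville derivative of order alpha > 0: the ordinary derivative
   when alpha is a natural number, and otherwise alpha is in ]n - 1, n[ with
   n = (truncn alpha).+1. *)
Definition RL_derivable_pos (R : realType) (alpha : R) (f : R -> R[i]) : Prop :=
  if alpha == (Num.truncn alpha)%:R then Cderivable_pos (Num.truncn alpha) f
  else let n := (Num.truncn alpha).+1 in
       (forall z : R, 0 < z ->
          Cintegrable `]0, z[ (RL_integrand (n%:R - alpha - 1) f z)) /\
       Cderivable_pos n (fun z : R =>
          Cintegral `]0, z[ (RL_integrand (n%:R - alpha - 1) f z)).

Definition RL_derive (R : realType) (alpha : R) (f : R -> R[i]) (z : R) :
    R[i] :=
  if alpha == (Num.truncn alpha)%:R then Cderive (Num.truncn alpha) f z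
  else let n := (Num.truncn alpha).+1 in
       (Gamma (n%:R - alpha)%:C)^-1 *
       Cderive n (fun z : R =>
          Cintegral `]0, z[ (RL_integrand (n%:R - alpha - 1) f z)) z.

(* Main.v *)
(* Write E_e(z) for the integral of K(s) z^(e-1-ks) / Gamma(e-ks) along a vertical
   line.  Then d/dz E_e = E_(e-1), and by Fubini and Euler's Beta integral the
   Riemann-Liouville integral of order r maps E_1 to E_(1+r); hence
   d^alpha/dz^alpha E_1 = E_(1-alpha).  The H-functions are such E_1, with K a
   product of factors Gamma(B_j - s).  Writing alpha = k d and substituting
   s -> s - d in E_(1-alpha) moves the line by d and replaces K(s) by K(s - d),
   which by Gamma(x+1) = x Gamma(x) is a polynomial in s times the kernel of the
   right-hand side: the symbol of its differential operator.  Moving the line back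
   meets no pole.

   Convergence and the contour shift rest on |Gamma(x+iy)| = O(exp(-theta |y|)) for
   every theta < pi/2, obtained by rotating Euler's integral, and on
   |Gamma(x+iy)| >= c exp(-pi |y| / 2) for x >= 1; the number of Gamma factors in
   the numerator exceeds k in all three parts. *)
Require Import Defs.
From mathcomp Require Import all_boot all_order all_algebra.
From mathcomp Require Import complex ring lra.
From mathcomp Require Import all_classical all_reals all_analysis measurable_realfun.

Set Implicit Arguments.
Unset Strict Implicit.
Unset Printing Implicit Defensive.

Import Order.TTheory GRing.Theory Num.Theory.
Import numFieldNormedType.Exports.
Import Normc.

Local Open Scope classical_set_scope.
Local Open Scope ring_scope.
Local Open Scope complex_scope.

(** All integrals are carried to the whole real line: Euler's by t = exp u, the Riemann-Liouville
    one by a logistic substitution that makes it a Beta integral, contours by their height. One kind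
    of domination, C exp (- eta |t|), then serves integrability, Fubini and every estimate.

    The decay rate is a budget. With n Gamma factors in the numerator the kernel decays at rate n
    theta, while 1 / Gamma (e - k s) grows at rate k (pi / 2 + epsilon). As n > k strictly, theta
    and epsilon may both miss the sharp rate, and something is left for the polynomial factors that
    differentiation brings down. Since e decreases and the line is free, 1 / Gamma is needed on
    every vertical strip, where its recurrence holds at each point.

    The argument of the H-function contributes b^(-s), so a step d multiplies the kernel by b^d. In
    part (3), k = 2 alpha and d = 1 / 2: half a step carries the kernel of one unknown to that of
    the other, only one of the two Gamma factors leaving a linear factor, and b^(1 / 2) = 2 sqrt (b1
    b2) is what sgn (b1) and sqrt (b2 / b1) balance. *)

Local Notation re := (@complex.Re _).
Local Notation im := (@complex.Im _).

(** * The complex norm and exponential *)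

Section complex_norm.
Context {R : realType}.
Implicit Types (z w : R[i]) (x y : R).

Lemma normc_ge0 z : 0 <= normc z.
Proof. by case: z => a b; exact: sqrtr_ge0. Qed.

Lemma normcD z w : normc (z + w) <= normc z + normc w.
Proof. exact: le_normcD. Qed.

Lemma normcNE z : normc (- z) = normc z.
Proof. exact: normcN. Qed.

Lemma normcB z w : normc (z - w) <= normc z + normc w.
Proof. by rewrite (le_trans (normcD _ _))// normcNE. Qed.

Lemma normcR x : normc x%:C = `|x|.
Proof. by rewrite /= expr0n addr0 sqrtr_sqr. Qed.

Lemma normc_Re z : `|re z| <= normc z.
Proof.
by case: z => a b /=; rewrite -[leLHS]sqrtr_sqr ler_wsqrtr// lerDl sqr_ge0.
Qed.

Lemma normc_Im z : `|im z| <= normc z.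
Proof.
by case: z => a b /=; rewrite -[leLHS]sqrtr_sqr ler_wsqrtr// lerDr sqr_ge0.
Qed.

Lemma normc_le z : normc z <= `|re z| + `|im z|.
Proof.
case: z => a b /=; rewrite -[leRHS]ger0_norm ?addr_ge0// -sqrtr_sqr ler_wsqrtr//.
rewrite sqrrD !real_normK ?num_real//.
by have := mulr_ge0 (normr_ge0 a) (normr_ge0 b); lra.
Qed.

Lemma normcX z n : normc (z ^+ n) = normc z ^+ n.
Proof.
by elim: n => [|n IH]; rewrite ?expr0 ?normc1// !exprS normcM IH.
Qed.

Lemma normc_eq0P z : normc z = 0 -> z = 0.
Proof. exact: eq0_normc. Qed.

Lemma ReD z w : re (z + w) = re z + re w. Proof. by case: z; case: w. Qed.
Lemma ImD z w : im (z + w) = im z + im w. Proof. by case: z; case: w. Qed.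
Lemma ReN z : re (- z) = - re z. Proof. by case: z. Qed.
Lemma ImN z : im (- z) = - im z. Proof. by case: z. Qed.
Lemma ReM z w : re (z * w) = re z * re w - im z * im w.
Proof. by case: z; case: w. Qed.
Lemma ImM z w : im (z * w) = re z * im w + im z * re w.
Proof. by case: z; case: w. Qed.
Lemma ReMR z x : re (z * x%:C) = re z * x.
Proof. by rewrite ReM/= mulr0 subr0. Qed.
Lemma ImMR z x : im (z * x%:C) = im z * x.
Proof. by rewrite ImM/= mulr0 add0r. Qed.
Definition RIE := (ReD, ImD, ReN, ImN, ReM, ImM).

Lemma complex_ext z w : re z = re w -> im z = im w -> z = w.
Proof. by case: z => a b; case: w => c d /= -> ->. Qed.

End complex_norm.

(** * Elementary bounds for sine, cosine and exponential *)

Section real_bounds.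
Context {R : realType}.
Implicit Types (x y : R).

(** The min/max form leaves the endpoints unordered, so that the bounds below hold for [x] of either
    sign. *)
Lemma MVT_between (f df : R -> R) (a b : R) :
  (forall x, is_derive x 1 f (df x)) ->
  exists2 c, Order.min a b <= c <= Order.max a b & f b - f a = df c * (b - a).
Proof.
move=> fd; have cf (u v : R) : {within `[u, v]%classic, continuous f}.
  apply: continuous_subspaceT => x.
  by apply: differentiable_continuous; apply/derivable1_diffP; case: (fd x).
case: (leP a b) => ab.
  have [c + E] := MVT_segment ab (fun x _ => fd x) (cf a b).
  by rewrite in_itv/= => cab; exists c.
have [c + E] := MVT_segment (ltW ab) (fun x _ => fd x) (cf b a).
rewrite in_itv/= => cab; exists c => //.
by rewrite -[LHS]opprB E -mulrN opprB.
Qed.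

Lemma between_norm (b c : R) :
  Order.min 0 b <= c <= Order.max 0 b -> `|c| <= `|b|.
Proof.
by case: (leP 0 b) => b0 /andP[c1 c2];
  [rewrite !ger0_norm// (le_trans c1)|rewrite !ler0_norm ?lerN2// ltW].
Qed.

Lemma sin_norm_le x : `|sin x| <= `|x|.
Proof.
have [c _] := MVT_between 0 x (fun x => is_derive_sin x).
rewrite sin0 !subr0 => ->; rewrite normrM ler_piMl//; exact: cos_max.
Qed.

Lemma cos_norm_le x : `|cos x - 1| <= `|x|.
Proof.
have [c _] := MVT_between 0 x (fun x => is_derive_cos x).
rewrite cos0 subr0 => ->; rewrite normrM ler_piMl// normrN; exact: sin_max.
Qed.

Lemma cos_quadratic x : 1 - cos x <= x ^+ 2.
Proof.
have [c /between_norm cx] := MVT_between 0 x (fun x => is_derive_cos x).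
rewrite cos0 subr0 => /(congr1 (fun y => - y)); rewrite opprB => ->.
rewrite mulNr opprK (le_trans (ler_norm _))// normrM -[leRHS]real_normK ?num_real//.
by rewrite expr2 ler_pM// (le_trans (sin_norm_le _)).
Qed.

Lemma sin_quadratic x : `|sin x - x| <= x ^+ 2.
Proof.
have dsin y : is_derive y 1 (fun y => sin y - y) (cos y - 1).
  by apply: is_deriveB.
have [c /between_norm cx] := MVT_between 0 x dsin.
rewrite sin0 !subr0 => ->.
rewrite normrM -[leRHS]real_normK ?num_real// expr2 ler_pM//.
by rewrite (le_trans (cos_norm_le _)).
Qed.

Lemma expR_sub1 x : `|expR x - 1| <= `|x| * expR `|x|.
Proof.
have h1 := expR_ge1Dx x; have h2 := expR_ge1Dx (- x).
have [x0|x0] := leP 0 x.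
  have e1 : 1 <= expR x by lra.
  rewrite !ger0_norm ?subr_ge0//.
  rewrite expRN in h2.
  have := ler_wpM2r (expR_ge0 x) h2; rewrite mulVf ?gt_eqF ?expR_gt0//.
  lra.
have e1 : expR x <= 1 by rewrite expR_le1 ltW.
rewrite (ler0_norm (ltW x0)) ler0_norm ?subr_le0//.
have : - x <= - x * expR (- x) by rewrite ler_peMr//; lra.
lra.
Qed.

Lemma expR_quadratic x : `|expR x - 1 - x| <= x ^+ 2 * expR `|x|.
Proof.
rewrite ger0_norm; last by have := expR_ge1Dx x; lra.
apply: (@le_trans _ _ (x * (expR x - 1))).
  have := expR_ge1Dx (- x); rewrite expRN => h.
  have := ler_wpM2r (expR_ge0 x) h; rewrite mulVf ?gt_eqF ?expR_gt0//.
  lra.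
rewrite (le_trans (ler_norm _))// normrM -[x ^+ 2]real_normK ?num_real//.
by rewrite expr2 -mulrA ler_pM// expR_sub1.
Qed.

End real_bounds.

(** * The complex exponential and its Taylor remainders *)

Section Cexp_theory.
Context {R : realType}.
Implicit Types (z w : R[i]) (x y : R).

Lemma ReCexp z : re (Cexp z) = expR (re z) * cos (im z).
Proof. by rewrite /Cexp /= mul0r subr0. Qed.

Lemma ImCexp z : im (Cexp z) = expR (re z) * sin (im z).
Proof. by rewrite /Cexp /= mul0r addr0. Qed.

Lemma CexpD z w : Cexp (z + w) = Cexp z * Cexp w.
Proof.
apply: complex_ext; rewrite !(ReCexp, ImCexp, RIE) expRD ?cosD ?sinD; ring.
Qed.

Lemma Cexp0 : Cexp 0 = 1 :> R[i].
Proof.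
by apply: complex_ext; rewrite ?(ReCexp, ImCexp) /= expR0 ?cos0 ?sin0 mul1r.
Qed.

Lemma CexpR x : Cexp x%:C = (expR x)%:C.
Proof.
by apply: complex_ext; rewrite ?(ReCexp, ImCexp) /= ?cos0 ?sin0 ?mulr1 ?mulr0.
Qed.

Lemma normc_Cexp z : normc (Cexp z) = expR (re z).
Proof.
rewrite /Cexp normcM normcR ger0_norm ?expR_ge0// /=.
by rewrite cos2Dsin2 sqrtr1 mulr1.
Qed.

Lemma Cexp_neq0 z : Cexp z != 0.
Proof.
apply/eqP => /(congr1 (@normc R)); rewrite normc_Cexp normc0 => /eqP.
by rewrite gt_eqF// expR_gt0.
Qed.

Lemma CexpN z : Cexp (- z) = (Cexp z)^-1.
Proof.
apply: (mulIf (Cexp_neq0 z)); rewrite -CexpD addNr Cexp0 mulVf//.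
exact: Cexp_neq0.
Qed.

Lemma CexpB z w : Cexp (z - w) = Cexp z / Cexp w.
Proof. by rewrite CexpD CexpN. Qed.

Lemma sqr_Re_le z : (re z) ^+ 2 <= normc z ^+ 2.
Proof. by rewrite -real_normK ?num_real// lerXn2r ?nnegrE ?normc_ge0// normc_Re. Qed.

Lemma sqr_Im_le z : (im z) ^+ 2 <= normc z ^+ 2.
Proof. by rewrite -real_normK ?num_real// lerXn2r ?nnegrE ?normc_ge0// normc_Im. Qed.

(** Only [|re z|] enters the exponential, so the remainder stays quadratic however large [im z] is;
    along vertical lines the exponents to be expanded have unbounded imaginary part. The real and
    imaginary components contribute 2 each to the constant. *)
Lemma Cexp_quadratic z :
  normc (Cexp z - 1 - z) <= 4 * normc z ^+ 2 * expR `|re z|.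
Proof.
rewrite (le_trans (normc_le _))// !(ReCexp, ImCexp, RIE) /=.
have := sqr_Re_le z; have := sqr_Im_le z; have := normc_Re z; have := normc_Im z.
have := normc_ge0 z.
set a := re z; set b := im z; set n := normc z => n0 bn an b2 a2.
have e1 : 1 <= expR `|a| by rewrite -expR0 ler_expR.
have ea : expR a <= expR `|a| by rewrite ler_expR ler_norm.
have H1 : `|expR a * cos b - 1 - a| <= 2 * (n ^+ 2 * expR `|a|).
  have -> : expR a * cos b - 1 - a = (expR a - 1 - a) - expR a * (1 - cos b).
    by ring.
  rewrite (le_trans (ler_normB _ _))// [leRHS]mulr_natl [leRHS]mulr2n lerD//.
    by rewrite (le_trans (expR_quadratic _))// ler_wpM2r ?expR_ge0.
  rewrite normrM ger0_norm ?expR_ge0// ger0_norm ?subr_ge0 ?cos_le1// mulrC.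
  apply: ler_pM => //; rewrite ?subr_ge0 ?cos_le1 ?expR_ge0//.
  by rewrite (le_trans (cos_quadratic _)).
have H2 : `|expR a * sin b - 0 - b| <= 2 * (n ^+ 2 * expR `|a|).
  have -> : expR a * sin b - 0 - b = expR a * (sin b - b) + (expR a - 1) * b.
    by ring.
  rewrite (le_trans (ler_normD _ _))// [leRHS]mulr_natl [leRHS]mulr2n lerD//.
    rewrite normrM ger0_norm ?expR_ge0// mulrC.
    apply: ler_pM => //; rewrite ?expR_ge0//.
    by rewrite (le_trans (sin_quadratic _)).
  rewrite normrM (le_trans (ler_wpM2r _ (expR_sub1 _)))// mulrAC ler_wpM2r ?expR_ge0//.
  by rewrite expr2 ler_pM.
by rewrite (le_trans (lerD H1 H2))//; lra.
Qed.

Lemma Cexp_sub1 z : normc (Cexp z - 1) <= 3 * normc z * expR `|re z|.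
Proof.
rewrite (le_trans (normc_le _))// !(ReCexp, ImCexp, RIE) /=.
have := normc_Re z; have := normc_Im z; have := normc_ge0 z.
set a := re z; set b := im z; set n := normc z => n0 bn an.
have ea : expR a <= expR `|a| by rewrite ler_expR ler_norm.
have H1 : `|expR a * cos b - 1| <= 2 * (n * expR `|a|).
  have -> : expR a * cos b - 1 = (expR a - 1) + expR a * (cos b - 1) by ring.
  rewrite (le_trans (ler_normD _ _))// [leRHS]mulr_natl [leRHS]mulr2n lerD//.
    by rewrite (le_trans (expR_sub1 _))// ler_wpM2r ?expR_ge0.
  rewrite normrM ger0_norm ?expR_ge0// mulrC.
  apply: ler_pM => //; rewrite ?expR_ge0//.
  by rewrite (le_trans (cos_norm_le _)).
have H2 : `|expR a * sin b - 0| <= n * expR `|a|.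
  rewrite subr0 normrM ger0_norm ?expR_ge0// mulrC.
  by apply: ler_pM; rewrite ?expR_ge0// (le_trans (sin_norm_le _)).
by rewrite (le_trans (lerD H1 H2))//; lra.
Qed.

End Cexp_theory.

(** * Integration over the real line *)

Section substitution.
Context {R : realType}.
Notation mu := (@lebesgue_measure R).
Variables (g dg : R -> R).
Hypothesis g_incr : forall x y, x < y -> g x < g y.
Hypothesis g_der : forall x : R, is_derive x 1 g (dg x).
Hypothesis dg_cont : continuous dg.
Hypothesis dg_ge0 : forall x, 0 <= dg x.

Let cg : continuous g.
Proof.
by move=> x; apply: differentiable_continuous; apply/derivable1_diffP; case: (g_der x).
Qed.

Let dgE : derive1 g = dg.
Proof. by apply/funext => x; rewrite derive1E; case: (g_der x). Qed.

Let g_homo x y : x <= y -> g x <= g y.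
Proof. by rewrite le_eqVlt => /predU1P[->//|/g_incr/ltW]. Qed.

(** Compact images exhausting the range of [g]: substitution holds on each of them, and monotone
    convergence passes to the union. Hence nonnegative integrands come first. *)
Let F (n : nat) : set R := `[g (- n%:R), g n%:R]%classic.

Let F_subset n : F n `<=` range g.
Proof.
move=> y; rewrite /F/= in_itv/= => /andP[y1 y2].
have nn : - n%:R <= n%:R :> R by rewrite lerNl -subr_ge0 opprK addr_ge0.
have [||x _ <-] := @IVT R g (- n%:R) n%:R y nn.
- exact: continuous_subspaceT.
- by rewrite (min_l (g_homo nn)) (max_r (g_homo nn)) y1.
- by exists x.
Qed.

Let rangeE : range g = \bigcup_n F n.
Proof.
apply/seteqP; split => [_ [x _ <-]|y [n _ /F_subset]//].
exists (Num.truncn `|x|).+1 => //; rewrite /F/= in_itv/=.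
have h : `|x| <= (Num.truncn `|x|).+1%:R by rewrite ltW// truncnS_gt.
move: h; rewrite ler_norml => /andP[h1 h2].
by apply/andP; split; apply: g_homo.
Qed.

Let F_nd : nondecreasing_seq F.
Proof.
move=> m n mn; rewrite subsetEset => x; rewrite /F/= !in_itv/= => /andP[a b].
apply/andP; split; [apply: le_trans _ a|apply: le_trans b _];
  by apply: g_homo; rewrite ?lerN2 ler_nat.
Qed.

Variable G : R -> R.
Hypothesis cG : forall y, range g y -> {for y, continuous G}.

Let mG n : measurable_fun (F n) G.
Proof.
apply: subspace_continuous_measurable_fun; first exact: measurable_itv.
by apply: continuous_in_subspaceT => y; rewrite inE => /F_subset; exact: cG.
Qed.

Lemma measurable_range_fun : measurable_fun (range g) G.
Proof.
rewrite rangeE; apply/measurable_fun_bigcup => // i; exact: measurable_itv.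
Qed.

Lemma measurable_subst_fun : measurable_fun setT (fun x => G (g x) * dg x).
Proof.
apply: continuous_measurable_fun => x; apply: cvgM; last exact: dg_cont.
by apply: continuous_comp; [exact: cg | apply: cG; exists x].
Qed.

Lemma ge0_integral_subst : (forall y, range g y -> 0 <= G y) ->
  (\int[mu]_(y in range g) (G y)%:E = \int[mu]_x (G (g x) * dg x)%:E)%E.
Proof.
move=> G0.
have c1 : (\int[mu]_(y in F n) (G y)%:E @[n --> \oo] -->
    \int[mu]_(y in \bigcup_n F n) (G y)%:E)%E.
  apply: ge0_nondecreasing_set_cvg_integral => //.
  - by move=> n; exact: measurable_itv.
  - by move=> n; apply/measurable_EFinP; exact: mG.
  - by move=> n y /F_subset; exact: G0.
pose H (n : nat) : set R := `[(- n%:R)%R, n%:R%R]%classic.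
have H_nd : nondecreasing_seq H.
  move=> m n mn; rewrite subsetEset => x; rewrite /H/= !in_itv/= => /andP[a b].
  by rewrite (le_trans _ a) ?(le_trans b) ?lerN2 ?ler_nat.
have HT : \bigcup_n H n = setT.
  apply/seteqP; split => // x _; exists (Num.truncn `|x|).+1 => //.
  have h : `|x| <= (Num.truncn `|x|).+1%:R by rewrite ltW// truncnS_gt.
  by rewrite /H/= in_itv/= -ler_norml.
have c2 : (\int[mu]_(x in H n) (G (g x) * dg x)%:E @[n --> \oo] -->
    \int[mu]_(x in \bigcup_n H n) (G (g x) * dg x)%:E)%E.
  apply: ge0_nondecreasing_set_cvg_integral => //.
  - by move=> n; exact: measurable_itv.
  - by move=> n; apply/measurable_EFinP; apply: measurable_funTS; exact: measurable_subst_fun.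
  - by move=> n x _; rewrite lee_fin mulr_ge0// G0//; exists x.
rewrite HT -rangeE in c1 c2.
suff E : (fun n => \int[mu]_(y in F n) (G y)%:E)%E =
    (fun n => \int[mu]_(x in H n) (G (g x) * dg x)%:E)%E.
  by rewrite E in c1; exact: (cvg_unique _ c1 c2).
apply/funext => n; rewrite /F.
have nn : - n%:R <= n%:R :> R by rewrite lerNl -subr_ge0 opprK addr_ge0.
rewrite (@integration_by_substitution_increasing _ g G _ _ nn)//.
- by rewrite dgE.
- by move=> x y _ _; exact: g_incr.
- by rewrite dgE => x _; exact: dg_cont.
- by rewrite dgE; apply/cvg_ex; exists (dg (- n%:R)); apply: cvg_at_right_filter; exact: dg_cont.
- by rewrite dgE; apply/cvg_ex; exists (dg n%:R); apply: cvg_at_left_filter; exact: dg_cont.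
- split; first by move=> x _; case: (g_der x).
  + by apply: cvg_at_right_filter; exact: cg.
  + by apply: cvg_at_left_filter; exact: cg.
- by apply: continuous_in_subspaceT => y; rewrite inE => /F_subset; exact: cG.
Qed.

End substitution.

Section substitution_signed.
Context {R : realType}.
Notation mu := (@lebesgue_measure R).
Variables (g dg : R -> R).
Hypothesis g_incr : forall x y, x < y -> g x < g y.
Hypothesis g_der : forall x : R, is_derive x 1 g (dg x).
Hypothesis dg_cont : continuous dg.
Hypothesis dg_ge0 : forall x, 0 <= dg x.
Variable G : R -> R.
Hypothesis cG : forall y, range g y -> {for y, continuous G}.

(** Positive and negative parts are substituted separately, [dg_ge0] letting [dg] pass through the
    maximum with 0; the equality holds whether or not the integrals are finite. *)
Lemma integral_subst :
  (\int[mu]_(y in range g) (G y)%:E = \int[mu]_x (G (g x) * dg x)%:E)%E.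
Proof.
rewrite [LHS]integralE [RHS]integralE; congr (_ - _)%E.
  transitivity (\int[mu]_(y in range g) (Num.max (G y) 0)%:E)%E.
    by apply: eq_integral => y _; rewrite funeposE EFin_max.
  rewrite (@ge0_integral_subst _ g dg)//.
  - apply: eq_integral => x _; rewrite funeposE -EFin_max; congr EFin.
    by rewrite maxr_pMl// mul0r.
  - by move=> y yr; apply: continuous_max; [exact: cG|exact: cst_continuous].
  - by move=> y _; rewrite le_max lexx orbT.
transitivity (\int[mu]_(y in range g) (Num.max (- G y) 0)%:E)%E.
  by apply: eq_integral => y _; rewrite funenegE EFin_max EFinN.
rewrite (@ge0_integral_subst _ g dg)//.
- apply: eq_integral => x _; rewrite funenegE -EFinN -EFin_max; congr EFin.
  by rewrite maxr_pMl// mul0r mulNr.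
- move=> y yr; apply: continuous_max; last exact: cst_continuous.
  by apply: continuousN; exact: cG.
- by move=> y _; rewrite le_max lexx orbT.
Qed.

Lemma integrable_subst :
  mu.-integrable setT (fun x => (G (g x) * dg x)%:E) ->
  mu.-integrable (range g) (EFin \o G).
Proof.
move=> /integrableP[_ fin]; apply/integrableP; split.
  by apply/measurable_EFinP; exact: (@measurable_range_fun _ g dg).
rewrite /= (@ge0_integral_subst _ g dg g_incr g_der dg_cont dg_ge0 (fun y => `|G y|)).
- rewrite (le_lt_trans _ fin)// le_eqVlt; apply/orP; left; apply/eqP.
  by apply: eq_integral => x _; rewrite /= normrM (ger0_norm (dg_ge0 x)).
- by move=> y yr; apply: continuous_comp; [exact: cG|exact: norm_continuous].
- by [].
Qed.

End substitution_signed.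

(** * Measurability of complex-valued functions *)

Section measurability.
Context {R : realType} {d : measure_display} {T : measurableType d}.
Implicit Types (f g : T -> R[i]) (r : T -> R).

(** The domain is an arbitrary measurable type because Fubini needs the notion on [R * R]. *)
Definition Cmeas f := measurable_fun setT (fun t => re (f t)) /\
  measurable_fun setT (fun t => im (f t)).

Lemma CmeasD f g : Cmeas f -> Cmeas g -> Cmeas (fun t => f t + g t).
Proof.
move=> [f1 f2] [g1 g2]; split.
- by under eq_fun do rewrite ReD; exact: measurable_funD.
- by under eq_fun do rewrite ImD; exact: measurable_funD.
Qed.

Lemma CmeasM f g : Cmeas f -> Cmeas g -> Cmeas (fun t => f t * g t).
Proof.
move=> [f1 f2] [g1 g2]; split.
- under eq_fun do rewrite ReM.
  by apply: measurable_funB; exact: measurable_funM.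
- under eq_fun do rewrite ImM.
  by apply: measurable_funD; exact: measurable_funM.
Qed.

Lemma Cmeas_cst (c : R[i]) : Cmeas (fun=> c).
Proof. by split; exact: measurable_cst. Qed.

Lemma CmeasN f : Cmeas f -> Cmeas (fun t => - f t).
Proof.
move=> mf; under eq_fun do rewrite -mulN1r.
by apply: CmeasM => //; exact: Cmeas_cst.
Qed.

Lemma CmeasB f g : Cmeas f -> Cmeas g -> Cmeas (fun t => f t - g t).
Proof. by move=> mf mg; apply: CmeasD => //; exact: CmeasN. Qed.

Lemma CmeasR r : measurable_fun setT r -> Cmeas (fun t => (r t)%:C).
Proof. by split => //=; exact: measurable_cst. Qed.

Lemma Cmeas_exp f : Cmeas f -> Cmeas (fun t => Cexp (f t)).
Proof.
move=> [f1 f2].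
have me : measurable_fun setT (fun t => expR (re (f t))).
  exact: measurableT_comp (@measurable_expR R) f1.
split.
- under eq_fun do rewrite ReCexp; apply: measurable_funM => //.
  apply: measurableT_comp f2; apply: continuous_measurable_fun.
  exact: continuous_cos.
- under eq_fun do rewrite ImCexp; apply: measurable_funM => //.
  apply: measurableT_comp f2; apply: continuous_measurable_fun.
  exact: continuous_sin.
Qed.

End measurability.

Lemma Cmeas_comp {R : realType} {d d' : measure_display} {T : measurableType d}
    {T' : measurableType d'} (f : T -> R[i]) (g : T' -> T) :
  Cmeas f -> measurable_fun setT g -> Cmeas (f \o g).
Proof.
move=> [f1 f2] mg.
by split; [exact: (measurableT_comp f1)|exact: (measurableT_comp f2)].
Qed.

(** * Integrals of exponentially decaying functions *)

Section Cintegral_theory.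
Context {R : realType}.
Notation mu := (@lebesgue_measure R).
Implicit Types (f g : R -> R[i]) (C eta : R).

Definition Ccont f := continuous (fun t => re (f t)) /\
  continuous (fun t => im (f t)).

Lemma Ccont_meas f : Ccont f -> Cmeas f.
Proof. by move=> [? ?]; split; exact: continuous_measurable_fun. Qed.

(* All integrands below decay exponentially at both ends of the real line. *)
Definition edom C eta f := [/\ 0 < eta, Cmeas f &
  forall t, normc (f t) <= C * expR (- (eta * `|t|))].

Definition ebd f := exists C eta, edom C eta f.

Definition expmass eta := \int[mu]_t expR (- (eta * `|t|)).

(** By evenness the integral is twice that over the half-line, where the integrand is [eta^-1] times
    the density of the exponential law. *)
Lemma integrable_expabs eta : 0 < eta ->
  mu.-integrable setT (fun t => (expR (- (eta * `|t|)))%:E).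
Proof.
move=> e0; have ce : continuous (fun t : R => expR (- (eta * `|t|))).
  move=> x; apply: continuous_comp; last exact: continuous_expR.
  by apply: cvgN; apply: cvgMr; exact: norm_continuous.
apply/integrableP; split.
  by apply/measurable_EFinP; exact: continuous_measurable_fun.
under eq_integral do rewrite gee0_abs ?lee_fin ?expR_ge0//.
rewrite ge0_symfun_integralT//=.
- rewrite -set_itvcy lte_mul_pinfty//.
  apply: (@le_lt_trans _ _ (\int[mu]_(x in `[0%R, +oo[) (eta^-1 * exponential_pdf eta x)%:E)%E).
    rewrite le_eqVlt; apply/orP; left; apply/eqP; apply: eq_integral => x.
    rewrite inE/= in_itv/= andbT => x0; rewrite exponential_pdfE// ger0_norm//.
    by rewrite mulrA mulVf ?gt_eqF// mul1r mulNr.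
  have /integrableP[m] : mu.-integrable (`[0%R, +oo[%classic : set R)
      (fun x => (eta^-1 * exponential_pdf eta x)%:E).
    apply: (@integrableS _ _ _ mu setT) => //=.
    under eq_fun do rewrite EFinM.
    by apply: integrableZl => //; exact: integrable_exponential_pdf.
  apply: le_lt_trans; apply: ge0_le_integral => //=.
  - move=> x _; rewrite lee_fin mulr_ge0 ?invr_ge0 ?(ltW e0)//.
    by apply: exponential_pdf_ge0; exact: ltW.
  - apply/measurable_EFinP; apply: measurableT_comp => //.
    exact/measurable_EFinP.
  - by move=> x _; rewrite lee_fin ler_norm.
- by move=> x; rewrite /= normrN.
Qed.

Lemma edom_integrable C eta f : edom C eta f -> Cintegrable setT f.
Proof.
move=> [e0 [m1 m2] H].
have I : mu.-integrable setT (fun t => (C * expR (- (eta * `|t|)))%:E).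
  under eq_fun do rewrite EFinM.
  by apply: integrableZl => //; exact: integrable_expabs.
split; apply: le_integrable I => //; try exact/measurable_EFinP.
- move=> t _; rewrite lee_fin (le_trans (normc_Re _))// (le_trans (H t))//.
  exact: ler_norm.
- move=> t _; rewrite lee_fin (le_trans (normc_Im _))// (le_trans (H t))//.
  exact: ler_norm.
Qed.

Lemma ebd_integrable f : ebd f -> Cintegrable setT f.
Proof. by move=> [C [eta /edom_integrable]]. Qed.

Lemma Rintegral_edom C eta (r : R -> R) : 0 < eta -> measurable_fun setT r ->
  (forall t, `|r t| <= C * expR (- (eta * `|t|))) ->
  `| \int[mu]_t r t | <= C * expmass eta.
Proof.
move=> e0 mr H.
have I : mu.-integrable setT (EFin \o (fun t => C * expR (- (eta * `|t|)))).
  rewrite (_ : EFin \o _ = fun t => (C%:E * (expR (- (eta * `|t|)))%:E)%E)//.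
  by apply: integrableZl => //; exact: integrable_expabs.
have Ir : mu.-integrable setT (EFin \o r).
  apply: le_integrable I => //; first exact/measurable_EFinP.
  by move=> t _; rewrite lee_fin (le_trans (H t))// ler_norm.
rewrite (le_trans (le_normr_Rintegral _ Ir))//.
rewrite /expmass -RintegralZl//; last exact: integrable_expabs.
apply: le_Rintegral => //.
have := integrable_norm Ir; exact.
Qed.

(** The factor 2 comes from bounding the real and imaginary parts separately. *)
Lemma normc_Cintegral C eta f : edom C eta f ->
  normc (Cintegral setT f) <= 2 * C * expmass eta.
Proof.
move=> [e0 [m1 m2] H]; rewrite (le_trans (normc_le _))//=.
rewrite -mulrA [leRHS]mulr_natl [leRHS]mulr2n lerD//; apply: Rintegral_edom => // t.
- by rewrite (le_trans (normc_Re _)).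
- by rewrite (le_trans (normc_Im _)).
Qed.

Lemma expmass_ge0 eta : 0 <= expmass eta.
Proof. by apply: Rintegral_ge0 => t _; exact: expR_ge0. Qed.

Lemma ebd_meas f : ebd f -> Cmeas f.
Proof. by move=> [C [eta []]]. Qed.

Lemma CintegralD f g : ebd f -> ebd g ->
  Cintegral setT (fun t => f t + g t) = Cintegral setT f + Cintegral setT g.
Proof.
move=> /ebd_integrable[f1 f2] /ebd_integrable[g1 g2].
apply: complex_ext; rewrite RIE /=.
- by under eq_Rintegral do rewrite ReD; rewrite RintegralD.
- by under eq_Rintegral do rewrite ImD; rewrite RintegralD.
Qed.

Lemma CintegralZ f (c : R[i]) : ebd f ->
  Cintegral setT (fun t => c * f t) = c * Cintegral setT f.
Proof.
move=> /ebd_integrable[f1 f2].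
have Z (x : R) (r : R -> R) : mu.-integrable setT (EFin \o r) ->
    mu.-integrable setT (EFin \o (fun t => x * r t)).
  move=> Ir; rewrite (_ : _ \o _ = fun t => (x%:E * (EFin \o r) t)%E)//.
  exact: integrableZl.
apply: complex_ext; rewrite RIE /=.
- under eq_Rintegral do rewrite ReM.
  by rewrite RintegralB ?RintegralZl//; exact: Z.
- under eq_Rintegral do rewrite ImM.
  by rewrite RintegralD ?RintegralZl//; exact: Z.
Qed.

Lemma ebdD f g : ebd f -> ebd g -> ebd (fun t => f t + g t).
Proof.
move=> [C [e [e0 mf Hf]]] [D [e' [e'0 mg Hg]]].
exists (`|C| + `|D|), (Num.min e e'); split.
- by rewrite lt_min e0.
- exact: CmeasD.
move=> t; rewrite (le_trans (normcD _ _))// mulrDl lerD//.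
- rewrite (le_trans (Hf t))// (le_trans (ler_wpM2r (expR_ge0 _) (ler_norm C)))//.
  by rewrite ler_wpM2l// ler_expR lerN2 ler_wpM2r// ge_min lexx.
- rewrite (le_trans (Hg t))// (le_trans (ler_wpM2r (expR_ge0 _) (ler_norm D)))//.
  by rewrite ler_wpM2l// ler_expR lerN2 ler_wpM2r// ge_min lexx orbT.
Qed.

Lemma ebdZ f (c : R[i]) : ebd f -> ebd (fun t => c * f t).
Proof.
move=> [C [e [e0 mf Hf]]]; exists (normc c * C), e; split => //.
  by apply: CmeasM => //; exact: Cmeas_cst.
by move=> t; rewrite normcM -mulrA ler_wpM2l// normc_ge0.
Qed.

Lemma ebdN f : ebd f -> ebd (fun t => - f t).
Proof. by move=> /(ebdZ (- 1)); under eq_fun do rewrite mulN1r. Qed.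

Lemma ebdB f g : ebd f -> ebd g -> ebd (fun t => f t - g t).
Proof. by move=> ? ?; apply: ebdD => //; exact: ebdN. Qed.

Lemma CintegralB f g : ebd f -> ebd g ->
  Cintegral setT (fun t => f t - g t) = Cintegral setT f - Cintegral setT g.
Proof.
move=> bf bg; rewrite CintegralD//; last exact: ebdN.
rewrite -[- Cintegral _ g]mulN1r -CintegralZ//; congr (_ + Cintegral _ _).
by apply/funext => t; rewrite mulN1r.
Qed.

Lemma range_shift (h : R) : range (fun t : R => t + h) = setT.
Proof. by apply/seteqP; split => // x _; exists (x - h); rewrite ?subrK. Qed.

Lemma Rintegral_translate (r : R -> R) (h : R) : continuous r ->
  \int[mu]_t r (t + h) = \int[mu]_t r t.
Proof.
move=> cr; rewrite /Rintegral; congr fine.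
transitivity (\int[mu]_(t in range (fun t : R => (t + h)%R)) (r t)%:E)%E;
  last by rewrite range_shift.
have D (x : R) : is_derive x 1 (fun t : R => t + h) 1.
  by rewrite -[1 in X in is_derive _ _ _ X]addr0; apply: is_deriveD.
rewrite (@integral_subst _ (fun t => t + h) (fun=> 1) _ _ _ _ r (fun y _ => cr y))//.
- by apply: eq_integral => t _; rewrite mulr1.
- by move=> x y xy; rewrite ltrD2r.
- by move=> x; exact: cst_continuous.
Qed.

Lemma Cintegral_translate f (h : R) : Ccont f ->
  Cintegral setT (fun t => f (t + h)) = Cintegral setT f.
Proof.
by move=> [c1 c2]; apply: complex_ext => /=;
  rewrite (@Rintegral_translate (fun t => _ (f t))).
Qed.

(** The product domination bounds the absolute double integral by a multiple of [expmass eta]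
    squared, which gives integrability for the product measure; the two components then both go
    through the real statement [W]. *)
Lemma Cintegral_Fubini (f : R -> R -> R[i]) (C eta : R) : 0 < eta ->
  Cmeas (fun p : R * R => f p.1 p.2) ->
  (forall u v, normc (f u v) <=
     C * (expR (- (eta * `|u|)) * expR (- (eta * `|v|)))) ->
  Cintegral setT (fun u => Cintegral setT (f u)) =
  Cintegral setT (fun v => Cintegral setT (f^~ v)).
Proof.
move=> e0 [m1 m2] H.
have E (u : R) : (\int[mu]_v `|(C * (expR (- (eta * `|u|)) * expR (- (eta * `|v|))))%:E| <=
    (`|C| * expmass eta * expR (- (eta * `|u|)))%:E)%E.
  under eq_integral => v _.
    rewrite abse_EFin 2!normrM (ger0_norm (expR_ge0 (- (eta * `|u|)))).
    rewrite (ger0_norm (expR_ge0 (- (eta * `|v|)))) mulrA EFinM; over.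
  rewrite integralZl//; last exact: integrable_expabs.
  rewrite [X in (_ <= X%:E)%E]mulrAC [in leRHS]EFinM /expmass /Rintegral fineK//.
  by apply: integrable_fin_num => //; exact: integrable_expabs.
have W (r : R * R -> R) : measurable_fun setT r ->
    (forall u v, `|r (u, v)| <= C * (expR (- (eta * `|u|)) * expR (- (eta * `|v|)))) ->
    \int[mu]_u \int[mu]_v r (u, v) = \int[mu]_v \int[mu]_u r (u, v).
  move=> mr Hr.
  have I u : mu.-integrable setT (fun v => (r (u, v))%:E).
    have J : mu.-integrable setT (fun v => ((C * expR (- (eta * `|u|))) * expR (- (eta * `|v|)))%:E).
      under eq_fun do rewrite EFinM.
      by apply: integrableZl => //; exact: integrable_expabs.
    apply: le_integrable J => //.
      apply/measurable_EFinP; exact: (measurableT_comp mr (pair1_measurable u)).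
    by move=> v _; rewrite lee_fin (le_trans (Hr _ _))// mulrA ler_norm.
  have I' v : mu.-integrable setT (fun u => (r (u, v))%:E).
    have J : mu.-integrable setT (fun u => ((C * expR (- (eta * `|v|))) * expR (- (eta * `|u|)))%:E).
      under eq_fun do rewrite EFinM.
      by apply: integrableZl => //; exact: integrable_expabs.
    apply: le_integrable J => //.
      apply/measurable_EFinP; exact: (measurableT_comp mr (pair2_measurable v)).
    by move=> u _; rewrite lee_fin (le_trans (Hr _ _))// [X in C * X]mulrC mulrA ler_norm.
  have mEr : measurable_fun setT (EFin \o r) by exact/measurable_EFinP.
  have P : (mu \x mu)%E.-integrable setT (EFin \o r).
    apply/(integrable12ltyP mu mu mEr).
    apply: (@le_lt_trans _ _ (\int[mu]_u (`|C| * expmass eta * expR (- (eta * `|u|)))%:E)%E).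
      apply: ge0_le_integral => //=.
      - by move=> u _; exact: integral_ge0.
      - apply: (measurable_fun_fubini_tonelli_F (m2 := mu) (fun p => `|(r p)%:E|%E)) => //.
        exact: measurableT_comp.
      - apply/measurable_EFinP; apply: measurable_funM => //.
        by have /integrableP[/measurable_EFinP] := integrable_expabs e0.
      - move=> u _; apply: (le_trans _ (E u)); apply: ge0_le_integral => //=.
        + apply/measurable_EFinP; apply: measurableT_comp => //.
          exact: (measurableT_comp mr (pair1_measurable u)).
        + apply/measurable_EFinP; apply: measurableT_comp => //.
          apply: measurable_funM => //; apply: measurable_funM => //.
          by have /integrableP[/measurable_EFinP] := integrable_expabs e0.
        + by move=> v _; rewrite lee_fin (le_trans (Hr _ _))// ler_norm.
    under eq_integral do rewrite EFinM.
    rewrite integralZl//; last exact: integrable_expabs.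
    have L : (\int[mu]_t (expR (- (eta * `|t|)))%:E < +oo)%E.
      by apply: integrable_lty => //; exact: integrable_expabs.
    by rewrite lte_mul_pinfty// lee_fin mulr_ge0// expmass_ge0.
  have Fu (u : R) : (\int[mu]_v r (u, v))%:E = (\int[mu]_v (r (u, v))%:E)%E.
    by rewrite fineK//; apply: integrable_fin_num.
  have Fv (v : R) : (\int[mu]_u r (u, v))%:E = (\int[mu]_u (r (u, v))%:E)%E.
    by rewrite fineK//; apply: integrable_fin_num.
  rewrite /Rintegral -/(Rintegral _ _ _); congr fine.
  transitivity (\int[mu]_u \int[mu]_v (r (u, v))%:E)%E.
    by apply: eq_integral => u _; exact: Fu.
  rewrite (Fubini P); apply: eq_integral => v _; exact/esym/Fv.
apply: complex_ext => /=.
- apply: (W (fun p => re (f p.1 p.2))) => // u v.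
  by rewrite (le_trans (normc_Re _)).
- apply: (W (fun p => im (f p.1 p.2))) => // u v.
  by rewrite (le_trans (normc_Im _)).
Qed.

End Cintegral_theory.

(** * Holomorphy with exponential bounds on vertical strips *)

Section strip_class.
Context {R : realType}.
Implicit Types (F G : R[i] -> R[i]) (a b rho x y : R) (s h : R[i]).

(* [hol F a b rho]: on the closed strip [a <= Re s <= b], [F] is complex
   differentiable with a quadratic remainder, and [F], its derivative [A] and the
   remainder constant are all O(expR (rho * |Im s|)).  The quadratic remainder
   replaces differentiation under the integral sign everywhere below. *)
Definition hol F a b rho := exists C d, [/\ 0 <= C, 0 < d <= 1 &
  forall s, a <= re s <= b ->
    normc (F s) <= C * expR (rho * `|im s|) /\
    exists A, normc A <= C * expR (rho * `|im s|) /\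
      forall h, normc h <= d -> normc (F (s + h) - F s - h * A) <=
        C * normc h ^+ 2 * expR (rho * `|im s|)].

Lemma hol_le F a b rho a' b' rho' : a <= a' -> b' <= b -> rho <= rho' ->
  hol F a b rho -> hol F a' b' rho'.
Proof.
move=> aa bb rr [C [d [C0 d0 H]]]; exists C, d; split => // s /andP[s1 s2].
have e : expR (rho * `|im s|) <= expR (rho' * `|im s|).
  by rewrite ler_expR ler_wpM2r.
have [|H1 [A [HA Hr]]] := H s; first by rewrite (le_trans aa) ?(le_trans s2).
split; first by rewrite (le_trans H1)// ler_wpM2l.
exists A; split => [|h hd]; first by rewrite (le_trans HA)// ler_wpM2l.
by rewrite (le_trans (Hr h hd))// ler_wpM2l// mulr_ge0// exprn_ge0// normc_ge0.
Qed.

(** Since [normc h <= d <= 1], the quadratic remainder is itself at most linear in [h]; it and the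
    derivative term contribute [K] each. *)
Lemma hol_near (A E E0 : R[i]) h (K d : R) : 0 <= K -> d <= 1 ->
  normc h <= d -> normc A <= K -> normc (E - E0 - h * A) <= K * normc h ^+ 2 ->
  normc (E - E0) <= 2 * K * normc h.
Proof.
move=> K0 d1 hd HA H.
have -> : E - E0 = (E - E0 - h * A) + h * A by ring.
rewrite (le_trans (normcD _ _))// normcM.
have h0 := normc_ge0 h; have h1 : normc h <= 1 by rewrite (le_trans hd).
have : K * normc h ^+ 2 <= K * normc h by rewrite ler_wpM2l// expr2 ler_piMl.
have : normc h * normc A <= normc h * K by rewrite ler_wpM2l.
lra.
Qed.

Lemma hol_mul F G a b rho sig : hol F a b rho -> hol G a b sig ->
  hol (fun s => F s * G s) a b (rho + sig).
Proof.
move=> [C [d [C0 /andP[d0 d1] HF]]] [D [d' [D0 /andP[d'0 d'1] HG]]].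
(* The two remainders cost 1 each and the product of the two increments, bounded by [hol_near],
   costs 2 * 2; so 6 is enough, and 9 leaves slack. *)
exists (9 * (C * D)), (Num.min d d'); split.
- by rewrite !mulr_ge0.
- by rewrite lt_min d0 d'0 ge_min d1.
move=> s sab; have [F0 [A [HA Fr]]] := HF s sab.
have [G0 [B [HB Gr]]] := HG s sab.
rewrite (mulrDl rho) expRD; move: F0 HA Fr G0 HB Gr.
set e := expR (rho * _); set e' := expR (sig * _).
have e0 : 0 <= e by exact: expR_ge0.
have e'0 : 0 <= e' by exact: expR_ge0.
move=> F0 HA Fr G0 HB Gr.
have Ce0 : 0 <= C * e by exact: mulr_ge0.
have De0 : 0 <= D * e' by exact: mulr_ge0.
have P0 := mulr_ge0 Ce0 De0.
have FG : normc (F s) * normc (G s) <= (C * e) * (D * e') by rewrite ler_pM ?normc_ge0.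
have AG : normc A * normc (G s) <= (C * e) * (D * e') by rewrite ler_pM ?normc_ge0.
have FB : normc (F s) * normc B <= (C * e) * (D * e') by rewrite ler_pM ?normc_ge0.
split.
  by rewrite normcM; lra.
exists (A * G s + F s * B); split.
  by rewrite (le_trans (normcD _ _))// !normcM; lra.
move=> h; rewrite le_min => /andP[hd hd'].
have {}Fr : normc (F (s + h) - F s - h * A) <= C * e * normc h ^+ 2.
  by rewrite (le_trans (Fr h hd))// mulrAC.
have {}Gr : normc (G (s + h) - G s - h * B) <= D * e' * normc h ^+ 2.
  by rewrite (le_trans (Gr h hd'))// mulrAC.
have Fd := hol_near Ce0 d1 hd HA Fr.
have Gd := hol_near De0 d'1 hd' HB Gr.
set n := normc h in Fr Gr Fd Gd *.
have n0 : 0 <= n by exact: normc_ge0.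
have n1 : n <= 1 by rewrite (le_trans hd).
have -> : F (s + h) * G (s + h) - F s * G s - h * (A * G s + F s * B) =
   (F (s + h) - F s - h * A) * G s + F s * (G (s + h) - G s - h * B)
   + (F (s + h) - F s) * (G (s + h) - G s) by ring.
have T1 : normc ((F (s + h) - F s - h * A) * G s) <= (C * e * n ^+ 2) * (D * e').
  by rewrite normcM ler_pM ?normc_ge0.
have T2 : normc (F s * (G (s + h) - G s - h * B)) <= (C * e) * (D * e' * n ^+ 2).
  by rewrite normcM ler_pM ?normc_ge0.
have T3 : normc ((F (s + h) - F s) * (G (s + h) - G s)) <=
   (2 * (C * e) * n) * (2 * (D * e') * n).
  by rewrite normcM ler_pM ?normc_ge0.
have Q : 0 <= (C * e) * (D * e') * n ^+ 2 by rewrite mulr_ge0// exprn_ge0.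
rewrite (le_trans (normcD _ _))// (le_trans (lerD (normcD _ _) T3))//.
rewrite (le_trans (lerD (lerD T1 T2) (lexx _)))//.
have -> : 9 * (C * D) * n ^+ 2 * (e * e') = 9 * ((C * e) * (D * e') * n ^+ 2) by ring.
have -> : C * e * n ^+ 2 * (D * e') + C * e * (D * e' * n ^+ 2) +
  2 * (C * e) * n * (2 * (D * e') * n) = 6 * ((C * e) * (D * e') * n ^+ 2) by ring.
lra.
Qed.

Lemma hol_cst (c : R[i]) a b : hol (fun=> c) a b 0.
Proof.
exists (normc c), 1; split => //; rewrite ?normc_ge0 ?ltr01 ?lexx// => s _.
rewrite mul0r expR0 mulr1; split => //; exists 0; split.
  by rewrite normc0 normc_ge0.
move=> h _; rewrite subrr mulr0 subr0 normc0 mulr1 mulr_ge0 ?exprn_ge0//;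
exact: normc_ge0.
Qed.

Lemma ler_expR_lin (e y : R) : 0 < e -> y <= e^-1 * expR (e * y).
Proof.
move=> e0; rewrite -(ler_pM2l e0) mulrA mulfV ?gt_eqF// mul1r.
by have := expR_ge1Dx (e * y); lra.
Qed.

(** Linear growth is absorbed by an exponential rate [e] as small as desired. This is how the
    polynomial factors of the Gamma recurrence are paid for. *)
Lemma hol_id a b e : 0 < e -> hol id a b e.
Proof.
move=> e0; exists (`|a| + `|b| + 1 + e^-1), 1; split.
- by rewrite !addr_ge0// invr_ge0 ltW.
- by rewrite ltr01 lexx.
move=> s /andP[s1 s2].
have E1 : 1 <= expR (e * `|im s|) by rewrite -expR0 ler_expR mulr_ge0// ltW.
have ab0 : 0 <= `|a| + `|b| by rewrite addr_ge0.
have P : (`|a| + `|b| + 1) <= (`|a| + `|b| + 1) * expR (e * `|im s|).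
  by rewrite ler_peMr// addr_ge0.
have Q := ler_expR_lin `|im s| e0.
have I0 : 0 <= e^-1 * expR (e * `|im s|) by rewrite mulr_ge0 ?expR_ge0// invr_ge0 ltW.
split.
  rewrite mulrDl (le_trans (normc_le _))// lerD// (le_trans _ P)//.
  rewrite ler_norml; have := ler_norm b.
  have := normr_ge0 a; have := normr_ge0 b.
  by have := ler_norm (- a); rewrite normrN => *; apply/andP; split; lra.
exists 1; split; first by rewrite normc1 mulrDl; lra.
move=> h _; rewrite mulr1.
have -> : s + h - s - h = 0 by ring.
by rewrite normc0 !mulr_ge0 ?expR_ge0 ?exprn_ge0 ?normc_ge0// !addr_ge0// invr_ge0 ltW.
Qed.

Lemma hol_affine F a b rho (e : R[i]) (k : R) : 0 < k ->
  hol F (re e - k * b) (re e - k * a) rho ->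
  hol (fun s => F (e - k%:C * s)) a b (k * rho).
Proof.
move=> k0 [C [d [C0 /andP[d0 d1] H]]].
pose M := expR (`|rho| * `|im e|).
have M0 : 0 <= M by exact: expR_ge0.
(* The summands 1, [k] and [k ^+ 2] pay for the value, the derivative and the remainder. [M] pays
   for the offset [im e]; it uses [|rho|] because [rho] may be negative. *)
exists (C * M * (1 + k + k ^+ 2)), (d / (1 + k)); split.
- by rewrite !mulr_ge0// !addr_ge0// ?exprn_ge0// ltW.
- have k1 : 0 < 1 + k by rewrite addr_gt0.
  rewrite divr_gt0//= ler_pdivrMr// mul1r (le_trans d1)// lerDl ltW//.
move=> s /andP[s1 s2].
have rs : re (e - k%:C * s) = re e - k * re s by rewrite !RIE/=; ring.
have ims : im (e - k%:C * s) = im e - k * im s by rewrite !RIE/=; ring.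
have [|F0 [A [HA Fr]]] := H (e - k%:C * s).
  by rewrite rs !lerD2l !lerN2 !ler_pM2l// s1 s2.
have E : expR (rho * `|im (e - k%:C * s)|) <= M * expR (k * rho * `|im s|).
  rewrite -expRD ler_expR ims.
  have B : `| `|im e - k * im s| - k * `|im s| | <= `|im e|.
    have <- : `|- (k * im s)| = k * `|im s| by rewrite normrN normrM gtr0_norm.
    by rewrite (le_trans (ler_dist_dist _ _))// opprK subrK.
  have : rho * (`|im e - k * im s| - k * `|im s|) <= `|rho| * `|im e|.
    by rewrite (le_trans (ler_norm _))// normrM ler_wpM2l.
  lra.
set e1 := expR (k * rho * _) in E *.
have e10 : 0 <= e1 by exact: expR_ge0.
have kk : 0 <= k ^+ 2 by rewrite exprn_ge0// ltW.
have CM : 0 <= C * M by exact: mulr_ge0.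
have CMe := mulr_ge0 CM e10.
have CE : C * expR (rho * `|im (e - k%:C * s)|) <= C * M * e1.
  by rewrite -mulrA ler_wpM2l.
have X1 : 0 <= C * M * e1 * k by rewrite mulr_ge0// ltW.
have X2 : 0 <= C * M * e1 * k ^+ 2 by rewrite mulr_ge0.
have XE : C * M * (1 + k + k ^+ 2) * e1 = C * M * e1 + C * M * e1 * k + C * M * e1 * k ^+ 2.
  by ring.
split.
  by rewrite (le_trans F0)// (le_trans CE)// XE; lra.
exists (- k%:C * A); split.
  rewrite XE normcM normcNE normcR gtr0_norm//.
  have : k * normc A <= k * (C * M * e1).
    by rewrite ler_pM2l// (le_trans HA).
  lra.
move=> h hd.
have nkh : normc (- (k%:C * h)) = k * normc h.
  by rewrite normcNE normcM normcR gtr0_norm.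
have := Fr (- (k%:C * h)).
have -> : e - k%:C * s + - (k%:C * h) = e - k%:C * (s + h) by ring.
have -> : - (k%:C * h) * A = h * (- k%:C * A) by ring.
rewrite nkh => H1.
apply: (le_trans (H1 _)).
  have k1 : 0 < 1 + k by rewrite addr_gt0.
  move: hd; rewrite ler_pdivlMr// mulrDr mulr1.
  by have := normc_ge0 h; lra.
have -> : C * M * (1 + k + k ^+ 2) * normc h ^+ 2 * e1 =
  (C * M * (1 + k + k ^+ 2) * e1) * normc h ^+ 2 by ring.
rewrite mulrAC exprMn XE.
have h2 : 0 <= normc h ^+ 2 by rewrite exprn_ge0// normc_ge0.
have -> : C * expR (rho * `|im (e - k%:C * s)|) * (k ^+ 2 * normc h ^+ 2) =
  (C * expR (rho * `|im (e - k%:C * s)|) * k ^+ 2) * normc h ^+ 2 by ring.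
apply: ler_wpM2r => //.
have : C * expR (rho * `|im (e - k%:C * s)|) * k ^+ 2 <= C * M * e1 * k ^+ 2.
  exact: ler_wpM2r.
lra.
Qed.

(** For real [l] the modulus depends on [re s] alone, hence the rate 0. *)
Lemma hol_exp (l : R) a b : hol (fun s => Cexp (l%:C * s)) a b 0.
Proof.
pose M := expR (`|l| * (`|a| + `|b|)).
have M0 : 0 <= M by exact: expR_ge0.
pose K := 1 + `|l| + 4 * `|l| ^+ 2 * expR `|l|.
have K1 : 0 <= 4 * `|l| ^+ 2 * expR `|l| by rewrite !mulr_ge0 ?expR_ge0// exprn_ge0.
have K0 : 0 <= K by rewrite !addr_ge0.
exists (M * K), 1; split; rewrite ?ltr01 ?lexx ?mulr_ge0//.
move=> s /andP[s1 s2]; rewrite mul0r expR0 !mulr1.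
have ns : normc (Cexp (l%:C * s)) <= M.
  rewrite normc_Cexp ler_expR !RIE/= mul0r subr0.
  rewrite (le_trans (ler_norm _))// normrM ler_wpM2l//.
  rewrite ler_norml; have := ler_norm b.
  have := normr_ge0 a; have := normr_ge0 b.
  by have := ler_norm (- a); rewrite normrN => *; apply/andP; split; lra.
have l0 := normr_ge0 l.
have MK1 : 0 <= M * `|l| by exact: mulr_ge0.
have MK2 : 0 <= M * (4 * `|l| ^+ 2 * expR `|l|) by exact: mulr_ge0.
have KE : M * K = M + M * `|l| + M * (4 * `|l| ^+ 2 * expR `|l|).
  by rewrite /K; ring.
split; first by rewrite (le_trans ns)// KE; lra.
exists (l%:C * Cexp (l%:C * s)); split.
  rewrite normcM normcR KE.
  have : `|l| * normc (Cexp (l%:C * s)) <= `|l| * M by rewrite ler_wpM2l.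
  lra.
move=> h h1; rewrite mulr1.
have -> : Cexp (l%:C * (s + h)) - Cexp (l%:C * s) - h * (l%:C * Cexp (l%:C * s)) =
  Cexp (l%:C * s) * (Cexp (l%:C * h) - 1 - l%:C * h).
  by rewrite mulrDr CexpD; ring.
rewrite normcM.
have R1 := Cexp_quadratic (l%:C * h).
have R2 : normc (Cexp (l%:C * h) - 1 - l%:C * h) <=
    (4 * `|l| ^+ 2 * expR `|l|) * normc h ^+ 2.
  rewrite (le_trans R1)// normcM normcR exprMn.
  have -> : (4 * `|l| ^+ 2 * expR `|l|) * normc h ^+ 2 = 4 * (`|l| ^+ 2 * normc h ^+ 2) * expR `|l| by ring.
  apply: ler_wpM2l; first by rewrite !mulr_ge0// ?exprn_ge0// ?normc_ge0.
  rewrite ler_expR !RIE/= mul0r subr0 normrM ler_piMr//.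
  by rewrite (le_trans (normc_Re _)).
have := ler_pM (normc_ge0 _) (normc_ge0 _) ns R2.
move/le_trans; apply; rewrite mulrA ler_wpM2r ?exprn_ge0 ?normc_ge0// KE; lra.
Qed.

(** The worst part of the remainder is [h * A * (F (s + h) - F s)] over [F s ^+ 2 * F (s + h)], of
    rate [2 * rho + 3 * tau]. By [0 <= rho + tau] this dominates the rates [tau] of the value and
    [rho + 2 * tau] of the derivative. The lower bound is asked on a wider strip because [F (s + h)]
    is inverted too. *)
Lemma hol_inv F a b rho tau c eta : 0 <= tau -> 0 <= rho + tau -> 0 < c -> 0 < eta ->
  hol F a b rho ->
  (forall s, a - eta <= re s <= b + eta -> c * expR (- (tau * `|im s|)) <= normc (F s)) ->
  hol (fun s => (F s)^-1) a b (2 * rho + 3 * tau).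
Proof.
move=> t0 rt c0 eta0 [C [d [C0 /andP[d0 d1] H]]] L.
(* The factor [expR tau] covers the unit by which [|im (s + h)|] may exceed [|im s|]. *)
pose D := c^-1 * expR tau.
have c1 : 0 < c^-1 by rewrite invr_gt0.
have et1 : 1 <= expR tau by rewrite -expR0 ler_expR.
have D0 : 0 < D by rewrite mulr_gt0// expR_gt0.
pose K := D + C * D ^+ 2 + 3 * C ^+ 2 * D ^+ 3 + C * D ^+ 2.
have KD1 : 0 <= C * D ^+ 2 by rewrite mulr_ge0// exprn_ge0// ltW.
have KD2 : 0 <= 3 * C ^+ 2 * D ^+ 3 by rewrite !mulr_ge0// ?exprn_ge0// ltW.
have K0 : 0 <= K by rewrite !addr_ge0// ltW.
exists K, (Num.min d eta); split => //.
  by rewrite lt_min d0 eta0 ge_min d1.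
move=> s /andP[s1 s2].
have [|F0 [A [HA Fr]]] := H s; first by rewrite s1 s2.
set y := `|im s| in F0 HA Fr *.
have y0 : 0 <= y by exact: normr_ge0.
pose er := expR (rho * y); pose et := expR (tau * y).
have er0 : 0 < er by exact: expR_gt0.
have ett0 : 0 < et by exact: expR_gt0.
have inv_le s' : a - eta <= re s' <= b + eta -> `|im s'| <= y + 1 ->
    normc (F s')^-1 <= D * et.
  move=> /L Ls ys; rewrite normcV.
  have p : 0 < c * expR (- (tau * `|im s'|)) by rewrite mulr_gt0// expR_gt0.
  have q : 0 < normc (F s') by exact: lt_le_trans Ls.
  rewrite (@le_trans _ _ (c * expR (- (tau * `|im s'|)))^-1)//.
    by rewrite lef_pV2 ?posrE.
  rewrite invfM expRN invrK /D -mulrA ler_pM2l// -expRD ler_expR.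
  have : tau * `|im s'| <= tau * (y + 1) by exact: ler_wpM2l.
  lra.
have Fneq s' : a - eta <= re s' <= b + eta -> F s' != 0.
  move=> /L Ls; apply/eqP => F0'; move: Ls; rewrite F0' normc0 leNgt.
  by rewrite mulr_gt0// expR_gt0.
have sin : a - eta <= re s <= b + eta by apply/andP; split; lra.
have I1 : normc (F s)^-1 <= D * et by apply: inv_le => //; rewrite lerDl.
have eT : expR ((2 * rho + 3 * tau) * y) = er ^+ 2 * et ^+ 3.
  by rewrite /er /et -!expRM_natl -expRD; congr expR; ring.
have ert : 1 <= er * et.
  by rewrite -expRD -mulrDl -expR0 ler_expR mulr_ge0.
rewrite eT.
have e1 : et <= er ^+ 2 * et ^+ 3.
  have -> : er ^+ 2 * et ^+ 3 = (er * et) ^+ 2 * et by ring.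
  by rewrite ler_peMl ?(ltW ett0)// exprn_ege1.
have e2 : er * et ^+ 2 <= er ^+ 2 * et ^+ 3.
  have -> : er ^+ 2 * et ^+ 3 = (er * et) * (er * et ^+ 2) by ring.
  by rewrite ler_peMl// mulr_ge0 ?exprn_ge0 ?ltW.
have et3 : 0 <= er ^+ 2 * et ^+ 3 by rewrite mulr_ge0// exprn_ge0 ?ltW.
have KE : K * (er ^+ 2 * et ^+ 3) = D * (er ^+ 2 * et ^+ 3) +
   C * D ^+ 2 * (er ^+ 2 * et ^+ 3) + 3 * C ^+ 2 * D ^+ 3 * (er ^+ 2 * et ^+ 3)
   + C * D ^+ 2 * (er ^+ 2 * et ^+ 3) by rewrite /K; ring.
have K1 : D * et <= K * (er ^+ 2 * et ^+ 3).
  have : D * et <= D * (er ^+ 2 * et ^+ 3) by rewrite ler_pM2l.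
  have := mulr_ge0 KD1 et3; have := mulr_ge0 KD2 et3; lra.
split; first exact: (le_trans I1).
exists (- A / F s ^+ 2); split.
  rewrite normcM normcNE normcV normcX -exprVn -normcV.
  have : normc A * normc (F s)^-1 ^+ 2 <= C * er * (D * et) ^+ 2.
    by rewrite ler_pM ?normc_ge0 ?exprn_ge0 ?normc_ge0// lerXn2r ?nnegrE ?normc_ge0// ?mulr_ge0// ltW.
  have -> : C * er * (D * et) ^+ 2 = C * D ^+ 2 * (er * et ^+ 2) by ring.
  have : C * D ^+ 2 * (er * et ^+ 2) <= C * D ^+ 2 * (er ^+ 2 * et ^+ 3).
    exact: ler_wpM2l.
  have := mulr_ge0 KD2 et3; have := mulr_ge0 (ltW D0) et3.
  have := mulr_ge0 KD1 et3; lra.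
move=> h; rewrite le_min => /andP[hd heta].
have n0 := normc_ge0 h; have n1 : normc h <= 1 by rewrite (le_trans hd).
have shin : a - eta <= re (s + h) <= b + eta.
  rewrite ReD; have := normc_Re h; rewrite ler_norml => /andP[h1 h2].
  apply/andP; split; lra.
have I2 : normc (F (s + h))^-1 <= D * et.
  apply: inv_le => //; rewrite ImD (le_trans (ler_normD _ _))// lerD//.
  by rewrite (le_trans (normc_Im _)).
have Ce0 : 0 <= C * er by rewrite mulr_ge0// ltW.
have {}Fr : normc (F (s + h) - F s - h * A) <= C * er * normc h ^+ 2.
  by rewrite (le_trans (Fr h hd))// mulrAC.
have Fd := hol_near Ce0 d1 hd HA Fr.
set n := normc h in n0 n1 Fr Fd *.
have fs := Fneq _ sin; have fsh := Fneq _ shin.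
set r := F (s + h) - F s - h * A in Fr.
have -> : (F (s + h))^-1 - (F s)^-1 - h * (- A / F s ^+ 2) =
  h * A * (F (s + h) - F s) * ((F s)^-1 ^+ 2 * (F (s + h))^-1)
  - r * ((F s)^-1 * (F (s + h))^-1).
  by rewrite /r; field; rewrite fs fsh.
have T1 : normc (h * A * (F (s + h) - F s) * ((F s)^-1 ^+ 2 * (F (s + h))^-1)) <=
  n * (C * er) * (2 * (C * er) * n) * ((D * et) ^+ 2 * (D * et)).
  rewrite normcM (normcM (h * A)) (normcM h) (normcM (_ ^+ 2)) normcX; apply: ler_pM; rewrite ?mulr_ge0 ?exprn_ge0 ?normc_ge0//.
    by apply: ler_pM; rewrite ?mulr_ge0 ?normc_ge0// ler_wpM2l// normc_ge0.
  apply: ler_pM; rewrite ?exprn_ge0 ?normc_ge0//.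
  by rewrite lerXn2r ?nnegrE ?normc_ge0// mulr_ge0// ltW.
have T2 : normc (r * ((F s)^-1 * (F (s + h))^-1)) <= C * er * n ^+ 2 * ((D * et) * (D * et)).
  rewrite !normcM; apply: ler_pM; rewrite ?mulr_ge0 ?normc_ge0//.
  by apply: ler_pM; rewrite ?normc_ge0.
rewrite (le_trans (normcB _ _))// (le_trans (lerD T1 T2))//.
have -> : K * n ^+ 2 * (er ^+ 2 * et ^+ 3) = (K * (er ^+ 2 * et ^+ 3)) * n ^+ 2 by ring.
have -> : n * (C * er) * (2 * (C * er) * n) * ((D * et) ^+ 2 * (D * et)) +
   C * er * n ^+ 2 * (D * et * (D * et)) =
   (2 * C ^+ 2 * D ^+ 3 * (er ^+ 2 * et ^+ 3) + C * D ^+ 2 * (er * et ^+ 2)) * n ^+ 2 by ring.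
apply: ler_wpM2r; first by rewrite exprn_ge0.
have : C * D ^+ 2 * (er * et ^+ 2) <= C * D ^+ 2 * (er ^+ 2 * et ^+ 3).
  exact: ler_wpM2l.
have := mulr_ge0 KD2 et3; have := mulr_ge0 (ltW D0) et3.
have := mulr_ge0 KD1 et3; lra.
Qed.

End strip_class.

(** * Cauchy's theorem for vertical lines *)

Section contour_shift.
Context {R : realType}.
Implicit Types (F : R[i] -> R[i]) (a b rho x y : R).

Lemma lipschitz_at_continuous (r : R -> R) (t K d : R) : 0 < d ->
  (forall k, `|k| <= d -> `|r (t + k) - r t| <= K * `|k|) ->
  {for t, continuous r}.
Proof.
move=> d0 H; apply/(@cvgrPdist_le _ R^o) => e e0.
have K1 : 0 < `|K| + 1 by rewrite ltr_wpDl.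
near=> u.
have uk : `|u - t| <= Num.min d (e / (`|K| + 1)).
  rewrite distrC; near: u.
  by apply: (@cvgr_dist_le _ R^o _ _ _ id t cvg_id); rewrite lt_min d0 divr_gt0.
move: uk; rewrite le_min => /andP[ud ue].
have := H (u - t) ud; rewrite subrKC distrC => h.
rewrite (le_trans h)// (@le_trans _ _ ((`|K| + 1) * `|u - t|))//.
  by rewrite ler_wpM2r// (le_trans (ler_norm _))// lerDl.
by rewrite mulrC -ler_pdivlMr.
Unshelve. all: by end_near. Qed.

Lemma line_shift (x t k : R) : x +i* (t + k) = x +i* t + 0 +i* k :> R[i].
Proof. by apply: complex_ext; rewrite RIE/= ?addr0. Qed.

Lemma hol_lip F a b rho x t : a <= x <= b -> hol F a b rho ->
  exists K d, 0 < d /\ forall h : R[i], normc h <= d ->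
    normc (F (x +i* t + h) - F (x +i* t)) <= K * normc h.
Proof.
move=> xab [C [d [C0 /andP[d0 d1] H]]].
have [_ [A [HA Hr]]] := H (x +i* t) xab.
exists (2 * (C * expR (rho * `|t|))), d; split => // h hd.
apply: (hol_near _ d1 hd HA).
  by rewrite mulr_ge0// expR_ge0.
by rewrite (le_trans (Hr h hd))// mulrAC.
Qed.

Lemma hol_cont F a b rho x : a <= x <= b -> hol F a b rho ->
  Ccont (fun t => F (x +i* t)).
Proof.
move=> xab HF; split => t; have [K [d [d0 H]]] := hol_lip t xab HF.
- apply: (lipschitz_at_continuous (K := K) d0) => k kd.
  have nk : normc (0 +i* k) = `|k| :> R by rewrite /= expr0n add0r sqrtr_sqr.
  rewrite line_shift -ReN -ReD (le_trans (normc_Re _))// -nk H// nk//.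
- apply: (lipschitz_at_continuous (K := K) d0) => k kd.
  have nk : normc (0 +i* k) = `|k| :> R by rewrite /= expr0n add0r sqrtr_sqr.
  rewrite line_shift -ImN -ImD (le_trans (normc_Im _))// -nk H// nk//.
Qed.

Lemma hol_edom F a b eta : 0 < eta -> hol F a b (- eta) ->
  exists C, forall x, a <= x <= b -> edom C eta (fun t => F (x +i* t)).
Proof.
move=> e0 HF; have [C [d [C0 d0 H]]] := HF; exists C => x xab; split => //.
  by apply: Ccont_meas; exact: hol_cont HF.
by move=> t; have [] := H (x +i* t) xab; rewrite mulNr.
Qed.

(** Cutting the segment from [x] to [y] into [n] equal steps bounds the total increment by a
    multiple of [1 / n]. A nonzero increment [c] is contradicted as soon as the steps are at most
    [d] and that bound is below [c], which fixes [n]. *)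
Lemma quadratic_increment_cst (L : R -> R[i]) a b (K d : R) : 0 < d ->
  (forall x y, a <= x <= b -> a <= y <= b -> `|y - x| <= d ->
     normc (L y - L x) <= K * `|y - x| ^+ 2) ->
  forall x y, a <= x <= b -> a <= y <= b -> L x = L y.
Proof.
move=> d0 H x y xab yab.
apply/eqP; rewrite eq_sym -subr_eq0; apply/eqP/normc_eq0P/eqP.
rewrite eq_le normc_ge0 andbT leNgt; apply/negP => c0.
set c := normc _ in c0.
pose n := (Num.truncn (`|y - x| / d + `|K * `|y - x| ^+ 2 / c|)).+1.
have n0 : 0 < n%:R :> R by rewrite ltr0n.
have hn : `|y - x| / d + `|K * `|y - x| ^+ 2 / c| < n%:R by exact: truncnS_gt.
have q0 : 0 <= `|y - x| / d by rewrite divr_ge0// ltW.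
have n1 : `|(y - x) / n%:R| <= d.
  rewrite normrM normfV (gtr0_norm n0) ler_pdivrMr// -ler_pdivrMl// mulrC.
  by have := normr_ge0 (K * `|y - x| ^+ 2 / c); lra.
have n2 : K * `|y - x| ^+ 2 < c * n%:R.
  rewrite -ltr_pdivrMl// mulrC (le_lt_trans (ler_norm _))//.
  lra.
pose p k := x + k%:R / n%:R * (y - x).
have pab k : (k <= n)%N -> a <= p k <= b.
  move=> kn; have : 0 <= (k%:R / n%:R : R) <= 1.
    by rewrite divr_ge0//= ler_pdivrMr// mul1r ler_nat.
  rewrite /p; set th := (_ / _) => /andP[th0 th1].
  move: xab yab => /andP[x1 x2] /andP[y1 y2].
  apply/andP; split; nra.
have S k : (k <= n)%N -> normc (L (p k) - L x) <= k%:R * (K * `|(y - x) / n%:R| ^+ 2).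
  elim: k => [|k IH] kn.
    by rewrite /p !mul0r addr0 subrr normc0.
  have -> : L (p k.+1) - L x = (L (p k.+1) - L (p k)) + (L (p k) - L x) by ring.
  rewrite (le_trans (normcD _ _))// -natr1 mulrDl mul1r addrC lerD ?IH ?(ltnW kn)//.
  have E : p k.+1 - p k = (y - x) / n%:R by rewrite /p -natr1; field; rewrite gt_eqF.
  by rewrite -E H ?E// pab// ltnW.
have pn : p n = y by rewrite /p mulfV ?gt_eqF// mul1r addrC subrK.
have := S n (leqnn n); rewrite pn -/c.
rewrite normrM normfV (gtr0_norm n0) leNgt => /negP; apply.
have -> : n%:R * (K * (`|y - x| / n%:R) ^+ 2) = K * `|y - x| ^+ 2 / n%:R.
  by field; rewrite gt_eqF.
by rewrite ltr_pdivrMr.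
Qed.

(* With [A] the derivative, [F (s + h) - F s] and ['i * (F (s + 'i h) - F s)] are
   [h A] and [- h A] up to O(h^2); the second one integrates to 0 along a vertical
   line, so the line integral has quadratically small increments. *)
Lemma contour_shift F a b eta x y : 0 < eta -> hol F a b (- eta) ->
  a <= x <= b -> a <= y <= b ->
  Cintegral setT (fun t => F (x +i* t)) = Cintegral setT (fun t => F (y +i* t)).
Proof.
move=> e0 HF; have [M HM] := hol_edom e0 HF.
have [C [d [C0 /andP[d0 d1] H]]] := HF.
move: x y; apply: (@quadratic_increment_cst _ a b (2 * (2 * C) * expmass eta) d d0).
move=> x y xab yab; set h := y - x => hd.
have Fx : ebd (fun t => F (x +i* t)) by exists M, eta; exact: HM.
have Fy : ebd (fun t => F (y +i* t)) by exists M, eta; exact: HM.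
have cx := hol_cont xab HF.
have Fxh : ebd (fun t => F (x +i* (t + h))).
  exists (M * expR (eta * `|h|)), eta; split => //.
    have mh : measurable_fun setT (fun t : R => t + h) by exact: measurable_funD.
    exact: (Cmeas_comp (Ccont_meas cx) mh).
  move=> t; have [_ _ B] := HM x xab; rewrite (le_trans (B (t + h)))//.
  have M0 : 0 <= M.
    by have := le_trans (normc_ge0 _) (B 0); rewrite pmulr_lge0// expR_gt0.
  rewrite -mulrA -expRD ler_wpM2l// ler_expR.
  have : eta * `|t| <= eta * (`|t + h| + `|h|).
    by rewrite ler_pM2l// (le_trans _ (ler_normB _ _))// addrK.
  lra.
have Z : Cintegral setT (fun t => (0 +i* 1) * (F (x +i* (t + h)) - F (x +i* t))) = 0.
  rewrite CintegralZ; last exact: ebdB.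
  by rewrite CintegralB// (@Cintegral_translate _ (fun t => F (x +i* t)))// subrr mulr0.
rewrite -CintegralB// -[X in normc X]addr0 -Z -CintegralD; last 2 first.
- exact: ebdB.
- by apply: ebdZ; exact: ebdB.
have -> : 2 * (2 * C) * expmass eta * `|h| ^+ 2 = 2 * (2 * C * `|h| ^+ 2) * expmass eta by ring.
apply: normc_Cintegral; split => //.
  by apply: CmeasD; [|apply: CmeasM; first exact: Cmeas_cst];
    apply: CmeasB; exact: ebd_meas.
move=> t; have [_ [A [_ Hr]]] := H (x +i* t) xab.
have nh : normc h%:C = `|h| by exact: normcR.
have nih : normc (0 +i* h) = `|h| :> R by rewrite /= expr0n add0r sqrtr_sqr.
have H1 := Hr h%:C; have H2 := Hr (0 +i* h).
rewrite nh in H1; rewrite nih in H2.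
have {}H1 := H1 hd; have {}H2 := H2 hd.
have ey : y +i* t = x +i* t + h%:C.
  by apply: complex_ext; rewrite RIE/= ?addr0// /h; ring.
rewrite line_shift ey.
have ih : 0 +i* h = (0 +i* 1) * h%:C :> R[i].
  by apply: complex_ext; rewrite RIE/=; ring.
have ii : (0 +i* 1) * (0 +i* 1) = -1 :> R[i].
  by apply: complex_ext; rewrite !RIE/= ?oppr0; ring.
have -> : F (x +i* t + h%:C) - F (x +i* t) + (0 +i* 1) * (F (x +i* t + 0 +i* h) - F (x +i* t))
  = (F (x +i* t + h%:C) - F (x +i* t) - h%:C * A) +
    (0 +i* 1) * (F (x +i* t + 0 +i* h) - F (x +i* t) - (0 +i* h) * A).
  have E : (0 +i* 1) * ((0 +i* h) * A) = - (h%:C * A) :> R[i].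
    by rewrite ih !mulrA ii mulN1r mulNr.
  have G (u v w j z : R[i]) : j * z = - v -> u + j * w = u - v + j * (w - z).
    by rewrite mulrBr => ->; ring.
  exact: G.
rewrite (le_trans (normcD _ _))// normcM.
have -> : normc (0 +i* 1) = 1 :> R by rewrite /= expr0n expr1n add0r sqrtr1.
rewrite mul1r (le_trans (lerD H1 H2))// mulNr.
have -> : im (x +i* t) = t by [].
lra.
Qed.

End contour_shift.

(** * The Gamma and Beta functions *)

Section log_gamma_integrand.
Context {R : realType}.
Implicit Types (z w s h : R[i]) (a b c x y u th : R).

(* The integrand of Euler's integral in the variable u = ln t, extended to
   complex u. *)
Definition Phi z w := Cexp (z * w - Cexp w).

Definition dPhi z w := (z - Cexp w) * Phi z w.

(** For negative [u] the linear term already decays at rate [a]. For positive [u], the tangent of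
    [c * expR u] at the point [u0] where it equals [a + b] has slope [a + b]: it beats [b * u] and
    leaves [- a * u]. *)
Lemma exp_exp_bound a b c : 0 < a -> 0 < c -> exists C, 0 <= C /\
  forall x u, a <= x <= b -> expR (x * u - c * expR u) <= C * expR (- (a * `|u|)).
Proof.
move=> a0 c0; have [ab|ba] := leP a b; last first.
  by exists 0; split => // x u /andP[/le_trans h /h]; rewrite leNgt ba.
have q0 : 0 < (a + b) / c by rewrite divr_gt0// addr_gt0// (lt_le_trans a0).
pose u0 := ln ((a + b) / c).
exists (expR ((a + b) * `|u0 - 1|)); split; first exact: expR_ge0.
move=> x u /andP[ax xb]; rewrite -expRD ler_expR.
have e0 := expR_ge0 u; have ce0 : 0 <= c * expR u by rewrite mulr_ge0// ltW.
have ab0 : 0 <= a + b by lra.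
have P : 0 <= (a + b) * `|u0 - 1| by rewrite mulr_ge0.
have [u00|u00] := leP 0 u.
  have E : (a + b) * (1 + (u - u0)) <= c * expR u.
    have -> : expR u = (a + b) / c * expR (u - u0).
      by rewrite expRB lnK ?posrE// mulrC divfK ?gt_eqF.
    rewrite mulrA mulrCA mulfV ?gt_eqF// mulr1 ler_wpM2l//; exact: expR_ge1Dx.
  have xu : x * u <= b * u by exact: ler_wpM2r.
  have : (a + b) * (u0 - 1) <= (a + b) * `|u0 - 1|.
    by rewrite ler_wpM2l// ler_norm.
  rewrite (ger0_norm u00); lra.
have xu : x * u <= a * u by rewrite ler_wnM2r// ltW.
have -> : `|u| = - u by rewrite ltr0_norm.
lra.
Qed.

Lemma normc_Phi z w :
  normc (Phi z w) = expR (re z * re w - im z * im w - expR (re w) * cos (im w)).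
Proof. by rewrite normc_Cexp RIE ReN ReCexp ReM. Qed.

Lemma cos_ge_strip th v : 0 <= th < pi / 2 -> `|v| <= th -> cos th <= cos v.
Proof.
move=> /andP[t0 t1] vt; rewrite -(cos_norm v).
move: vt; rewrite le_eqVlt => /predU1P[->//|vt]; apply: ltW.
have p := @pi_gt0 R.
by rewrite ltr_cos// in_itv/= ?normr_ge0 ?t0/= ?ltW//; lra.
Qed.

Lemma cos_strip_gt0 th : 0 <= th < pi / 2 -> 0 < cos th :> R.
Proof.
move=> /andP[t0 t1]; apply: cos_gt0_pihalf; apply/andP; split => //.
by have := @pi_gt0 R; lra.
Qed.

(** On the strip the modulus carries a factor [expR (- (cos th * E))] with [E = expR (re w)]. One
    half of [cos th] cancels the growth [expR (c * E)] of the quadratic remainder, the other half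
    absorbs the powers of [E] and still leaves decay in [re w]. *)
Lemma Phi_strip z th : 0 < re z -> 0 <= th < pi / 2 ->
  exists C eta d, [/\ 0 <= C, 0 < eta, 0 < d <= 1 &
    forall w, `|im w| <= th -> [/\
      normc (Phi z w) <= C * expR (- (eta * `|re w|)),
      normc (dPhi z w) <= C * expR (- (eta * `|re w|)) &
      forall h, normc h <= d -> normc (Phi z (w + h) - Phi z w - h * dPhi z w) <=
        C * normc h ^+ 2 * expR (- (eta * `|re w|))]].
Proof.
move=> x0 thb; set x := re z in x0 *; pose c := cos th / 2.
have ct := cos_strip_gt0 thb.
have c0 : 0 < c by rewrite divr_gt0.
(* The range up to [x + 2] accommodates a factor [E ^+ 2]. *)
have [C0 [C00 HC]] := @exp_exp_bound x (x + 2) c x0 c0.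
have [th0 thp] := andP thb.
pose e1 := expR (1 : R).
have e10 : 0 < e1 by exact: expR_gt0.
pose Z := normc z + 3 * e1 + 1.
have z0 := normc_ge0 z.
have Z0 : 0 < Z by rewrite /Z; lra.
have Z1 : 1 <= Z by rewrite /Z; lra.
have zZ : normc z <= Z by rewrite /Z; lra.
(* This [d] keeps the increment of the exponent below [c * (1 + E)]. *)
pose d := Num.min 1 (c / Z).
have d0 : 0 < d by rewrite lt_min ltr01 divr_gt0.
have d1 : d <= 1 by rewrite ge_min lexx.
have dZ : Z * d <= c.
  by rewrite mulrC -ler_pdivlMr// ge_min lexx orbT.
pose Y := expR (`|im z| * th).
have Y0 : 0 <= Y by exact: expR_ge0.
pose K := 4 * Z ^+ 2 * expR c + 4 * e1 + Z + 1.
have KA : 0 <= 4 * Z ^+ 2 * expR c by rewrite !mulr_ge0 ?expR_ge0 ?exprn_ge0// ltW.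
exists (4 * C0 * Y * K), x, d; split => //.
- by rewrite !mulr_ge0// /K; lra.
- by rewrite d0 d1.
move=> w wth; set u := re w; pose E := expR u.
have E0 : 0 < E by exact: expR_gt0.
have nE : normc (Cexp w) = E by exact: normc_Cexp.
have P1 : normc (Phi z w) <= Y * expR (x * u - cos th * E).
  rewrite normc_Phi -expRD ler_expR -/x -/u -/E.
  have : - (im z * im w) <= `|im z| * th.
    by rewrite (le_trans (ler_norm _))// normrN normrM ler_wpM2l.
  have : cos th * E <= E * cos (im w).
    by rewrite mulrC ler_pM2l// cos_ge_strip.
  lra.
have P2 : (1 + E) ^+ 2 * expR (x * u - c * E) <= 4 * C0 * expR (- (x * `|u|)).
  have A1 := HC x u _; have A2 := HC (x + 2) u _.
  have {}A1 : expR (x * u - c * E) <= C0 * expR (- (x * `|u|)).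
    by apply: A1; rewrite lexx lerDl ler0n.
  have {}A2 : E ^+ 2 * expR (x * u - c * E) <= C0 * expR (- (x * `|u|)).
    have -> : E ^+ 2 * expR (x * u - c * E) = expR ((x + 2) * u - c * expR u).
      by rewrite -expRM_natl -expRD; congr expR; rewrite /E; ring.
    by apply: A2; rewrite lexx lerDl ler0n.
  have : (1 + E) ^+ 2 * expR (x * u - c * E) <= (2 + 2 * E ^+ 2) * expR (x * u - c * E).
    by rewrite ler_wpM2r ?expR_ge0//; have := sqr_ge0 (1 - E); lra.
  lra.
have split_cos : expR (x * u - cos th * E) = expR (x * u - c * E) * expR (- (c * E)).
  by rewrite -expRD; congr expR; rewrite /c; field.
have P3 (k m : R) : 0 <= k -> k <= m * (1 + E) ^+ 2 * expR (c * E) -> 0 <= m -> m <= K ->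
    k * normc (Phi z w) <= 4 * C0 * Y * K * expR (- (x * `|u|)).
  move=> k0 km m0 mK.
  apply: (@le_trans _ _ (m * (1 + E) ^+ 2 * expR (c * E) *
     (Y * (expR (x * u - c * E) * expR (- (c * E)))))).
    by apply: ler_pM; rewrite ?normc_ge0// -split_cos.
  have -> : m * (1 + E) ^+ 2 * expR (c * E) * (Y * (expR (x * u - c * E) * expR (- (c * E)))) =
    m * Y * ((1 + E) ^+ 2 * expR (x * u - c * E)) * (expR (c * E) * expR (- (c * E))) by ring.
  rewrite expRxMexpNx_1 mulr1.
  have -> : 4 * C0 * Y * K * expR (- (x * `|u|)) = K * Y * (4 * C0 * expR (- (x * `|u|))) by ring.
  apply: ler_pM => //; rewrite ?mulr_ge0 ?expR_ge0 ?exprn_ge0 ?addr_ge0 ?ler01 ?(ltW E0)//.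
  by rewrite ler_wpM2r.
have ecE : 1 <= expR (c * E) by rewrite -expR0 ler_expR mulr_ge0 ?ltW.
have E1 : 1 <= (1 + E) ^+ 2 by rewrite exprn_ege1// lerDl ltW.
have E1' : 1 + E <= (1 + E) ^+ 2 by rewrite expr2 ler_peMr ?addr_ge0 ?ler01 ?lerDl ?(ltW E0).
have EE : 1 <= (1 + E) ^+ 2 * expR (c * E) by rewrite mulr_ege1.
split.
- rewrite -[normc _]mul1r; apply: (P3 1 1) => //; rewrite ?mul1r ?ler01//.
  by rewrite /K; lra.
- rewrite normcM; apply: (P3 _ Z); rewrite ?normc_ge0 ?(ltW Z0)//; last by rewrite /K; lra.
  rewrite (le_trans (normcB _ _))// nE -mulrA.
  apply: (@le_trans _ _ (Z * (1 + E))).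
    by rewrite mulrDr mulr1 lerD// ler_peMl// ltW.
  by rewrite ler_pM2l// (le_trans E1')// ler_peMr//; lra.
move=> h hd.
have h0 := normc_ge0 h; have h1 : normc h <= 1 by exact: le_trans hd d1.
have rh : expR `|re h| <= e1 by rewrite ler_expR (le_trans (normc_Re h)).
(* The increment of the exponent [z * w - Cexp w] between [w] and [w + h]. *)
pose k := z * h - Cexp w * (Cexp h - 1).
have kE : Phi z (w + h) - Phi z w - h * dPhi z w =
    ((Cexp k - 1 - k) - Cexp w * (Cexp h - 1 - h)) * Phi z w.
  have -> : Phi z (w + h) = Cexp k * Phi z w.
    by rewrite /Phi -CexpD; congr Cexp; rewrite CexpD /k; ring.
  by rewrite /dPhi /k; ring.
have nk : normc k <= Z * (1 + E) * normc h.
  rewrite (le_trans (normcB _ _))// (normcM z) (normcM (Cexp w)) nE.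
  have S1 := Cexp_sub1 h.
  have {}S1 : normc (Cexp h - 1) <= 3 * e1 * normc h.
    by rewrite (le_trans S1)// mulrAC ler_wpM2r// ler_pM2l.
  have : E * normc (Cexp h - 1) <= E * (3 * e1 * normc h) by rewrite ler_pM2l.
  have : 0 <= (3 * e1 + 1) * normc h by rewrite mulr_ge0//; lra.
  have : 0 <= E * normc h by rewrite mulr_ge0// ltW.
  have : 0 <= normc z * E * normc h by rewrite !mulr_ge0// ltW.
  rewrite /Z; lra.
have kk : expR `|re k| <= expR c * expR (c * E).
  rewrite -expRD ler_expR (le_trans (normc_Re k))// (le_trans nk)//.
  have -> : c + c * E = c * (1 + E) by ring.
  have -> : Z * (1 + E) * normc h = (Z * normc h) * (1 + E) by ring.
  rewrite ler_wpM2r ?addr_ge0 ?ler01 ?(ltW E0)// (le_trans _ dZ)// ler_pM2l//.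
have Q1 : normc (Cexp k - 1 - k) <=
    4 * Z ^+ 2 * expR c * normc h ^+ 2 * ((1 + E) ^+ 2 * expR (c * E)).
  rewrite (le_trans (Cexp_quadratic k))//.
  have -> : 4 * Z ^+ 2 * expR c * normc h ^+ 2 * ((1 + E) ^+ 2 * expR (c * E)) =
    4 * (Z * (1 + E) * normc h) ^+ 2 * (expR c * expR (c * E)) by ring.
  apply: ler_pM => //; rewrite ?mulr_ge0 ?exprn_ge0 ?normc_ge0 ?expR_ge0//.
  by rewrite ler_pM2l// lerXn2r// nnegrE ?normc_ge0// (le_trans _ nk)// normc_ge0.
have Q2 : normc (Cexp w * (Cexp h - 1 - h)) <=
    4 * e1 * normc h ^+ 2 * ((1 + E) ^+ 2 * expR (c * E)).
  rewrite normcM nE.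
  have R1 : normc (Cexp h - 1 - h) <= 4 * e1 * normc h ^+ 2.
    by rewrite (le_trans (Cexp_quadratic h))// mulrAC ler_wpM2r ?exprn_ge0// ler_pM2l.
  rewrite mulrC; apply: ler_pM; rewrite ?normc_ge0 ?(ltW E0)//.
  have : (1 + E) ^+ 2 <= (1 + E) ^+ 2 * expR (c * E) by rewrite ler_peMr//; lra.
  lra.
pose m := 4 * Z ^+ 2 * expR c + 4 * e1.
have m0 : 0 <= m by rewrite /m; lra.
have Q : normc ((Cexp k - 1 - k) - Cexp w * (Cexp h - 1 - h)) <=
    m * (1 + E) ^+ 2 * expR (c * E) * normc h ^+ 2.
  by rewrite (le_trans (normcB _ _))// (le_trans (lerD Q1 Q2))// /m; lra.
rewrite kE normcM.
apply: (@le_trans _ _ ((m * (1 + E) ^+ 2 * expR (c * E)) * normc h ^+ 2 * normc (Phi z w))).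
  by rewrite ler_wpM2r ?normc_ge0.
have := P3 (m * (1 + E) ^+ 2 * expR (c * E)) m _ (lexx _) m0 _.
move=> PP; have {PP} : m * (1 + E) ^+ 2 * expR (c * E) * normc (Phi z w) <=
    4 * C0 * Y * K * expR (- (x * `|u|)).
  apply: PP; last by rewrite /m /K; lra.
  have p1 : 0 <= (1 + E) ^+ 2 by lra.
  by rewrite mulr_ge0 ?expR_ge0// mulr_ge0.
have n2 : 0 <= normc h ^+ 2 by rewrite exprn_ge0.
move/(ler_wpM2r n2); lra.
Qed.
End log_gamma_integrand.

(** * Euler's integral: logarithmic form, recurrence, rotation *)

Section gamma_integral.
Context {R : realType}.
Implicit Types (z w s h : R[i]) (a b c x y u t th : R).

Lemma range_expR : range (@expR R) = `]0, +oo[%classic.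
Proof.
apply/seteqP; split => [_ [x _ <-]|y]; rewrite /= in_itv/= andbT ?expR_gt0//.
by move=> y0; exists (ln y) => //; rewrite lnK ?posrE.
Qed.

Lemma CpowR t (p : R[i]) : 0 < t -> Cpow t%:C p = Cexp (p * (ln t)%:C).
Proof.
move=> t0; rewrite /Cpow /Carg.
have n : `|t%:C| = t%:C by apply: ger0_norm; rewrite ler0c ltW.
by rewrite n /= lexx divff ?gt_eqF// acos1.
Qed.

Lemma Cexp_ln_cont (p : R[i]) t : 0 < t ->
  {for t, continuous (fun t => re (Cexp (p * (ln t)%:C)))} /\
  {for t, continuous (fun t => im (Cexp (p * (ln t)%:C)))}.
Proof.
move=> t0.
have L (k : R) : {for t, continuous (fun t => k * ln t)}.
  by apply: cvgM; [exact: cvg_cst|exact: continuous_ln].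
have E (k : R) : {for t, continuous (fun t => expR (k * ln t))}.
  by apply: continuous_comp (L k) _; exact: continuous_expR.
have X (f g : R -> R) : f = g -> {for t, continuous g} -> {for t, continuous f}.
  by move=> ->.
split.
- apply: (X _ (fun t => expR (re p * ln t) * cos (im p * ln t))).
    by apply/funext => u; rewrite ReCexp !RIE/= !mulr0 subr0 add0r.
  apply: cvgM; first exact: E.
  by apply: continuous_comp (L _) _; exact: continuous_cos.
- apply: (X _ (fun t => expR (re p * ln t) * sin (im p * ln t))).
    by apply/funext => u; rewrite ImCexp !RIE/= !mulr0 subr0 add0r.
  apply: cvgM; first exact: E.
  by apply: continuous_comp (L _) _; exact: continuous_sin.
Qed.

(** Substitution t = exp u, whose Jacobian turns the exponent [z - 1] into [z]. *)
Lemma Gamma_intE z : Gamma_int z = Cintegral setT (fun u => Phi z u%:C).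
Proof.
have D (x : R) : is_derive x 1 (@expR R) (expR x) by exact: is_derive_expR.
have ce : continuous (@expR R) by exact: continuous_expR.
have e0 (x : R) : 0 <= expR x by exact: expR_ge0.
have ei (x y : R) : x < y -> expR x < expR y by rewrite ltr_expR.
have eN (t : R) : {for t, continuous (fun t => expR (- t))}.
  by apply: continuous_comp; [exact: opp_continuous|exact: continuous_expR].
have P (x : R) : Cexp ((z - 1) * (ln (expR x))%:C) * (expR (- expR x))%:C * (expR x)%:C =
    Phi z x%:C.
  by rewrite expRK -!CexpR -!CexpD /Phi CexpR; congr Cexp; rewrite rmorphN/=; ring.
rewrite /Gamma_int /Cintegral -range_expR; congr Complex.
- rewrite /Rintegral; congr fine.
  transitivity (\int[@lebesgue_measure R]_(t in range (@expR R))
     (re (Cexp ((z - 1) * (ln t)%:C)) * expR (- t))%:E)%E.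
    apply: eq_integral => t tr; have t0 : 0 < t.
      by move: tr; rewrite inE range_expR/= in_itv/= andbT.
    by rewrite CpowR// ReM/= mulr0 subr0.
  rewrite (@integral_subst _ expR expR ei D ce e0).
    by apply: eq_integral => x _; rewrite -P !RIE/=; congr EFin; ring.
  move=> y; rewrite range_expR/= in_itv/= andbT => y0.
  by apply: cvgM; [exact: (Cexp_ln_cont _ y0).1|exact: eN].
- rewrite /Rintegral; congr fine.
  transitivity (\int[@lebesgue_measure R]_(t in range (@expR R))
     (im (Cexp ((z - 1) * (ln t)%:C)) * expR (- t))%:E)%E.
    apply: eq_integral => t tr; have t0 : 0 < t.
      by move: tr; rewrite inE range_expR/= in_itv/= andbT.
    by rewrite CpowR// ImM/= mulr0 add0r.
  rewrite (@integral_subst _ expR expR ei D ce e0).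
    by apply: eq_integral => x _; rewrite -P !RIE/=; congr EFin; ring.
  move=> y; rewrite range_expR/= in_itv/= andbT => y0.
  by apply: cvgM; [exact: (Cexp_ln_cont _ y0).2|exact: eN].
Qed.

Lemma Cmeas_Phi z (r : R -> R[i]) : Cmeas r -> Cmeas (fun u => Phi z (r u)).
Proof.
move=> mr; apply: Cmeas_exp; apply: CmeasB; last exact: Cmeas_exp.
by apply: CmeasM => //; exact: Cmeas_cst.
Qed.

Lemma Cmeas_line th : Cmeas (fun u : R => u +i* th).
Proof. by split => /=; [exact: measurable_id|exact: measurable_cst]. Qed.

Lemma pihalf_gt0 : 0 < pi / 2 :> R.
Proof. by rewrite divr_gt0// pi_gt0. Qed.

Lemma ebd_Phi z th : 0 < re z -> `|th| < pi / 2 -> ebd (fun u => Phi z (u +i* th)).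
Proof.
move=> z0 thp; have thb : 0 <= `|th| < pi / 2 by rewrite normr_ge0.
have [C [eta [d [C0 e0 d0 H]]]] := Phi_strip z0 thb.
exists C, eta; split => //; first by apply: Cmeas_Phi; exact: Cmeas_line.
by move=> u; have [] := H (u +i* th) (lexx _).
Qed.

Lemma PhiS z w : Cexp w * Phi z w = Phi (z + 1) w.
Proof. by rewrite /Phi -CexpD; congr Cexp; ring. Qed.

Lemma Ccont_Phi z : 0 < re z -> Ccont (fun u : R => Phi z u%:C).
Proof.
move=> z0; have thb : 0 <= (0 : R) < pi / 2 by rewrite lexx pihalf_gt0.
have [C [eta [d [C0 e0 /andP[d0 d1] H]]]] := Phi_strip z0 thb.
have lip (u : R) : forall k : R, `|k| <= d ->
   normc (Phi z (u + k)%:C - Phi z u%:C) <= 2 * (C * expR (- (eta * `|u|))) * `|k|.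
  move=> k kd; have [|_ B2 B3] := H u%:C; first by rewrite normr0.
  rewrite -(normcR k) (_ : (u + k)%:C = u%:C + k%:C); last exact: rmorphD.
  apply: (@hol_near _ (dPhi z u%:C) _ _ _ _ d); rewrite ?normcR ?mulr_ge0 ?expR_ge0//.
  by have := B3 k%:C; rewrite normcR => /(_ kd)/le_trans; apply; rewrite mulrAC.
split => u; apply: (lipschitz_at_continuous d0 (K := 2 * (C * expR (- (eta * `|u|))))) => k kd.
- by rewrite -ReN -ReD (le_trans (normc_Re _))// lip.
- by rewrite -ImN -ImD (le_trans (normc_Im _))// lip.
Qed.

(* Integrating the total derivative [dPhi z] gives 0. *)
Lemma Gamma_int_rec z : 0 < re z -> Gamma_int (z + 1) = z * Gamma_int z.
Proof.
move=> z0; have p0 := pihalf_gt0.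
have thb : 0 <= (0 : R) < pi / 2 by rewrite lexx.
have [C [eta [d [C0 e0 /andP[d0 d1] H]]]] := Phi_strip z0 thb.
have cR u : u%:C = u +i* 0 :> R[i] by [].
have bP : ebd (fun u : R => Phi z u%:C) by apply: ebd_Phi; rewrite ?normr0.
have bP1 : ebd (fun u : R => Phi (z + 1) u%:C).
  by apply: ebd_Phi; rewrite ?normr0// ReD/= addr_gt0.
have bd : ebd (fun u : R => dPhi z u%:C).
  have -> : (fun u : R => dPhi z u%:C) = (fun u => z * Phi z u%:C - Phi (z + 1) u%:C).
    by apply/funext => u; rewrite /dPhi mulrBl PhiS.
  by apply: ebdB => //; exact: ebdZ.
suff I0 : Cintegral setT (fun u : R => dPhi z u%:C) = 0.
  rewrite !Gamma_intE -CintegralZ//; apply/esym/eqP; rewrite -subr_eq0 -CintegralB//.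
    apply/eqP; rewrite -[RHS]I0; congr Cintegral.
    by apply/funext => u; rewrite /dPhi mulrBl PhiS.
  exact: ebdZ.
have cont := Ccont_Phi z0.
have M0 := expmass_ge0 eta.
(* Translation invariance cancels the integrals of [Phi z (u + k)%:C] and [Phi z u%:C]; what remains
   is that [k] times the integral equals minus the integral of a remainder of order [k ^+ 2]. *)
have small (k : R) : 0 < k <= d ->
    normc (Cintegral setT (fun u : R => dPhi z u%:C)) <= 2 * C * expmass eta * k.
  move=> /andP[k0 kd].
  have bh : ebd (fun u : R => Phi z (u + k)%:C).
    have -> : (fun u : R => Phi z (u + k)%:C) =
      (fun u : R => (Phi z (u + k)%:C - Phi z u%:C - k%:C * dPhi z u%:C) +
                    (Phi z u%:C + k%:C * dPhi z u%:C)).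
      by apply/funext => u; ring.
    apply: ebdD; last by apply: ebdD => //; exact: ebdZ.
    exists (C * k ^+ 2), eta; split => //.
      apply: CmeasB; last by apply: ebd_meas; exact: ebdZ.
      apply: CmeasB; last exact: ebd_meas.
      by apply: Cmeas_Phi; apply: CmeasR; exact: measurable_funD.
    move=> u; have [|_ _ B3] := H u%:C; first by rewrite normr0.
    by rewrite rmorphD/= (le_trans (B3 k%:C _))// normcR gtr0_norm.
  have E : k%:C * Cintegral setT (fun u : R => dPhi z u%:C) =
     - Cintegral setT (fun u : R => Phi z (u + k)%:C - Phi z u%:C - k%:C * dPhi z u%:C).
    rewrite CintegralB; [|exact: ebdB|exact: ebdZ].
    rewrite CintegralB// CintegralZ// (@Cintegral_translate _ (fun u : R => Phi z u%:C))//.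
    by rewrite subrr sub0r opprK.
  rewrite -(ler_pM2l k0) -{1}(gtr0_norm k0) -normcR -normcM E normcNE.
  have -> : k * (2 * C * expmass eta * k) = 2 * (C * k ^+ 2) * expmass eta by ring.
  apply: normc_Cintegral; split => //.
    apply: CmeasB; last by apply: ebd_meas; exact: ebdZ.
    by apply: CmeasB; exact: ebd_meas.
  move=> u; have [|_ _ B3] := H u%:C; first by rewrite normr0.
  by rewrite rmorphD/= (le_trans (B3 k%:C _))// normcR gtr0_norm.
apply/normc_eq0P/eqP; rewrite eq_le normc_ge0 andbT leNgt; apply/negP => q0.
set q := normc _ in q0 small.
pose M := 2 * C * expmass eta.
have M1 : 0 <= M by rewrite !mulr_ge0.
have k0 : 0 < Num.min d (q / (M + 1) / 2).
  by rewrite lt_min d0 !divr_gt0// ltr_wpDl.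
have := small (Num.min d (q / (M + 1) / 2)); rewrite k0 ge_min lexx => /(_ isT).
rewrite -/M leNgt => /negP; apply.
apply: (@le_lt_trans _ _ (M * (q / (M + 1) / 2))).
  by rewrite ler_wpM2l// ge_min lexx orbT.
have -> : M * (q / (M + 1) / 2) = q * (M / (M + 1) / 2) by field; lra.
rewrite gtr_pMr//.
have : M / (M + 1) <= 1 by rewrite ler_pdivrMr; lra.
lra.
Qed.

(** [contour_shift] moves vertical lines, whereas here the line is horizontal: [j], that is -i,
    makes the quarter turn between the two, and height [th] becomes abscissa [- th]. *)
Lemma Gamma_int_rot z th : 0 < re z -> `|th| < pi / 2 ->
  Gamma_int z = Cintegral setT (fun u => Phi z (u +i* th)).
Proof.
move=> z0 thp; have thb : 0 <= `|th| < pi / 2 by rewrite normr_ge0.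
have [C [eta [d [C0 e0 d0 H]]]] := Phi_strip z0 thb.
pose j : R[i] := 0 +i* (- 1).
have nj : normc j = 1 by rewrite /j /= expr0n/= add0r sqrrN expr1n sqrtr1.
have jE (x t : R) : j * (x +i* t) = t +i* (- x).
  by apply: complex_ext; rewrite !RIE/=; ring.
have HF : hol (fun s => Phi z (j * s)) (- `|th|) `|th| (- eta).
  exists C, d; split => // s /andP[s1 s2].
  have ims : `|im (j * s)| <= `|th|.
    by case: s s1 s2 => p q /= s1 s2; rewrite mul0r mulN1r add0r normrN ler_norml s1.
  have rej : `|re (j * s)| = `|im s|.
    by case: s {s1 s2 ims} => p q /=; rewrite mul0r mulN1r add0r opprK.
  have [B1 B2 B3] := H _ ims.
  rewrite mulNr -rej; split => //; exists (j * dPhi z (j * s)); split.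
    by rewrite normcM nj mul1r.
  move=> h hd; have := B3 (j * h); rewrite normcM nj mul1r => /(_ hd).
  by rewrite mulrDr (_ : j * h * dPhi z (j * s) = h * (j * dPhi z (j * s)))//; ring.
have := contour_shift (x := 0) (y := - th) e0 HF.
rewrite lerNl oppr0 normr_ge0 => /(_ isT); rewrite lerN2 ler_norm/=.
rewrite -normrN ler_norm => /(_ isT) => E.
rewrite Gamma_intE; transitivity (Cintegral setT (fun t => Phi z (j * (0 +i* t)))).
  by congr Cintegral; apply/funext => t; rewrite jE oppr0.
by rewrite E; congr Cintegral; apply/funext => t; rewrite jE opprK.
Qed.

End gamma_integral.

(** * Exponential decay of Gamma on vertical strips *)

Section gamma_strip.
Context {R : realType}.
Implicit Types (z w s h : R[i]) (a b c x y u t th : R).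

Lemma hol_ext (F G : R[i] -> R[i]) a b rho : 0 < a ->
  (forall s, 0 < re s -> F s = G s) -> hol F a b rho -> hol G a b rho.
Proof.
move=> a0 FG [C [d [C0 /andP[d0 d1] H]]].
exists C, (Num.min d (a / 2)); split => //.
  by rewrite lt_min d0 divr_gt0//= ge_min d1.
move=> s sab; have [F0 [A [HA Hr]]] := H s sab.
have [s1 s2] := andP sab.
rewrite -FG ?(lt_le_trans a0)//; split => //; exists A; split => // h.
rewrite le_min => /andP[hd ha]; rewrite -FG ?Hr// ReD.
have := normc_Re h; rewrite ler_norml => /andP[h1 h2]; lra.
Qed.

Lemma hol_Gamma_int a b th : 0 < a -> 0 <= th < pi / 2 ->
  hol (@Gamma_int R) a b (- th).
Proof.
move=> a0 thb; have [th0 thp] := andP thb.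
have ct := cos_strip_gt0 thb.
have [C0 [C00 HC]] := @exp_exp_bound R a b (cos th) a0 ct.
(* Of the decay rate [a] in [u], one quarter pays for [W u ^+ 2] (twice [e]), one quarter for the
   exponential of [h * w] with [normc h <= a / 4], and one half is left for integration. *)
pose e := a / 8; have e0 : 0 < e by rewrite divr_gt0.
pose K := e^-1 ^+ 2 * expR (4 * e).
have K0 : 0 <= K by rewrite mulr_ge0 ?expR_ge0// exprn_ge0// invr_ge0 ltW.
pose C1 := 4 * C0 * K * expR (a / 2).
have C10 : 0 <= C1 by exact: mulr_ge0 (mulr_ge0 (mulr_ge0 (ler0n _ 4) C00) K0) (expR_ge0 _).
have M0 := @expmass_ge0 R (a / 2).
have C1K : C0 * K <= C1.
  have P : C0 * K <= (C0 * K) * expR (a / 2).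
    have ea : 1 <= expR (a / 2) by rewrite -expR0 ler_expR divr_ge0// ltW.
    by apply: ler_peMr => //; exact: mulr_ge0.
  have : 0 <= C0 * K by exact: mulr_ge0.
  rewrite /C1; lra.
pose d := Num.min 1 (a / 4).
exists (2 * C1 * expmass (a / 2)), d; split.
- exact: mulr_ge0 (mulr_ge0 (ler0n _ 2) C10) M0.
- by rewrite lt_min ltr01 divr_gt0//= ge_min lexx.
move=> s /andP[s1 s2].
(* Rotating in the direction of the sign of [im s] produces the factor [expR (- th * |im s|)]. The
   same angle is kept at [s + h], so that the remainder is estimated under a single integral. *)
pose t1 := if 0 <= im s then th else - th.
have t1n : `|t1| = th by rewrite /t1; case: ifP => _; rewrite ?normrN ger0_norm.
have t1p : `|t1| < pi / 2 by rewrite t1n.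
have yt : im s * t1 = `|im s| * th.
  rewrite /t1; case: (leP 0 (im s)) => y0; first by rewrite ger0_norm.
  by rewrite ltr0_norm// mulrN mulNr.
have ce : cos t1 = cos th by rewrite -(cos_norm t1) t1n.
pose W u := `|u| + 2.
have W1 u : 1 <= W u by rewrite /W; have := normr_ge0 u; lra.
have th2 : th <= 2 by have := @pihalf_lt2 R; lra.
have nw u : normc (u +i* t1) <= W u.
  by rewrite (le_trans (normc_le _))//= lerD2l t1n.
have W2 u : W u ^+ 2 <= K * expR (a / 4 * `|u|).
  have := ler_expR_lin (W u) e0 => h.
  have -> : K * expR (a / 4 * `|u|) = (e^-1 * expR (e * W u)) ^+ 2.
    rewrite /K exprMn -mulrA; congr (_ * _).
    by rewrite -expRM_natl -expRD; congr expR; rewrite /e /W; field.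
  by rewrite lerXn2r// nnegrE ?(le_trans ler01)// (le_trans _ h)// (le_trans ler01).
have P1 u : normc (Phi s (u +i* t1)) <=
    expR (- th * `|im s|) * (C0 * expR (- (a * `|u|))).
  rewrite normc_Phi/= yt ce.
  have -> : re s * u - `|im s| * th - expR u * cos th =
    - th * `|im s| + (re s * u - cos th * expR u) by ring.
  by rewrite expRD ler_wpM2l ?expR_ge0// HC// s1 s2.
pose E := expR (- th * `|im s|).
have E0 : 0 <= E by exact: expR_ge0.
have P2 (m c : R) u : 0 <= m -> 0 <= c -> m <= W u ^+ 2 * (4 * expR (a / 4 * W u) * c) ->
    m * normc (Phi s (u +i* t1)) <= C1 * c * E * expR (- (a / 2 * `|u|)).
  move=> m0 c0' mW.
  apply: (@le_trans _ _ (K * expR (a / 4 * `|u|) * (4 * expR (a / 4 * W u) * c)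
      * (E * (C0 * expR (- (a * `|u|)))))).
    apply: ler_pM; rewrite ?normc_ge0 ?P1// (le_trans mW)// ler_wpM2r//.
    by rewrite !mulr_ge0 ?expR_ge0//.
  have -> : K * expR (a / 4 * `|u|) * (4 * expR (a / 4 * W u) * c) *
     (E * (C0 * expR (- (a * `|u|)))) = 4 * C0 * K * c * E *
     (expR (a / 4 * `|u|) * expR (a / 4 * W u) * expR (- (a * `|u|))) by ring.
  have -> : C1 * c * E * expR (- (a / 2 * `|u|)) =
    4 * C0 * K * c * E * (expR (a / 2) * expR (- (a / 2 * `|u|))) by rewrite /C1; ring.
  rewrite -!expRD le_eqVlt; apply/orP; left; apply/eqP; congr (_ * expR _).
  by rewrite /W; field.
have e4 u : 1 <= expR (a / 4 * W u).
  by rewrite -expR0 ler_expR mulr_ge0 ?divr_ge0 ?(ltW a0)// (le_trans ler01).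
have W21 u : W u <= W u ^+ 2 by rewrite expr2 ler_peMr// (le_trans ler01).
have mP : Cmeas (fun u => Phi s (u +i* t1)) by apply: Cmeas_Phi; exact: Cmeas_line.
have s0 : 0 < re s by exact: lt_le_trans s1.
have a20 : 0 < a / 2 by rewrite divr_gt0.
have B0 : edom (C1 * E) (a / 2) (fun u => Phi s (u +i* t1)).
  split => // u; rewrite -[normc _]mul1r -[C1 in leRHS]mulr1.
  apply: P2 => //; rewrite mulr1.
  by apply: mulr_ege1; [exact: le_trans (W1 u) (W21 u)|have := e4 u; lra].
have B1 : edom (C1 * E) (a / 2) (fun u => (u +i* t1) * Phi s (u +i* t1)).
  split => //; first by apply: CmeasM => //; exact: Cmeas_line.
  move=> u; rewrite normcM -[C1 in leRHS]mulr1; apply: P2; rewrite ?normc_ge0//.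
  rewrite mulr1 (le_trans (nw u))// (le_trans (W21 u))//.
  apply: ler_peMr; first by apply: exprn_ge0; exact: le_trans ler01 (W1 u).
  by have := e4 u; lra.
have CE : 2 * (C1 * E) * expmass (a / 2) = 2 * C1 * expmass (a / 2) * E by ring.
split.
  by rewrite (Gamma_int_rot s0 t1p) -/E -CE normc_Cintegral.
(* Differentiating [Phi] in its first argument brings down the second one. *)
exists (Cintegral setT (fun u => (u +i* t1) * Phi s (u +i* t1))); split.
  by rewrite -/E -CE normc_Cintegral.
move=> h; rewrite le_min => /andP[h1 h4].
have h0 := normc_ge0 h.
have sh0 : 0 < re (s + h).
  rewrite ReD; have := normc_Re h; rewrite ler_norml => /andP[? ?]; lra.
have rb u : normc (Phi (s + h) (u +i* t1) - Phi s (u +i* t1) -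
     h * ((u +i* t1) * Phi s (u +i* t1))) <=
     C1 * normc h ^+ 2 * E * expR (- (a / 2 * `|u|)).
  have -> : Phi (s + h) (u +i* t1) - Phi s (u +i* t1) - h * ((u +i* t1) * Phi s (u +i* t1))
    = (Cexp (h * (u +i* t1)) - 1 - h * (u +i* t1)) * Phi s (u +i* t1).
    have -> : Phi (s + h) (u +i* t1) = Cexp (h * (u +i* t1)) * Phi s (u +i* t1).
      by rewrite /Phi -CexpD; congr Cexp; ring.
    by ring.
  rewrite normcM; apply: P2; rewrite ?normc_ge0 ?exprn_ge0//.
  rewrite (le_trans (Cexp_quadratic _))// normcM exprMn.
  have -> : 4 * (normc h ^+ 2 * normc (u +i* t1) ^+ 2) * expR `|re (h * (u +i* t1))| =
   (4 * normc h ^+ 2) * (normc (u +i* t1) ^+ 2 * expR `|re (h * (u +i* t1))|) by ring.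
  have -> : W u ^+ 2 * (4 * expR (a / 4 * W u) * normc h ^+ 2) =
   (4 * normc h ^+ 2) * (W u ^+ 2 * expR (a / 4 * W u)) by ring.
  apply: ler_wpM2l; first by rewrite mulr_ge0// exprn_ge0.
  apply: ler_pM; rewrite ?expR_ge0 ?exprn_ge0 ?normc_ge0//.
    by rewrite lerXn2r// nnegrE ?normc_ge0// (le_trans ler01).
  by rewrite ler_expR (le_trans (normc_Re _))// normcM ler_pM ?normc_ge0.
have eB0 : ebd (fun u => Phi s (u +i* t1)) by exists (C1 * E), (a / 2).
have eB1 : ebd (fun u => (u +i* t1) * Phi s (u +i* t1)) by exists (C1 * E), (a / 2).
rewrite (Gamma_int_rot s0 t1p) (Gamma_int_rot sh0 t1p) -CintegralZ//.
have eB2 : ebd (fun u => Phi (s + h) (u +i* t1)) by exact: ebd_Phi.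
rewrite -CintegralB// -CintegralB//; [|exact: ebdB|exact: ebdZ].
have -> : 2 * C1 * expmass (a / 2) * normc h ^+ 2 * E =
  2 * (C1 * normc h ^+ 2 * E) * expmass (a / 2) by ring.
apply: normc_Cintegral; split => //; apply: ebd_meas.
by apply: ebdB; [exact: ebdB|exact: ebdZ].
Qed.

End gamma_strip.

(** * Lower bound for Gamma on [Re s >= 1] *)

Section gamma_lower_bound.
Context {R : realType}.
Notation mu := (@lebesgue_measure R).
Implicit Types (z w s h : R[i]) (x y u t : R).

Definition rGamma x : R := re (Gamma_int x%:C).

Lemma PhiR x u : Phi x%:C u%:C = (expR (x * u - expR u))%:C.
Proof.
by rewrite /Phi CexpR -rmorphM -rmorphB CexpR.
Qed.

Lemma ebd_PhiR z : 0 < re z -> ebd (fun u : R => Phi z u%:C).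
Proof. by move=> z0; apply: ebd_Phi; rewrite ?normr0// pihalf_gt0. Qed.

Lemma Gamma_int_real x : Gamma_int x%:C = (rGamma x)%:C.
Proof.
apply: complex_ext; first by [].
rewrite Gamma_intE; transitivity (\int[mu]_(u in setT) (0 : R)).
  by apply: eq_Rintegral => u _; rewrite PhiR.
by rewrite /Rintegral integral0.
Qed.

Lemma rGammaE x : rGamma x = \int[mu]_u expR (x * u - expR u).
Proof.
rewrite /rGamma Gamma_intE; apply: eq_Rintegral => u _; by rewrite PhiR.
Qed.

Lemma rGammaS x : 0 < x -> rGamma (x + 1) = x * rGamma x.
Proof.
move=> x0; have := @Gamma_int_rec R x%:C x0.
by rewrite -(rmorphD (real_complex R) x 1) !Gamma_int_real -rmorphM => /(congr1 re).
Qed.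

Lemma integrable_PhiR x : 0 < x ->
  mu.-integrable setT (fun u => (expR (x * u - expR u))%:E).
Proof.
move=> x0; have [h _] := ebd_integrable (@ebd_PhiR x%:C x0).
move: h; rewrite (_ : (fun t => _) = (fun u => (expR (x * u - expR u))%:E))//.
by apply/funext => u; rewrite PhiR.
Qed.

(** Only [u] in [0, 1] is kept, where the exponent [x * u - expR u] is at least - e. *)
Lemma rGamma_ge x : 0 < x -> expR (- expR 1) <= rGamma x.
Proof.
move=> x0; rewrite rGammaE.
have -> : expR (- expR 1) = \int[mu]_(u in `[0, 1]%classic) expR (- expR 1) :> R.
  rewrite Rintegral_cst//= lebesgue_measure_itv/= lte_fin ltr01.
  by rewrite -EFinB/= subr0 mulr1.
rewrite Rintegral_mkcond; apply: le_Rintegral => //.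
- rewrite (_ : _ \o _ = (fun u => ((expR (- expR 1))%:E * (\1_(`[0%R, 1%R]%classic) u)%:E)%E)).
    by apply: integrableZl => //; exact: integrable_indic_itv.
  apply/funext => u; rewrite /= patchE indicE.
  by case: (u \in _); rewrite /= ?mule1 ?mule0.
- exact: integrable_PhiR.
- move=> u _; rewrite patchE; case: ifPn => [|_]; last exact: expR_ge0.
  rewrite inE/= in_itv/= => /andP[u0 u1]; rewrite ler_expR.
  have : expR u <= expR 1 by rewrite ler_expR.
  have : 0 <= x * u by rewrite mulr_ge0// ltW.
  lra.
Qed.

Lemma rGamma_gt0 x : 0 < x -> 0 < rGamma x.
Proof. by move=> /rGamma_ge; apply: lt_le_trans; exact: expR_gt0. Qed.

(** The bracket is the square of [expR (t / 2) - expR (- (t / 2))], whose modulus is at least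
    [|t / 2|]. Exponentials are preferred to [t ^+ 2] because against Euler's integrand they only
    move [x] by one, and [rGammaS] evaluates the result. *)
Lemma sqr_le_cosh t : t ^+ 2 <= 4 * (expR t + expR (- t) - 2).
Proof.
have E : expR t + expR (- t) - 2 = (expR (t / 2) - expR (- (t / 2))) ^+ 2.
  have e2 : expR t = expR (t / 2) ^+ 2 by rewrite -expRM_natl; congr expR; field.
  have e3 : expR (- t) = expR (- (t / 2)) ^+ 2 by rewrite -expRM_natl; congr expR; field.
  have := expRxMexpNx_1 (t / 2); rewrite e2 e3 sqrrB => ->; lra.
have pos (v : R) : 0 <= v -> v <= expR v - expR (- v).
  move=> v0; have := expR_ge1Dx v; have : expR (- v) <= 1 by rewrite expR_le1 oppr_le0.
  lra.
have B : `|t / 2| <= `|expR (t / 2) - expR (- (t / 2))|.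
  have [t0|t0] := leP 0 (t / 2).
    by rewrite (ger0_norm t0) (le_trans (pos _ t0))// ler_norm.
  rewrite (ltr0_norm t0) -normrN opprB.
  have t0' : 0 <= - (t / 2) by rewrite oppr_ge0 ltW.
  by rewrite (le_trans (pos _ t0'))// opprK ler_norm.
set q := _ - _ in B; rewrite E -/q -(real_normK (num_real q)).
have : `|t / 2| ^+ 2 <= `|q| ^+ 2 by rewrite lerXn2r ?nnegrE.
rewrite (real_normK (num_real (t / 2))).
have -> : (t / 2) ^+ 2 = t ^+ 2 / 4 by field.
lra.
Qed.

Lemma integrableBR (f g : R -> R) : mu.-integrable setT (EFin \o f) ->
  mu.-integrable setT (EFin \o g) -> mu.-integrable setT (EFin \o (fun u => f u - g u)).
Proof.
move=> If Ig; rewrite (_ : _ \o _ = ((EFin \o f) \- (EFin \o g))%E)//.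
exact: integrableB.
Qed.

(* A Gamma(X) variable has E [ln (T / X) ^ 2] = O(1 / X), so the oscillating factor
   T^(iy) is nearly constant once X is large compared with y^2. *)
Lemma Gamma_int_ge_half x y : 1 < x -> 8 * y ^+ 2 <= x - 1 ->
  rGamma x <= 2 * normc (Gamma_int (x +i* y)).
Proof.
move=> x1 xy; have x0 : 0 < x by lra. have x10 : 0 < x - 1 by lra.
(* [x * u - expR u] is maximal at [u0], and [j] cancels the phase of the integrand there. *)
pose u0 := ln x; have eu0 : expR u0 = x by rewrite lnK ?posrE.
pose j := Cexp (0 +i* (- (y * u0))).
have nj : normc j = 1 by rewrite normc_Cexp expR0.
(* Euler's integrand times the minorant [1 - 4 * y ^+ 2 * (expR t + expR (- t) - 2)] of
   [cos (y * t)], [t = u - u0], expanded so that each term is a real Gamma integrand at [x], [x + 1]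
   or [x - 1]. *)
pose m u := (1 + 8 * y ^+ 2) * expR (x * u - expR u)
  - (4 * y ^+ 2 / x) * expR ((x + 1) * u - expR u)
  - (4 * y ^+ 2 * x) * expR ((x - 1) * u - expR u).
have I x' (k : R) : 0 < x' -> mu.-integrable setT (EFin \o (fun u => k * expR (x' * u - expR u))).
  move=> x'0; rewrite (_ : _ \o _ = (fun u => (k%:E * (expR (x' * u - expR u))%:E)%E))//.
  by apply: integrableZl => //; exact: integrable_PhiR.
have z0 : 0 < re (x +i* y) by [].
have bP := ebd_PhiR z0.
have lowint : \int[mu]_u m u = rGamma x * (1 - 4 * y ^+ 2 / (x - 1)).
  have x2 : 0 < x + 1 by lra.
  rewrite /m RintegralB//; last 2 first.
  - by apply: integrableBR; exact: I.
  - exact: I.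
  rewrite RintegralB ?RintegralZl//; try exact: I; try exact: integrable_PhiR.
  rewrite -!rGammaE rGammaS//.
  have := rGammaS x10; rewrite subrK => E.
  rewrite E; field; apply/andP; split; lra.
have main : \int[mu]_u m u <= re (j * Gamma_int (x +i* y)).
  rewrite Gamma_intE -CintegralZ//.
  rewrite [leRHS](_ : _ = \int[mu]_u re (j * Phi (x +i* y) u%:C))//.
  apply: le_Rintegral => //.
  - apply: integrableBR; last exact: I.
    by apply: integrableBR; apply: I => //; lra.
  - by have [] := ebd_integrable (ebdZ j bP).
  move=> u _; pose t := u - u0.
  have -> : j * Phi (x +i* y) u%:C = Cexp ((x * u - expR u) +i* (y * t)).
    rewrite /j /Phi CexpR -CexpD; congr Cexp.
    by apply: complex_ext; rewrite !RIE/= /t; ring.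
  rewrite ReCexp/=.
  have -> : m u = expR (x * u - expR u) *
      (1 - y ^+ 2 * (4 * (expR t + expR (- t) - 2))).
    have -> : expR t = expR u / x by rewrite expRB eu0.
    have -> : expR (- t) = x * expR (- u).
      by rewrite /t opprB expRB eu0 expRN.
    rewrite /m.
    have -> : (x + 1) * u - expR u = (x * u - expR u) + u by ring.
    have -> : (x - 1) * u - expR u = (x * u - expR u) + - u by ring.
    by rewrite !(expRD (x * u - expR u)); field; lra.
  rewrite ler_pM2l ?expR_gt0//.
  have := cos_quadratic (y * t); rewrite exprMn.
  have : y ^+ 2 * t ^+ 2 <= y ^+ 2 * (4 * (expR t + expR (- t) - 2)).
    by rewrite ler_wpM2l ?sqr_ge0// sqr_le_cosh.
  lra.
have : re (j * Gamma_int (x +i* y)) <= normc (Gamma_int (x +i* y)).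
  by rewrite (le_trans (ler_norm _))// (le_trans (normc_Re _))// normcM nj mul1r.
move/(le_trans main); rewrite lowint.
have : rGamma x * (1 / 2) <= rGamma x * (1 - 4 * y ^+ 2 / (x - 1)).
  rewrite ler_pM2l ?rGamma_gt0//.
  have : 4 * y ^+ 2 / (x - 1) <= 1 / 2 by rewrite ler_pdivrMr//; lra.
  lra.
lra.
Qed.

(* An antiderivative in u of [ln (1 + y^2 / u^2)] that increases to [pi * y]. *)
Definition Hfun y u := u * ln (u ^+ 2 + y ^+ 2) - 2 * u * ln u + 2 * y * atan (u / y).

Lemma Hfun_derive y u : 0 < y -> 0 < u ->
  is_derive u 1 (Hfun y) (ln (u ^+ 2 + y ^+ 2) - 2 * ln u).
Proof.
move=> y0 u0.
have q0 : 0 < u ^+ 2 + y ^+ 2 by rewrite addr_gt0// exprn_gt0.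
have D1 := is_derive1_ln q0.
have D2 := is_derive1_ln u0.
have D3 := is_derive1_atan (u / y).
have E1 : is_derive u 1 (fun u => u ^+ 2 + y ^+ 2) (2 * u).
  apply: is_derive_eq; rewrite /GRing.scale/=; ring.
have E2 : is_derive u 1 (fun u => ln (u ^+ 2 + y ^+ 2)) ((u ^+ 2 + y ^+ 2)^-1 * (2 * u)).
  exact: (@is_derive1_comp _ (@ln R) (fun u => u ^+ 2 + y ^+ 2)).
have E3 : is_derive u 1 (fun u => u / y) y^-1.
  by apply: is_derive_eq; rewrite /GRing.scale/=; ring.
have E4 : is_derive u 1 (fun u => atan (u / y)) ((1 + (u / y) ^+ 2)^-1 * y^-1).
  exact: (@is_derive1_comp _ (@atan R) (fun u => u / y)).
rewrite /Hfun; apply: is_derive_eq.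
rewrite /GRing.scale/=.
have u1 : u != 0 by rewrite gt_eqF.
have y1 : y != 0 by rewrite gt_eqF.
have q1 : u ^+ 2 + y ^+ 2 != 0 by rewrite gt_eqF.
have q2 : y ^+ 2 + u ^+ 2 != 0 by rewrite addrC.
by field; rewrite ?u1 ?y1 ?q1 ?q2.
Qed.

(** Comparison of a sum with an integral: the derivative of [Hfun y] decreases, so by the mean value
    theorem its increment over a unit interval is at least the derivative at the right end, which is
    the next term. *)
Lemma Hfun_ge_sum y N : 0 < y ->
  \sum_(k < N.+1) ln (1 + y ^+ 2 / k.+1%:R ^+ 2) <= Hfun y N.+1%:R.
Proof.
move=> y0; elim: N => [|N IH].
  rewrite big_ord1 /Hfun !expr1n ln1 mulr0 subr0 mul1r divr1 lerDl.
  by rewrite !mulr_ge0 ?(ltW y0)// -atan0 le_atan// divr_ge0// ltW.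
rewrite big_ord_recr/= (le_trans (lerD IH (lexx _)))// -lerBrDl.
have N0 : 0 < N.+1%:R :> R by rewrite ltr0n.
have NN : N.+1%:R < N.+2%:R :> R by rewrite ltr_nat.
have D (u : R) : u \in `]N.+1%:R, N.+2%:R[ ->
    is_derive u 1 (Hfun y) (ln (u ^+ 2 + y ^+ 2) - 2 * ln u).
  rewrite in_itv/= => /andP[u1 _]; apply: Hfun_derive => //; exact: lt_trans u1.
have cH : {within `[N.+1%:R, N.+2%:R]%classic, continuous (Hfun y)}.
  apply: continuous_in_subspaceT => u; rewrite inE/= in_itv/= => /andP[u1 _].
  have u0 : 0 < u by exact: lt_le_trans u1.
  apply: differentiable_continuous; apply/derivable1_diffP.
  by have [] := Hfun_derive y0 u0.
have [c + ->] := MVT NN D cH.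
rewrite in_itv/= => /andP[c1 c2].
have c0 : 0 < c by exact: lt_trans c1.
have -> : N.+2%:R - N.+1%:R = 1 :> R by rewrite -natr1 addrC addKr.
rewrite mulr1.
have -> : ln (c ^+ 2 + y ^+ 2) - 2 * ln c = ln (1 + y ^+ 2 / c ^+ 2).
  have -> : 1 + y ^+ 2 / c ^+ 2 = (c ^+ 2 + y ^+ 2) / c ^+ 2 by field; rewrite gt_eqF.
  rewrite ln_div ?posrE ?addr_gt0 ?exprn_gt0// lnXn//.
  by rewrite mulr_natl.
rewrite ler_ln ?posrE ?ltr_wpDr ?divr_ge0 ?exprn_ge0 ?(ltW y0) ?(ltW c0)//.
rewrite lerD2l ler_wpM2l ?sqr_ge0// lef_pV2 ?posrE ?exprn_gt0//.
by rewrite lerXn2r ?nnegrE ?(ltW c0)// ltW.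
Qed.

(** In [Hfun y n] the arctangent is below [pi / 2], which gives [pi * y]. The logarithmic terms
    combine into [n * ln (1 + y ^+ 2 / n ^+ 2)], at most [y ^+ 2 / n], hence at most 1. *)
Lemma sum_ln_le y N : y ^+ 2 <= N.+1%:R ->
  \sum_(k < N.+1) ln (1 + y ^+ 2 / k.+1%:R ^+ 2) <= pi * `|y| + 1.
Proof.
wlog y0 : y / 0 <= y.
  move=> H yN; have := H `|y| (normr_ge0 y).
  by rewrite real_normK ?num_real// normr_id => /(_ yN).
rewrite (ger0_norm y0); move: y0; rewrite le_eqVlt => /predU1P[<- _|y0 yN].
  rewrite big1 ?mulr0 ?add0r// => k _.
  by rewrite expr0n mul0r addr0 ln1.
have N0 : 0 < N.+1%:R :> R by rewrite ltr0n.
rewrite (le_trans (Hfun_ge_sum N y0))// /Hfun.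
set n := N.+1%:R in N0 yN *.
have E : n * ln (n ^+ 2 + y ^+ 2) - 2 * n * ln n = n * ln (1 + y ^+ 2 / n ^+ 2).
  have -> : 1 + y ^+ 2 / n ^+ 2 = (n ^+ 2 + y ^+ 2) / n ^+ 2 by field; rewrite gt_eqF.
  rewrite ln_div ?posrE ?addr_gt0 ?exprn_gt0// lnXn// -mulr_natl; ring.
rewrite E.
have q0 : 0 <= y ^+ 2 / n ^+ 2 by rewrite divr_ge0 ?sqr_ge0.
have L : ln (1 + y ^+ 2 / n ^+ 2) <= y ^+ 2 / n ^+ 2.
  by apply: le_ln1Dx; apply: lt_le_trans q0; rewrite oppr_lt0.
have : n * ln (1 + y ^+ 2 / n ^+ 2) <= 1.
  apply: (@le_trans _ _ (n * (y ^+ 2 / n ^+ 2))); first by rewrite ler_pM2l.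
  have -> : n * (y ^+ 2 / n ^+ 2) = y ^+ 2 / n by field; rewrite gt_eqF.
  by rewrite ler_pdivrMr// mul1r.
have : 2 * y * atan (n / y) <= 2 * y * (pi / 2).
  by rewrite ler_pM2l ?mulr_gt0// ltW// atan_ltpi2.
lra.
Qed.

(** [1 <= x] lets [k + 1] replace [x + k] in the denominator, making the correction independent of
    [x]; as an exponential of logarithms it turns products over [k] into sums. *)
Lemma normc_line_le x y (k : nat) : 1 <= x ->
  normc (x +i* y + k%:R) <= (x + k%:R) * expR (ln (1 + y ^+ 2 / k.+1%:R ^+ 2) / 2).
Proof.
move=> x1; have k0 : 0 <= k%:R :> R by exact: ler0n.
have e0 := expR_ge0 (ln (1 + y ^+ 2 / k.+1%:R ^+ 2) / 2).
have xk : 0 <= x + k%:R by lra.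
have -> : x +i* y + k%:R = (x + k%:R) +i* y.
  rewrite -(rmorph_nat (real_complex R)).
  by apply: complex_ext; rewrite !RIE/= ?addr0.
rewrite /= -[leRHS]ger0_norm ?mulr_ge0// -sqrtr_sqr ler_wsqrtr// exprMn.
rewrite -expRM_natl (_ : 2 * _ = ln (1 + y ^+ 2 / k.+1%:R ^+ 2)); last by rewrite mulrC divfK.
have p : 0 <= y ^+ 2 / k.+1%:R ^+ 2 by rewrite divr_ge0 ?sqr_ge0.
rewrite lnK ?posrE ?ltr_wpDr// mulrDr mulr1 lerD2l mulrCA ler_peMr ?sqr_ge0//.
rewrite ler_pdivlMr ?exprn_gt0// mul1r lerXn2r ?nnegrE//.
by rewrite -natr1; lra.
Qed.

(** Cross-multiplied comparison of the quotients |Gamma (x + i y)| / Gamma (x) before and after [N]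
    steps of the recurrence, each step costing one factor from [normc_line_le]. *)
Lemma Gamma_int_ratio x y N : 1 <= x ->
  normc (Gamma_int (x +i* y + N%:R)) * rGamma x <=
  normc (Gamma_int (x +i* y)) * rGamma (x + N%:R) *
  expR (\sum_(k < N) ln (1 + y ^+ 2 / k.+1%:R ^+ 2) / 2).
Proof.
move=> x1; elim: N => [|N IH]; first by rewrite big_ord0 expR0 !addr0 mulr1.
have N0 : 0 <= N%:R :> R by exact: ler0n.
have xN : 0 < x + N%:R by lra.
have rN : re (x +i* y + N%:R) = x + N%:R.
  by rewrite -(rmorph_nat (real_complex R)) RIE.
have e1 : x +i* y + N.+1%:R = (x +i* y + N%:R) + 1 by rewrite -natr1 addrA.
have e2 : x + N.+1%:R = (x + N%:R) + 1 by rewrite -natr1 addrA.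
rewrite big_ord_recr expRD e1 e2 Gamma_int_rec ?rN// rGammaS// normcM -mulrA.
have := ler_pM (normc_ge0 _) _ (normc_line_le y N x1) IH.
rewrite mulr_ge0 ?normc_ge0// ?(ltW (rGamma_gt0 _)) ?(lt_le_trans ltr01)// => /(_ isT).
move=> /le_trans; apply; rewrite le_eqVlt; apply/orP; left; apply/eqP; ring.
Qed.

(* The exponential rate pi / 2 is sharp; it comes from the finite products
   [prod (1 + y^2 / k^2) <= e * exp (pi * |y|)]. *)
Lemma Gamma_int_lower : exists c, 0 < c /\ forall s, 1 <= re s ->
  c * expR (- (pi / 2 * `|im s|)) <= normc (Gamma_int s).
Proof.
(* The three factors come from [rGamma_ge], from half of the additive 1 in [sum_ln_le], and from the
   2 in [Gamma_int_ge_half]. *)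
pose c := expR (- expR 1) * expR (- (1 / 2)) / 2 : R.
exists c; split; first by rewrite !mulr_gt0 ?expR_gt0 ?invr_gt0.
case=> x y; rewrite -[re _]/x -[im _]/y => x1.
(* With [8 * y ^+ 2 < N + 1], both [Gamma_int_ge_half] at [x + N + 1] and [sum_ln_le] apply. *)
pose N := (Num.truncn (8 * y ^+ 2)).
have hN : 8 * y ^+ 2 < N.+1%:R by exact: truncnS_gt.
have y2 := sqr_ge0 y.
have NN : 0 < N.+1%:R :> R by rewrite ltr0n.
have rat := Gamma_int_ratio y N.+1 x1.
have G0 : 0 < rGamma x by rewrite rGamma_gt0// (lt_le_trans ltr01).
have GN : 0 < rGamma (x + N.+1%:R) by rewrite rGamma_gt0//; lra.
have half : rGamma (x + N.+1%:R) <= 2 * normc (Gamma_int ((x + N.+1%:R) +i* y)).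
  by apply: Gamma_int_ge_half; lra.
have e1 : x +i* y + N.+1%:R = (x + N.+1%:R) +i* y.
  by rewrite -(rmorph_nat (real_complex R)); apply: complex_ext; rewrite !RIE/= ?addr0.
rewrite e1 in rat.
have S : expR (\sum_(k < N.+1) ln (1 + y ^+ 2 / k.+1%:R ^+ 2) / 2) <=
    expR (pi / 2 * `|y| + 1 / 2).
  rewrite ler_expR -mulr_suml ler_pdivrMr//.
  have := @sum_ln_le y N (ltW (le_lt_trans _ hN)).
  have y8 : y ^+ 2 <= 8 * y ^+ 2 by lra.
  move=> /(_ y8).
  lra.
set e := expR (\sum_(k < N.+1) _) in S rat.
have P : rGamma (x + N.+1%:R) * rGamma x <= 2 * (normc (Gamma_int (x +i* y)) * rGamma (x + N.+1%:R) * e).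
  apply: (@le_trans _ _ (2 * normc (Gamma_int ((x + N.+1%:R) +i* y)) * rGamma x)).
    by rewrite ler_pM2r.
  by rewrite -mulrA ler_pM2l.
have {}P : rGamma x <= 2 * normc (Gamma_int (x +i* y)) * e.
  by rewrite -(ler_pM2l GN) (le_trans P)// le_eqVlt; apply/orP; left; apply/eqP; ring.
have {}P : rGamma x <= 2 * normc (Gamma_int (x +i* y)) * expR (pi / 2 * `|y| + 1 / 2).
  by rewrite (le_trans P)// ler_wpM2l// mulr_ge0// normc_ge0.
have Gx : expR (- expR 1) <= rGamma x by apply: rGamma_ge; lra.
have {}P := le_trans Gx P.
have ei : expR (- (pi / 2 * `|y|)) * expR (- (1 / 2)) * expR (pi / 2 * `|y| + 1 / 2) = 1.
  rewrite -!expRD -[RHS]expR0; congr expR; ring.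
rewrite -(ler_pM2r (expR_gt0 (pi / 2 * `|y| + 1 / 2))) /c.
have -> : expR (- expR 1) * expR (- (1 / 2)) / 2 * expR (- (pi / 2 * `|y|)) *
   expR (pi / 2 * `|y| + 1 / 2) = expR (- expR 1) / 2 * (expR (- (pi / 2 * `|y|)) *
    expR (- (1 / 2)) * expR (pi / 2 * `|y| + 1 / 2)) by ring.
by rewrite ei mulr1 ler_pdivrMr// mulrC mulrA.
Qed.

End gamma_lower_bound.

(** * The reciprocal Gamma function on arbitrary strips *)

Section gamma_reciprocal.
Context {R : realType}.
Implicit Types (z w s h : R[i]) (a b x y u t : R) (F : R[i] -> R[i]).

Lemma Gamma_pos z : 0 < re z -> Gamma z = Gamma_int z.
Proof. by move=> z0; rewrite /Gamma z0. Qed.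

Lemma Gamma_rec z : 0 < re z -> Gamma (z + 1) = z * Gamma z.
Proof.
move=> z0; rewrite !Gamma_pos//; first exact: Gamma_int_rec.
by rewrite ReD /= addr_gt0.
Qed.

(* Junk value: [Gamma] is 0 at its poles, so this holds everywhere. *)
Lemma Gamma_inv_rec z : (Gamma z)^-1 = z * (Gamma (z + 1))^-1.
Proof.
have [z0|z0] := ltP 0 (re z).
  rewrite Gamma_rec// invfM mulrA mulfV ?mul1r//.
  by apply/eqP => zE; move: z0; rewrite zE ltxx.
have E : Gamma z = Gamma_int (z + (Num.truncn (- re z)).+1%:R) /
    \prod_(k < (Num.truncn (- re z)).+1) (z + k%:R).
  by rewrite /Gamma ltNge z0.
have [z1|z1] := ltP 0 (re (z + 1)).
  have t0 : Num.truncn (- re z) = 0%N.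
    apply: truncn_def; rewrite oppr_ge0 z0/=.
    by move: z1; rewrite ReD /=; lra.
  by rewrite E t0 big_ord1 addr0 invf_div Gamma_pos.
have z1' : 0 <= - re z - 1 by move: z1; rewrite ReD /=; lra.
have tS : Num.truncn (- re z) = (Num.truncn (- re (z + 1))).+1.
  have e1 : - re (z + 1) = - re z - 1 by rewrite ReD /=; ring.
  apply: truncn_def; rewrite e1; have /andP[t1 t2] := truncn_itv z1'.
  by rewrite -!natr1 in t2 *; apply/andP; split; lra.
rewrite E /Gamma ltNge z1/= tS; set m := Num.truncn (- re (z + 1)).
rewrite !invf_div big_ord_recl/= addr0 -mulrA; congr (_ * (_ / _)).
  by apply: eq_bigr => k _; rewrite -addrA nat1r.
by rewrite -addrA nat1r.
Qed.

Lemma hol_shift F a b rho (c : R) : hol F (a + c) (b + c) rho ->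
  hol (fun s => F (s + c%:C)) a b rho.
Proof.
move=> [C [d [C0 d0 H]]]; exists C, d; split => // s /andP[s1 s2].
have ims : im (s + c%:C) = im s by rewrite ImD /= addr0.
have [|F0 [A [HA Hr]]] := H (s + c%:C).
  by rewrite ReD /= !lerD2r s1.
rewrite ims in F0 HA Hr; split => //; exists A; split => // h hd.
by rewrite (addrAC s) Hr.
Qed.

Lemma hol_Gamma a b th : 0 < a -> 0 <= th < pi / 2 ->
  hol (@Gamma R) a b (- th).
Proof.
move=> a0 thb; apply: hol_ext (hol_Gamma_int b a0 thb) => //.
by move=> s s0; rewrite Gamma_pos.
Qed.

(** For [2 <= a], [hol_inv] combines the decay [pi / 2 - d] with the lower bound of rate [pi / 2]:
    [- 2 * (pi / 2 - d) + 3 * (pi / 2)] is only [2 * d] above [pi / 2]. The margin 2 leaves room to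
    widen the strip by 1 inside [1 <= re s]. Other strips are reached leftwards by [Gamma_inv_rec],
    each step giving away half of the current [e] to the linear factor. *)
Lemma hol_Gamma_inv a b e : 0 < e -> hol (fun s => (Gamma s)^-1) a b (pi / 2 + e).
Proof.
have p0 := @pihalf_gt0 R.
suff H n : forall a b e, 2 <= a + n%:R -> 0 < e ->
    hol (fun s => (Gamma s)^-1 : R[i]) a b (pi / 2 + e).
  move=> e0; apply: (H (Num.truncn `|2 - a|).+1) => //.
  have := truncnS_gt `|2 - a|; have := ler_norm (2 - a); lra.
elim: n => [|n IH] {}a {}b {}e a2 e0.
  rewrite addr0 in a2.
  pose d := Num.min (e / 2) (pi / 4).
  have d0 : 0 < d by rewrite lt_min !divr_gt0// pi_gt0.
  have de : 2 * d <= e.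
    have : d <= e / 2 by rewrite ge_min lexx.
    lra.
  have dp : d <= pi / 4 by rewrite ge_min lexx orbT.
  have thb : 0 <= pi / 2 - d < pi / 2 by apply/andP; split; lra.
  have a0 : 0 < a by lra.
  have [c [c0 L]] := @Gamma_int_lower R.
  apply: (@hol_le _ _ a b (2 * (- (pi / 2 - d)) + 3 * (pi / 2))) => //; first lra.
  apply: (@hol_ext _ (fun s => (Gamma_int s)^-1)) => //.
    by move=> s s0; rewrite Gamma_pos.
  apply: (@hol_inv _ _ _ _ _ _ c 1) => //; rewrite ?(ltW p0)//; first lra.
    exact: hol_Gamma_int.
  by move=> s /andP[s1 _]; apply: L; lra.
have e2 : 0 < e / 2 by rewrite divr_gt0.
have -> : (fun s => (Gamma s)^-1 : R[i]) = (fun s => s * (Gamma (s + 1%:C))^-1).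
  by apply/funext => s; rewrite Gamma_inv_rec.
have -> : pi / 2 + e = e / 2 + (pi / 2 + e / 2) by field.
apply: (@hol_mul _ id); first exact: hol_id.
apply: (@hol_shift (fun s => (Gamma s)^-1)); apply: IH => //.
by rewrite -natr1 in a2; lra.
Qed.

End gamma_reciprocal.

(** * Euler's Beta integral *)

Section beta.
Context {R : realType}.
Implicit Types (p z : R[i]) (r u v : R).

(** For t = e^v / (1 + e^v), this is - ln (1 - t), and [v - softplus v] is ln t. *)
Definition softplus v := ln (1 + expR v) : R.

Lemma softplus_gt0 v : 0 < softplus v.
Proof. by rewrite ln_gt0// ltrDl expR_gt0. Qed.

Lemma expR_softplus v : expR (softplus v) = 1 + expR v.
Proof. by rewrite lnK// posrE addr_gt0// expR_gt0. Qed.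

Lemma softplus_ge v : v <= softplus v.
Proof. by rewrite -ler_expR expR_softplus lerDr. Qed.

Lemma measurable_softplus : measurable_fun setT softplus.
Proof.
apply: measurableT_comp; first exact: measurable_ln.
by apply: measurable_funD => //; exact: measurable_expR.
Qed.

(* Euler's Beta integrand with the logistic substitution t = e^v / (1 + e^v). *)
Definition Bint r p v := Cexp (p * v%:C - (r%:C + p) * (softplus v)%:C).

Lemma normc_Bint r p v : 0 < r -> 0 < re p ->
  normc (Bint r p v) <= expR (- (Num.min r (re p) * `|v|)).
Proof.
move=> r0 p0; rewrite normc_Cexp ler_expR !RIE /=.
have s0 := softplus_gt0 v; have s1 := softplus_ge v.
set q := re p in p0 *; set m := Num.min r q; set L := softplus v in s0 s1 *.
have mr : m <= r by rewrite ge_min lexx.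
have mq : m <= q by rewrite ge_min lexx orbT.
have [v0|v0] := leP 0 v.
  rewrite (ger0_norm v0).
  have : m * v <= r * v by exact: ler_wpM2r.
  have : (r + q) * v <= (r + q) * L by rewrite ler_pM2l// addr_gt0.
  lra.
rewrite (ltr0_norm v0).
have : q * v <= m * v by rewrite ler_wnM2r// ltW.
have : 0 <= (r + q) * L by rewrite mulr_ge0 ?addr_ge0// ltW.
lra.
Qed.

Lemma Cmeas_Bint r p : Cmeas (Bint r p).
Proof.
apply: Cmeas_exp; apply: CmeasB; apply: CmeasM; try exact: Cmeas_cst.
- by apply: CmeasR; exact: measurable_id.
- by apply: CmeasR; exact: measurable_softplus.
Qed.

Lemma ebd_Bint r p : 0 < r -> 0 < re p -> ebd (Bint r p).
Proof.
move=> r0 p0; exists 1, (Num.min r (re p)); split.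
- by rewrite lt_min r0.
- exact: Cmeas_Bint.
- by move=> v; rewrite mul1r normc_Bint.
Qed.

Lemma beta_dominated r (P : R) : 0 < r -> 0 < P -> exists C eta, [/\ 0 <= C, 0 < eta &
  forall u v, expR ((r + P) * u + P * v - expR u * (1 + expR v)) <=
    C * (expR (- (eta * `|u|)) * expR (- (eta * `|v|)))].
Proof.
move=> r0 P0; pose q := P + r / 2.
have q0 : 0 < q by rewrite addr_gt0// divr_gt0.
have [C1 [C10 H1]] := @exp_exp_bound R q q 1 q0 ltr01.
have r20 : 0 < r / 2 by rewrite divr_gt0.
have [C2 [C20 H2]] := @exp_exp_bound R (r / 2) (r + P) 1 r20 ltr01.
pose eta := Num.min (r / 2) P.
have eta0 : 0 < eta by rewrite lt_min r20 P0.
have er : eta <= r / 2 by rewrite ge_min lexx.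
have eP : eta <= P by rewrite ge_min lexx orbT.
exists (C2 * C1 + C2), eta; split => //; first by rewrite addr_ge0 ?mulr_ge0.
move=> u v.
have eu0 := expR_gt0 u.
have down : expR (- (r / 2 * `|u|)) <= expR (- (eta * `|u|)).
  by rewrite ler_expR lerN2 ler_wpM2r.
have [v0|v0] := leP 0 v.
  have A2 : expR (r / 2 * u - expR u) <= C2 * expR (- (eta * `|u|)).
    apply: (@le_trans _ _ (C2 * expR (- (r / 2 * `|u|)))); last exact: ler_wpM2l.
    by have := H2 (r / 2) u; rewrite mul1r; apply; apply/andP; split; lra.
  have A1 : expR (q * (u + v) - expR (u + v)) <= C1.
    apply: (@le_trans _ _ (C1 * expR (- (q * `|u + v|)))).
      by have := H1 q (u + v); rewrite mul1r; apply; rewrite lexx.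
    by rewrite ler_piMr// expR_le1 oppr_le0 mulr_ge0// ltW.
  have -> : expR ((r + P) * u + P * v - expR u * (1 + expR v)) =
    expR (r / 2 * u - expR u) * expR (q * (u + v) - expR (u + v)) * expR (- (r / 2 * v)).
    by rewrite -!expRD; congr expR; rewrite /q expRD; field.
  have B : expR (- (r / 2 * v)) <= expR (- (eta * `|v|)).
    by rewrite ger0_norm// ler_expR lerN2 ler_wpM2r.
  apply: (@le_trans _ _ (C2 * expR (- (eta * `|u|)) * C1 * expR (- (eta * `|v|)))).
    by apply: ler_pM; rewrite ?mulr_ge0 ?expR_ge0//; apply: ler_pM; rewrite ?expR_ge0.
  have : 0 <= C2 * (expR (- (eta * `|u|)) * expR (- (eta * `|v|))).
    by rewrite !mulr_ge0 ?expR_ge0.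
  lra.
have A2 : expR ((r + P) * u - expR u) <= C2 * expR (- (eta * `|u|)).
  apply: (@le_trans _ _ (C2 * expR (- (r / 2 * `|u|)))); last exact: ler_wpM2l.
  by have := H2 (r + P) u; rewrite mul1r; apply; apply/andP; split; lra.
have -> : expR ((r + P) * u + P * v - expR u * (1 + expR v)) =
    expR ((r + P) * u - expR u) * expR (P * v) * expR (- (expR u * expR v)).
  by rewrite -!expRD; congr expR; rewrite expRD; ring.
have B : expR (P * v) <= expR (- (eta * `|v|)).
  rewrite ltr0_norm// ler_expR mulrN opprK ler_wnM2r// ltW//.
have B2 : expR (- (expR u * expR v)) <= 1.
  by rewrite expR_le1 oppr_le0 mulr_ge0 ?expR_ge0.
apply: (@le_trans _ _ (C2 * expR (- (eta * `|u|)) * expR (- (eta * `|v|)) * 1)).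
  by apply: ler_pM; rewrite ?mulr_ge0 ?expR_ge0//; apply: ler_pM; rewrite ?expR_ge0.
have : 0 <= C2 * C1 * (expR (- (eta * `|u|)) * expR (- (eta * `|v|))).
  by rewrite !mulr_ge0 ?expR_ge0.
lra.
Qed.

(** One double integral is evaluated in both orders. Translating [v] by [u] in the second Gamma
    integral gives [f]; translating [u] by [softplus v] in the Gamma integral at [r + p] splits [f]
    into that integral and the Beta integrand. *)
Lemma Beta_Gamma r p : 0 < r -> 0 < re p ->
  Gamma_int r%:C * Gamma_int p = Gamma_int (r%:C + p) * Cintegral setT (Bint r p).
Proof.
move=> r0 p0.
have rp0 : 0 < re (r%:C + p) by rewrite ReD addr_gt0.
have bp := ebd_PhiR p0; have br := @ebd_PhiR _ r%:C r0.
have brp := ebd_PhiR rp0.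
pose f (u v : R) := Cexp ((r%:C + p) * u%:C + p * v%:C - (expR u * (1 + expR v))%:C).
have nf u v : normc (f u v) = expR ((r + re p) * u + re p * v - expR u * (1 + expR v)).
  by rewrite normc_Cexp; congr expR; rewrite !RIE/=; ring.
have E1 u : Phi r%:C u%:C * Cintegral setT (fun v : R => Phi p v%:C) =
    Cintegral setT (f u).
  rewrite -(Cintegral_translate u (Ccont_Phi p0)) -CintegralZ; last first.
    have [C [eta [e0 m B]]] := bp.
    exists (C * expR (eta * `|u|)), eta; split => //.
      by apply: Cmeas_Phi; apply: CmeasR; exact: measurable_funD.
    move=> v; rewrite (le_trans (B (v + u)))// -mulrA -expRD ler_wpM2l//.
      by have := le_trans (normc_ge0 _) (B 0); rewrite pmulr_lge0// expR_gt0.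
    rewrite ler_expR.
    have : eta * `|v| <= eta * (`|v + u| + `|u|).
      by rewrite ler_pM2l// (le_trans _ (ler_normB _ _))// addrK.
    lra.
  congr Cintegral; apply/funext => v; rewrite /Phi -CexpD !CexpR /f; congr Cexp.
  by rewrite expRD; ring.
have E2 v : Cintegral setT (f^~ v) = Bint r p v * Gamma_int (r%:C + p).
  rewrite Gamma_intE -(Cintegral_translate (softplus v) (Ccont_Phi rp0)) -CintegralZ; last first.
    have [C [eta [e0 m B]]] := brp.
    exists (C * expR (eta * `|softplus v|)), eta; split => //.
      by apply: Cmeas_Phi; apply: CmeasR; exact: measurable_funD.
    move=> u; rewrite (le_trans (B (u + softplus v)))// -mulrA -expRD ler_wpM2l//.
      by have := le_trans (normc_ge0 _) (B 0); rewrite pmulr_lge0// expR_gt0.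
    rewrite ler_expR.
    have : eta * `|u| <= eta * (`|u + softplus v| + `|softplus v|).
      by rewrite ler_pM2l// (le_trans _ (ler_normB _ _))// addrK.
    lra.
  congr Cintegral; apply/funext => u; rewrite /Bint /Phi -CexpD CexpR /f; congr Cexp.
  by rewrite expRD expR_softplus; ring.
have [C [eta [C0 e0 HC]]] := beta_dominated r0 p0.
have mf : Cmeas (fun q : R * R => f q.1 q.2).
  have m1 : measurable_fun setT (fun q : R * R => q.1) by exact: measurable_fst.
  have m2 : measurable_fun setT (fun q : R * R => q.2) by exact: measurable_snd.
  have me := @measurable_expR R.
  apply: Cmeas_exp; apply: CmeasB; first apply: CmeasD.
  - by apply: CmeasM; [exact: Cmeas_cst|exact: CmeasR].
  - by apply: CmeasM; [exact: Cmeas_cst|exact: CmeasR].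
  - apply: CmeasR; apply: measurable_funM; first exact: measurableT_comp me m1.
    by apply: measurable_funD => //; exact: measurableT_comp me m2.
have Hf u v : normc (f u v) <= C * (expR (- (eta * `|u|)) * expR (- (eta * `|v|))).
  by rewrite nf HC.
have F := Cintegral_Fubini e0 mf Hf.
transitivity (Cintegral setT (fun u => Cintegral setT (f u))).
  rewrite (Gamma_intE r%:C) (Gamma_intE p).
  rewrite [LHS]mulrC -(CintegralZ (Cintegral setT (fun v : R => Phi p v%:C)) br).
  by congr Cintegral; apply/funext => u; rewrite -E1 mulrC.
rewrite F -(CintegralZ _ (ebd_Bint r0 p0)).
by congr Cintegral; apply/funext => v; rewrite E2 mulrC.
Qed.

End beta.

(** * Mellin-Barnes integrals and their fractional derivatives *)

Section derivatives.
Context {R : realType}.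

Lemma is_derive_quadratic (r : R -> R) (z l K d : R) : 0 < d ->
  (forall h, `|h| <= d -> `|r (z + h) - r z - h * l| <= K * h ^+ 2) ->
  is_derive z 1 r l.
Proof.
move=> d0 H.
have C : h^-1 *: (r (h *: 1 + z) - r z) @[h --> 0^'] --> l.
  apply/(@cvgrPdist_le _ R^o) => e e0.
  have K1 : 0 < `|K| + 1 by rewrite ltr_wpDl.
  near=> h.
  have h0 : h != 0 by near: h; exact: nbhs_dnbhs_neq.
  have hm : `|h| <= Num.min d (e / (`|K| + 1)).
    near: h; apply: dnbhs0_le; by rewrite lt_min d0 divr_gt0.
  move: hm; rewrite le_min => /andP[hd he].
  rewrite /GRing.scale/= mulr1 (addrC h).
  have -> : l - h^-1 * (r (z + h) - r z) = - (h^-1 * (r (z + h) - r z - h * l)).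
    by field.
  rewrite normrN normrM normfV ler_pdivrMl ?normr_gt0//.
  rewrite (le_trans (H h hd))// -real_normK ?num_real// expr2 mulrA mulrC.
  rewrite ler_wpM2l//; apply: (@le_trans _ _ ((`|K| + 1) * `|h|)).
    by rewrite ler_wpM2r// (le_trans (ler_norm K))// lerDl.
  by rewrite mulrC -ler_pdivlMr.
apply: DeriveDef; first by apply/cvg_ex; exists l.
exact: cvg_lim C.
Unshelve. all: by end_near. Qed.

(** Both sides come from [le_ln1Dx], applied to [1 + v] and to its inverse. *)
Lemma ln1p_quadratic (v : R) : `|v| <= 1 / 2 ->
  `|ln (1 + v) - v| <= 2 * v ^+ 2 /\ `|ln (1 + v)| <= 2 * `|v|.
Proof.
rewrite ler_norml => /andP[v1 v2].
have p0 : 0 < 1 + v by lra.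
have U : ln (1 + v) <= v by apply: le_ln1Dx; lra.
have L : v / (1 + v) <= ln (1 + v).
  rewrite -[leRHS]opprK -lnV ?posrE// lerNr.
  have := @le_ln1Dx R (- (v / (1 + v))).
  rewrite (_ : 1 + - (v / (1 + v)) = (1 + v)^-1); last by field; lra.
  by apply; rewrite ltrN2 ltr_pdivrMr// mul1r; lra.
have Q : v - v / (1 + v) <= 2 * v ^+ 2.
  have -> : v - v / (1 + v) = v ^+ 2 / (1 + v) by field; lra.
  rewrite ler_pdivrMr//; have := sqr_ge0 v; nra.
have A : `|ln (1 + v) - v| <= 2 * v ^+ 2 by rewrite ler_norml; apply/andP; split; lra.
split => //.
have B : `|ln (1 + v)| <= `|ln (1 + v) - v| + `|v|.
  by rewrite (le_trans _ (ler_normD _ _))// subrK.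
have : 2 * v ^+ 2 <= `|v|.
  rewrite -real_normK ?num_real// expr2.
  have : `|v| * `|v| <= `|v| * (1 / 2).
    by rewrite ler_wpM2l// ler_norml; apply/andP; split; lra.
  lra.
lra.
Qed.

End derivatives.

(** * Mellin-Barnes integrals as functions of [z] *)

Section mellin.
Context {R : realType}.
Variables (K : R[i] -> R[i]) (k be sig : R).
Hypothesis k_gt0 : 0 < k.
Hypothesis sig_gt : k * (pi / 2) < sig.
Hypothesis K_hol : forall a b, b < be -> hol K a b (- sig).
Implicit Types (e g z u v t r : R) (s : R[i]).

(** Half of the gap between the decay of [K] and the sharp growth of the reciprocal Gamma factor;
    the other half is spent on the loss in [hol_Gamma_inv]. *)
Let eta := (sig - k * (pi / 2)) / 2.

Let eta_gt0 : 0 < eta. Proof. by rewrite /eta divr_gt0// subr_gt0. Qed.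

Definition mellin_coef e s := K s / Gamma (e%:C - k%:C * s).

Definition mellin_integrand e z s :=
  mellin_coef e s * Cexp ((e%:C - 1 - k%:C * s) * (ln z)%:C).

(* The Mellin-Barnes integral along [Re s = g], normalised so that differentiation
   in [z] lowers [e] by one and Riemann-Liouville integration of order [r] raises
   it by [r]. *)
Definition mellin g e z := Cintegral setT (fun t => mellin_integrand e z (g +i* t)).

Lemma hol_mellin_coef e a b : b < be -> hol (mellin_coef e) a b (- eta).
Proof.
move=> bb; pose d := eta / k.
have d0 : 0 < d by rewrite divr_gt0.
have -> : - eta = - sig + k * (pi / 2 + d).
  by rewrite /d /eta; field; rewrite gt_eqF.
apply: hol_mul; first exact: K_hol.
by apply: (@hol_affine _ (fun s => (Gamma s)^-1)) => //; exact: hol_Gamma_inv.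
Qed.

Lemma hol_mellin e z a b : b < be -> hol (mellin_integrand e z) a b (- eta).
Proof.
move=> bb.
have -> : mellin_integrand e z = (fun s => mellin_coef e s *
    (Cexp ((e%:C - 1) * (ln z)%:C) * Cexp ((- (k * ln z))%:C * s))).
  apply/funext => s; rewrite -CexpD /mellin_integrand; congr (_ * Cexp _); ring.
rewrite -[- eta]addr0; apply: hol_mul; first exact: hol_mellin_coef.
by rewrite -[0]addr0; apply: hol_mul; [exact: hol_cst|exact: hol_exp].
Qed.

Lemma mellin_edom e z g : g < be ->
  exists C, edom C eta (fun t => mellin_integrand e z (g +i* t)).
Proof.
move=> gb; have [C H] := hol_edom eta_gt0 (@hol_mellin e z g g gb).
by exists C; apply: H; rewrite lexx.
Qed.

Lemma mellin_ebd e z g : g < be -> ebd (fun t => mellin_integrand e z (g +i* t)).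
Proof. by move=> /(mellin_edom e z)[C H]; exists C, eta. Qed.

Lemma mellin_shift e z g g' : g < be -> g' < be -> mellin g e z = mellin g' e z.
Proof.
move=> gb gb'.
apply: (contour_shift eta_gt0 (@hol_mellin e z (Num.min g g') (Num.max g g') _)).
- by rewrite gt_max gb.
- by rewrite ge_min le_max lexx.
- by rewrite ge_min le_max lexx !orbT.
Qed.

Lemma mellin_coefB1 e s :
  mellin_coef (e - 1) s = (e%:C - 1 - k%:C * s) * mellin_coef e s.
Proof.
rewrite /mellin_coef Gamma_inv_rec mulrCA; congr (_ * (K s / Gamma _));
  rewrite rmorphB rmorph1; ring.
Qed.

Lemma mellin_integrandB1 e z s : 0 < z -> mellin_integrand (e - 1) z s =
  (e%:C - 1 - k%:C * s) * mellin_integrand e z s / z%:C.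
Proof.
move=> z0; rewrite /mellin_integrand mellin_coefB1.
have -> : ((e - 1)%:C - 1 - k%:C * s) * (ln z)%:C =
  (e%:C - 1 - k%:C * s) * (ln z)%:C - (ln z)%:C by rewrite rmorphB rmorph1; ring.
by rewrite CexpB CexpR lnK ?posrE// !mulrA.
Qed.

(** Differentiation under the integral sign, done by hand: passing from [z] to [z + h] multiplies
    the integrand by [Cexp (p * ta)], where [ta] is the increment of the logarithm, and [ta] differs
    from [h / z] by O(h^2). *)
Lemma mellin_quadratic e z g : g < be -> 0 < z ->
  exists C d : R, [/\ 0 < d, d < z & forall h : R, `|h| <= d ->
    normc (mellin g e (z + h) - mellin g e z - h%:C * mellin g (e - 1) z)
      <= C * h ^+ 2].
Proof.
move=> gb z0; have [C HC] := mellin_edom e z gb.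
have [_ mF BF] := HC.
pose q := `|e - 1 - k * g| + 1.
have q0 : 0 < q by rewrite ltr_wpDl.
pose W t := q + k * `|t|.
have W1 t : 1 <= W t.
  have : 0 <= k * `|t| by rewrite mulr_ge0// ltW.
  by have := normr_ge0 (e - 1 - k * g); rewrite /W /q; lra.
(* Chosen so that [W t ^+ 2], which bounds the square of the exponent [p], costs half of the decay
   rate [eta]. *)
pose ep := eta / (4 * k).
have ep0 : 0 < ep by rewrite divr_gt0// mulr_gt0.
pose M := ep^-1 ^+ 2 * expR (2 * ep * q).
have M0 : 0 <= M by rewrite mulr_ge0 ?expR_ge0// exprn_ge0// invr_ge0 ltW.
have W2 t : W t ^+ 2 <= M * expR (eta / 2 * `|t|).
  have := ler_expR_lin (W t) ep0 => h.
  have -> : M * expR (eta / 2 * `|t|) = (ep^-1 * expR (ep * W t)) ^+ 2.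
    rewrite /M exprMn -mulrA; congr (_ * _).
    by rewrite -expRM_natl -expRD; congr expR; rewrite /ep /W; field; rewrite gt_eqF.
  by rewrite lerXn2r// nnegrE ?(le_trans ler01)// (le_trans _ h)// (le_trans ler01).
(* The first term comes from [Cexp_quadratic] with [|ta| <= 2 * |h / z|], the second from replacing
   [ta] by [h / z]. *)
pose D := 16 / z ^+ 2 * expR q + 2 / z ^+ 2.
have zz : 0 < z ^+ 2 by rewrite exprn_gt0.
have D0 : 0 <= D.
  apply: addr_ge0; last by rewrite divr_ge0// ltW.
  by apply: mulr_ge0 (expR_ge0 _); rewrite divr_ge0// ltW.
have C0 : 0 <= C.
  by have := le_trans (normc_ge0 _) (BF 0); rewrite pmulr_lge0// expR_gt0.
have e2 : 0 < eta / 2 by rewrite divr_gt0.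
exists (2 * (D * C * M) * expmass (eta / 2)), (z / 2); split; [lra|lra|].
move=> h hz.
have zh0 : 0 < z + h by move: hz; rewrite ler_norml => /andP[? ?]; lra.
pose ta := ln (z + h) - ln z.
have hv : `|h / z| <= 1 / 2.
  by rewrite normrM normfV (gtr0_norm z0) ler_pdivrMr//; lra.
have taE : ta = ln (1 + h / z).
  rewrite /ta -ln_div ?posrE//; congr ln; by field; rewrite gt_eqF.
have [t1 t2] := ln1p_quadratic hv.
rewrite -taE in t1 t2.
have bnd (t : R) : normc (mellin_integrand e (z + h) (g +i* t) - mellin_integrand e z (g +i* t)
     - h%:C * mellin_integrand (e - 1) z (g +i* t)) <=
     D * C * M * h ^+ 2 * expR (- (eta / 2 * `|t|)).
  set s := g +i* t; pose p := e%:C - 1 - k%:C * s.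
  have rp : re p = e - 1 - k * g by rewrite /p /s !RIE/=; ring.
  have ip : im p = - (k * t) by rewrite /p /s !RIE/=; ring.
  have np : normc p <= W t.
    rewrite (le_trans (normc_le _))// rp ip normrN normrM (gtr0_norm k_gt0) /W /q; lra.
  have -> : mellin_integrand e (z + h) s - mellin_integrand e z s -
      h%:C * mellin_integrand (e - 1) z s =
      mellin_integrand e z s * ((Cexp (p * ta%:C) - 1 - p * ta%:C) + p * (ta - h / z)%:C).
    have -> : mellin_integrand e (z + h) s = mellin_integrand e z s * Cexp (p * ta%:C).
      rewrite /mellin_integrand -mulrA -CexpD; congr (_ * Cexp _).
      by rewrite /p /ta rmorphB; ring.
    have E : (ta - h / z)%:C = ta%:C - h%:C / z%:C :> R[i].
      by rewrite -(fmorphV (real_complex R)); ring.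
    by rewrite mellin_integrandB1// -/p E; ring.
  rewrite normcM.
  have A1 : normc (Cexp (p * ta%:C) - 1 - p * ta%:C) <= 16 / z ^+ 2 * expR q * W t ^+ 2 * h ^+ 2.
    rewrite (le_trans (Cexp_quadratic _))// normcM normcR.
    have -> : 16 / z ^+ 2 * expR q * W t ^+ 2 * h ^+ 2 =
       4 * (W t * (2 * (`|h| / z))) ^+ 2 * expR q.
      rewrite -[h ^+ 2 in LHS]real_normK ?num_real//; by field; rewrite gt_eqF.
    have hz' : `|h / z| = `|h| / z by rewrite normrM normfV (gtr0_norm z0).
    have pt : normc p * `|ta| <= W t * (2 * (`|h| / z)).
      by apply: ler_pM; rewrite ?normc_ge0// -hz'.
    have p0 : 0 <= normc p * `|ta| by rewrite mulr_ge0// normc_ge0.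
    apply: ler_pM; rewrite ?expR_ge0//; first by rewrite mulr_ge0// exprn_ge0.
      by rewrite ler_pM2l// lerXn2r// nnegrE//; exact: le_trans p0 pt.
    (* Although [p] grows with [t], its real part is constant on the line, so the exponential factor
       stays below [expR q]. *)
    have -> : re (p * ta%:C) = (e - 1 - k * g) * ta by rewrite ReM rp /= mulr0 subr0.
    rewrite ler_expR normrM.
    have : `|e - 1 - k * g| * `|ta| <= `|e - 1 - k * g| * 1 by rewrite ler_wpM2l//; lra.
    by rewrite /q; lra.
  have A2 : normc (p * (ta - h / z)%:C) <= 2 / z ^+ 2 * W t ^+ 2 * h ^+ 2.
    rewrite normcM normcR.
    have -> : 2 / z ^+ 2 * W t ^+ 2 * h ^+ 2 = W t ^+ 2 * (2 * (h / z) ^+ 2).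
      by field; rewrite gt_eqF.
    apply: ler_pM; rewrite ?normc_ge0//.
    by rewrite (le_trans np)// expr2 ler_peMr// (le_trans ler01).
  have A3 : normc ((Cexp (p * ta%:C) - 1 - p * ta%:C) + p * (ta - h / z)%:C) <=
      D * h ^+ 2 * W t ^+ 2.
    by rewrite (le_trans (normcD _ _))// (le_trans (lerD A1 A2))// /D; lra.
  have Dh : 0 <= D * h ^+ 2 by rewrite mulr_ge0// sqr_ge0.
  apply: (@le_trans _ _ ((C * expR (- (eta * `|t|))) * (D * h ^+ 2 * (M * expR (eta / 2 * `|t|))))).
    apply: ler_pM; rewrite ?normc_ge0 ?BF//.
    by rewrite (le_trans A3)// ler_wpM2l.
  have -> : C * expR (- (eta * `|t|)) * (D * h ^+ 2 * (M * expR (eta / 2 * `|t|))) =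
    D * C * M * h ^+ 2 * (expR (- (eta * `|t|)) * expR (eta / 2 * `|t|)) by ring.
  rewrite -expRD le_eqVlt; apply/orP; left; apply/eqP; by congr (_ * expR _); field.
have b1 := mellin_ebd e (z + h) gb; have b2 := mellin_ebd e z gb.
have b3 := mellin_ebd (e - 1) z gb.
have -> : mellin g e (z + h) - mellin g e z - h%:C * mellin g (e - 1) z =
    Cintegral setT (fun t => mellin_integrand e (z + h) (g +i* t) -
      mellin_integrand e z (g +i* t) - h%:C * mellin_integrand (e - 1) z (g +i* t)).
  rewrite (CintegralB (ebdB b1 b2) (ebdZ h%:C b3)).
  by rewrite (CintegralB b1 b2) (CintegralZ h%:C b3).
have -> : 2 * (D * C * M) * expmass (eta / 2) * h ^+ 2 =
  2 * (D * C * M * h ^+ 2) * expmass (eta / 2) by ring.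
apply: normc_Cintegral; split => //; apply: ebd_meas.
by apply: ebdB; [exact: ebdB|exact: ebdZ].
Qed.

(** Stated for any [f] that agrees with the integral on the half-line, since successive derivatives
    and Riemann-Liouville integrals are identified only there. *)
Lemma mellin_is_derive (f : R -> R[i]) (c : R[i]) g e z : g < be -> 0 < z ->
  (forall u, 0 < u -> f u = c * mellin g e u) ->
  is_derive z 1 (fun u => re (f u)) (re (c * mellin g (e - 1) z)) /\
  is_derive z 1 (fun u => im (f u)) (im (c * mellin g (e - 1) z)).
Proof.
move=> gb z0 fE; have [C [d [d0 dz H]]] := mellin_quadratic e gb z0.
have B (h : R) : `|h| <= d -> normc (f (z + h) - f z - h%:C * (c * mellin g (e - 1) z)) <=
    normc c * C * h ^+ 2.
  move=> hd; have zh : 0 < z + h by move: hd; rewrite ler_norml => /andP[? ?]; lra.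
  rewrite !fE// (_ : c * _ - _ - _ =
    c * (mellin g e (z + h) - mellin g e z - h%:C * mellin g (e - 1) z)); last by ring.
  by rewrite normcM -mulrA ler_wpM2l ?normc_ge0// H.
split; apply: (is_derive_quadratic (K := normc c * C) d0) => h hd.
- rewrite (le_trans _ (B h hd))// (le_trans _ (normc_Re _))//.
  by rewrite !ReD !ReN [re (h%:C * _)]ReM/= mul0r subr0.
- rewrite (le_trans _ (B h hd))// (le_trans _ (normc_Im _))//.
  by rewrite !ImD !ImN [im (h%:C * _)]ImM/= mul0r addr0.
Qed.

Lemma mellin_derive1n (f : R -> R[i]) (c : R[i]) g e n : g < be ->
  (forall u, 0 < u -> f u = c * mellin g e u) ->
  forall z, 0 < z ->
    derive1n n (fun u => re (f u)) z +i* derive1n n (fun u => im (f u)) z =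
    c * mellin g (e - n%:R) z.
Proof.
move=> gb fE; elim: n => [|n IH] z z0.
  by rewrite subr0 -fE//=; case: (f z).
pose fn u := derive1n n (fun u => re (f u)) u +i* derive1n n (fun u => im (f u)) u.
have [D1 D2] := @mellin_is_derive fn c g (e - n%:R) z gb z0 IH.
rewrite !derive1nS !derive1E.
have [_ ->] := D1; have [_ ->] := D2.
by rewrite -natr1 opprD addrA; case: (c * _).
Qed.

Lemma mellin_Cderivable (f : R -> R[i]) (c : R[i]) g e n : g < be ->
  (forall u, 0 < u -> f u = c * mellin g e u) -> Cderivable_pos n f.
Proof.
move=> gb fE j _ z z0.
pose fj u := derive1n j (fun u => re (f u)) u +i* derive1n j (fun u => im (f u)) u.
have [[D1 _] [D2 _]] := @mellin_is_derive fj c g (e - j%:R) z gb z0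
  (mellin_derive1n j gb fE).
by [].
Qed.

End mellin.

(** * Riemann-Liouville derivatives of Mellin-Barnes integrals *)

Section fractional.
Context {R : realType}.
Notation mu := (@lebesgue_measure R).
Variables (K : R[i] -> R[i]) (k be sig : R).
Hypothesis k_gt0 : 0 < k.
Hypothesis sig_gt : k * (pi / 2) < sig.
Hypothesis K_hol : forall a b, b < be -> hol K a b (- sig).
Implicit Types (e g z u v t r : R) (s : R[i]).

Local Notation mellin := (mellin K k).

(** z e^v / (1 + e^v), which carries the line onto []0, z[] and the Riemann-Liouville integrand to
    powers of [z] times [Bint]. *)
Definition logistic z v := z * expR (v - softplus v).

Lemma logistic_gt0 z v : 0 < z -> 0 < logistic z v.
Proof. by move=> z0; rewrite mulr_gt0// expR_gt0. Qed.

Lemma subr_logistic z v : z - logistic z v = z * expR (- softplus v).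
Proof.
rewrite /logistic expRD expRN expR_softplus.
have : 0 < 1 + expR v by rewrite addr_gt0// expR_gt0.
by move=> h; field; rewrite gt_eqF.
Qed.

Lemma logistic_lt z v : 0 < z -> logistic z v < z.
Proof. by move=> z0; rewrite -subr_gt0 subr_logistic mulr_gt0// expR_gt0. Qed.

Lemma ln_logistic z v : 0 < z -> ln (logistic z v) = ln z + (v - softplus v).
Proof. by move=> z0; rewrite lnM ?posrE ?expR_gt0// expRK. Qed.

Lemma range_logistic z : 0 < z -> range (logistic z) = `]0, z[%classic.
Proof.
move=> z0; apply/seteqP; split => [_ [v _ <-]|u]; rewrite /= in_itv/=.
  by rewrite logistic_gt0// logistic_lt.
move=> /andP[u0 uz]; exists (ln (u / (z - u))) => //.
have zu : 0 < z - u by rewrite subr_gt0.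
rewrite /logistic expRB expR_softplus lnK ?posrE ?divr_gt0//.
field; rewrite gt_eqF//= gt_eqF//; lra.
Qed.

Lemma logistic_derive z v : is_derive v 1 (logistic z) (z * expR (v - 2 * softplus v)).
Proof.
have p0 : 0 < 1 + expR v by rewrite addr_gt0// expR_gt0.
have E1 : is_derive v 1 (fun v => 1 + expR v) (expR v).
  have := is_deriveD (is_derive_cst (1 : R) v 1) (is_derive_expR v).
  by rewrite add0r.
have D1 := is_derive1_ln p0.
have E2 : is_derive v 1 softplus ((1 + expR v)^-1 * expR v).
  exact: (@is_derive1_comp _ (@ln R) (fun v => 1 + expR v)).
have E3 : is_derive v 1 (fun v => v - softplus v) (1 - (1 + expR v)^-1 * expR v).
  exact: is_deriveB.
have D2 := is_derive_expR (v - softplus v).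
have E4 : is_derive v 1 (fun v => expR (v - softplus v))
    (expR (v - softplus v) * (1 - (1 + expR v)^-1 * expR v)).
  exact: (@is_derive1_comp _ (@expR R) (fun v => v - softplus v)).
rewrite /logistic; apply: is_derive_eq; rewrite /GRing.scale/=.
have -> : v - 2 * softplus v = (v - softplus v) + - softplus v by ring.
rewrite [in RHS]expRD expRN expR_softplus.
by field; rewrite gt_eqF.
Qed.

Lemma softplus_cont : continuous (@softplus R).
Proof.
move=> v; apply: (@continuous_comp _ _ _ (fun v => 1 + expR v) (@ln R)).
  by apply: cvgD; [exact: cvg_cst|exact: continuous_expR].
by apply: continuous_ln; rewrite addr_gt0// expR_gt0.
Qed.

Lemma logistic_derive_cont z : continuous (fun v => z * expR (v - 2 * softplus v)).
Proof.
move=> v; apply: cvgM; first exact: cvg_cst.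
apply: (@continuous_comp _ _ _ (fun v => v - 2 * softplus v) (@expR R)).
  apply: cvgB; first exact: cvg_id.
  by apply: cvgM; [exact: cvg_cst|exact: softplus_cont].
exact: continuous_expR.
Qed.

Lemma logistic_incr z : 0 < z -> forall v w, v < w -> logistic z v < logistic z w.
Proof.
move=> z0 v w vw.
have lt_sp : softplus v < softplus w.
  by rewrite ltr_ln ?posrE ?addr_gt0 ?expR_gt0// ltrD2l ltr_expR.
have H : z * expR (- softplus w) < z * expR (- softplus v).
  by rewrite ltr_pM2l// ltr_expR ltrN2.
have := subr_logistic z v; have := subr_logistic z w; lra.
Qed.

Lemma powR_pos_exp (u r : R) : 0 < u -> powR u r = expR (r * ln u).
Proof. by move=> u0; rewrite /powR gt_eqF. Qed.

(* The line is taken at [Re s = g <= 0], where the integrand is integrable at 0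
   and [Gamma (1 - k s)], [Gamma (1 + r - k s)] do not vanish. *)
Definition frac_double z r g v t :=
  mellin_coef K k 1 (g +i* t) *
  Cexp ((r%:C - k%:C * (g +i* t)) * (ln z)%:C) *
  Bint r (1 - k%:C * (g +i* t)) v.

Lemma frac_integrand (f : R -> R[i]) (c : R[i]) g z r v : g < be -> 0 < z ->
  (forall u, 0 < u -> f u = c * mellin g 1 u) ->
  RL_integrand (r - 1) f z (logistic z v) * (z * expR (v - 2 * softplus v))%:C =
  c * Cintegral setT (frac_double z r g v).
Proof.
move=> gb z0 fE; have l0 := logistic_gt0 v z0.
rewrite /RL_integrand fE// subr_logistic powR_pos_exp ?mulr_gt0 ?expR_gt0//.
rewrite lnM ?posrE ?expR_gt0// expRK.
have -> : z * expR (v - 2 * softplus v) = expR (ln z + (v - 2 * softplus v)).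
  by rewrite (expRD (ln z)) lnK ?posrE.
rewrite mulrAC -!CexpR -CexpD mulrCA; congr (_ * _).
rewrite -CintegralZ; last exact: (mellin_ebd k_gt0 sig_gt K_hol).
congr Cintegral; apply/funext => t.
rewrite /mellin_integrand /frac_double -mulrA mulrCA; congr (_ * _).
rewrite /Bint -!CexpD; congr Cexp; rewrite ln_logistic//.
rewrite !(rmorphD, rmorphB, rmorphM, rmorphN, rmorph1, rmorph_nat) /=; ring.
Qed.

Lemma frac_double_bound z r g : g < be -> g <= 0 -> 0 < r ->
  exists C eta, [/\ 0 < eta, 0 <= C & forall v t, normc (frac_double z r g v t) <=
    C * (expR (- (eta * `|v|)) * expR (- (eta * `|t|)))].
Proof.
move=> gb g0 r0; have [C [eta0 _ H]] := mellin_edom k_gt0 sig_gt K_hol 1 z gb.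
set et := (_ / 2) in eta0 H.
pose m := Num.min r (1 - k * g).
have p1 : 1 <= 1 - k * g by rewrite lerDl oppr_ge0 mulr_ge0_le0// ltW.
have m0 : 0 < m by rewrite lt_min r0 (lt_le_trans ltr01).
have C0 : 0 <= C.
  by have := le_trans (normc_ge0 _) (H 0); rewrite pmulr_lge0// expR_gt0.
exists (C * expR (r * ln z)), (Num.min et m); split.
- by rewrite lt_min eta0.
- by rewrite mulr_ge0 ?expR_ge0.
move=> v t.
have -> : frac_double z r g v t = mellin_integrand K k 1 z (g +i* t) *
    (Cexp (r * ln z)%:C * Bint r (1 - k%:C * (g +i* t)) v).
  rewrite /frac_double /mellin_integrand.
  have -> : Cexp ((r%:C - k%:C * (g +i* t)) * (ln z)%:C) =
    Cexp (((1 : R)%:C - 1 - k%:C * (g +i* t)) * (ln z)%:C) * Cexp (r * ln z)%:C.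
    by rewrite -CexpD; congr Cexp; ring.
  by rewrite !mulrA.
rewrite CexpR normcM (normcM (expR _)%:C) normcR (ger0_norm (expR_ge0 _)).
have rp : re (1 - k%:C * (g +i* t)) = 1 - k * g by rewrite !RIE/=; ring.
have B : normc (Bint r (1 - k%:C * (g +i* t)) v) <= expR (- (Num.min et m * `|v|)).
  apply: le_trans (normc_Bint v r0 _) _; rewrite rp ?(lt_le_trans ltr01)//.
  by rewrite ler_expR lerN2 ler_wpM2r// ge_min lexx orbT.
have A : normc (mellin_integrand K k 1 z (g +i* t)) <= C * expR (- (Num.min et m * `|t|)).
  rewrite (le_trans (H t))// ler_wpM2l// ler_expR lerN2 ler_wpM2r//.
  by rewrite ge_min lexx.
apply: (@le_trans _ _ ((C * expR (- (Num.min et m * `|t|))) *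
   (expR (r * ln z) * expR (- (Num.min et m * `|v|))))).
  apply: ler_pM => //; rewrite ?mulr_ge0 ?normc_ge0 ?expR_ge0//.
  by rewrite ler_wpM2l ?expR_ge0.
by rewrite le_eqVlt; apply/orP; left; apply/eqP; ring.
Qed.

(** In the Beta integral Gamma (r) Gamma (p) / Gamma (r + p), the factor Gamma (p) cancels the
    denominator of [mellin_coef] at 1 and Gamma (r + p) becomes the one at [1 + r]. Since [g <= 0],
    both have argument of real part at least 1, where [Gamma_int_lower] excludes zeros. *)
Lemma frac_double_inner z r g t : g < be -> g <= 0 -> 0 < r -> 
  Cintegral setT (fun v => frac_double z r g v t) =
  Gamma_int r%:C * mellin_integrand K k (1 + r) z (g +i* t).
Proof.
move=> gb g0 r0; set s := g +i* t; set p := 1 - k%:C * s.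
have rp : re p = 1 - k * g by rewrite /p /s !RIE/=; ring.
have p1 : 1 <= re p by rewrite rp lerDl oppr_ge0 mulr_ge0_le0// ltW.
have p0 : 0 < re p by exact: lt_le_trans p1.
have rp0 : 0 < re (r%:C + p) by rewrite ReD addr_gt0.
have Gneq (q : R[i]) : 1 <= re q -> Gamma_int q != 0.
  have [c [c0 L]] := @Gamma_int_lower R.
  move=> q1; have Lq := L q q1; apply/eqP => q0; move: Lq; rewrite q0 normc0 leNgt.
  by rewrite mulr_gt0// expR_gt0.
rewrite /frac_double (CintegralZ _ (ebd_Bint r0 p0)).
have BG := Beta_Gamma r0 p0.
have gp := Gneq p p1; have grp : Gamma_int (r%:C + p) != 0.
  by apply: Gneq; rewrite ReD /=; lra.
have -> : Cintegral setT (Bint r p) = Gamma_int r%:C * Gamma_int p / Gamma_int (r%:C + p).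
  by rewrite BG mulrC mulKf.
have e1 : (1 : R)%:C - k%:C * s = p by rewrite rmorph1.
have e2 : (1 + r)%:C - k%:C * s = r%:C + p.
  by rewrite /p rmorphD rmorph1; ring.
have e3 : (1 + r)%:C - 1 - k%:C * s = r%:C - k%:C * s.
  by rewrite rmorphD rmorph1; ring.
rewrite /mellin_integrand /mellin_coef e1 e2 e3 !Gamma_pos//.
by field; rewrite gp grp.
Qed.

Lemma Cmeas_frac_double z r g : g < be ->
  Cmeas (fun q : R * R => frac_double z r g q.1 q.2).
Proof.
move=> gb.
have m1 : measurable_fun setT (fun q : R * R => q.1) by exact: measurable_fst.
have m2 : measurable_fun setT (fun q : R * R => q.2) by exact: measurable_snd.
have ms : Cmeas (fun q : R * R => g +i* q.2) by split => //=; exact: measurable_cst.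
have mc : Cmeas (fun t => mellin_coef K k 1 (g +i* t)).
  apply: Ccont_meas; apply: (hol_cont _ (@hol_mellin_coef _ K k be sig k_gt0 sig_gt K_hol 1 g g gb)).
  by rewrite lexx.
have mks : Cmeas (fun q : R * R => k%:C * (g +i* q.2)).
  by apply: CmeasM => //; exact: Cmeas_cst.
apply: CmeasM; first apply: CmeasM.
- exact: (Cmeas_comp mc m2).
- apply: Cmeas_exp; apply: CmeasM; last exact: Cmeas_cst.
  by apply: CmeasB => //; exact: Cmeas_cst.
- apply: Cmeas_exp; apply: CmeasB; apply: CmeasM.
  + by apply: CmeasB => //; exact: Cmeas_cst.
  + exact: CmeasR.
  + by apply: CmeasD; [exact: Cmeas_cst|apply: CmeasB => //; exact: Cmeas_cst].
  + by apply: CmeasR; exact: measurableT_comp (@measurable_softplus R) m1.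
Qed.

Lemma is_derive1_continuous (h : R -> R) (x l : R) :
  is_derive x 1 h l -> {for x, continuous h}.
Proof.
by move=> [D _]; apply: differentiable_continuous; apply/derivable1_diffP.
Qed.

Lemma mellin_frac_integral (f : R -> R[i]) (c : R[i]) g z r :
  g < be -> g <= 0 -> 0 < r -> 0 < z ->
  (forall u, 0 < u -> f u = c * mellin g 1 u) ->
  Cintegrable `]0, z[%classic (RL_integrand (r - 1) f z) /\
  Cintegral `]0, z[%classic (RL_integrand (r - 1) f z) =
    (c * Gamma_int r%:C) * mellin g (1 + r) z.
Proof.
move=> gb g0 r0 z0 fE.
have [C [eta [eta0 C0 HB]]] := frac_double_bound z gb g0 r0.
pose dg (v : R) := z * expR (v - 2 * softplus v).
have dg0 v : 0 <= dg v by rewrite mulr_ge0 ?expR_ge0// ltW.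
have incr := logistic_incr z0.
have der v := logistic_derive z v.
have cdg := @logistic_derive_cont z.
pose H v := Cintegral setT (fun t => c * frac_double z r g v t).
have slice v : ebd (frac_double z r g v).
  exists (C * expR (- (eta * `|v|))), eta; split => //.
    exact: (Cmeas_comp (Cmeas_frac_double z r gb) (pair1_measurable v)).
  by move=> t; rewrite -mulrA HB.
have HE v : RL_integrand (r - 1) f z (logistic z v) * (dg v)%:C = H v.
  by rewrite (frac_integrand _ _ gb z0 fE) /H (CintegralZ c (slice v)).
have HRe v : re (RL_integrand (r - 1) f z (logistic z v)) * dg v = re (H v).
  by rewrite -HE ReMR.
have HIm v : im (RL_integrand (r - 1) f z (logistic z v)) * dg v = im (H v).
  by rewrite -HE ImMR.
have cpow u : u < z -> {for u, continuous (fun u => powR (z - u) (r - 1))}.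
  move=> uz; apply: (@continuous_comp _ _ _ (fun u => z - u) (fun x => powR x (r - 1))).
    by apply: cvgB; [exact: cvg_cst|exact: cvg_id].
  apply: differentiable_continuous; apply/derivable1_diffP.
  by apply: derivable_powR; rewrite in_itv/= andbT subr_gt0.
have cRe y : range (logistic z) y -> {for y, continuous (fun u => re (RL_integrand (r - 1) f z u))}.
  rewrite range_logistic//= in_itv/= => /andP[y0 yz].
  have [D _] := mellin_is_derive k_gt0 sig_gt K_hol gb y0 fE.
  have X (h h' : R -> R) : h = h' -> {for y, continuous h'} -> {for y, continuous h} by move=> ->.
  apply: (X _ (fun u => powR (z - u) (r - 1) * re (f u))).
    by apply/funext => u; rewrite /RL_integrand mulrC ReMR mulrC.
  by apply: cvgM; [exact: cpow|exact: is_derive1_continuous D].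
have cIm y : range (logistic z) y -> {for y, continuous (fun u => im (RL_integrand (r - 1) f z u))}.
  rewrite range_logistic//= in_itv/= => /andP[y0 yz].
  have [_ D] := mellin_is_derive k_gt0 sig_gt K_hol gb y0 fE.
  have X (h h' : R -> R) : h = h' -> {for y, continuous h'} -> {for y, continuous h} by move=> ->.
  apply: (X _ (fun u => powR (z - u) (r - 1) * im (f u))).
    by apply/funext => u; rewrite /RL_integrand mulrC ImMR mulrC.
  by apply: cvgM; [exact: cpow|exact: is_derive1_continuous D].
(* Measurability is read off the other expression of [H], the Riemann-Liouville integrand in the
   variable [v], which is continuous because [f] is differentiable. *)
have mH : Cmeas H.
  split.
  - have := measurable_subst_fun der cdg cRe.
    by rewrite (_ : (fun x => _) = (fun v => re (H v)))//; apply/funext => v; exact: HRe.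
  - have := measurable_subst_fun der cdg cIm.
    by rewrite (_ : (fun x => _) = (fun v => im (H v)))//; apply/funext => v; exact: HIm.
have HF u v : normc (c * frac_double z r g u v) <=
    normc c * C * (expR (- (eta * `|u|)) * expR (- (eta * `|v|))).
  by rewrite normcM -mulrA ler_wpM2l ?normc_ge0// HB.
have eH : edom (2 * (normc c * C) * expmass eta) eta H.
  split => // v.
  have -> : 2 * (normc c * C) * expmass eta * expR (- (eta * `|v|)) =
    2 * (normc c * C * expR (- (eta * `|v|))) * expmass eta by ring.
  apply: normc_Cintegral; split => //.
    by apply: CmeasM; [exact: Cmeas_cst|exact: ebd_meas].
  by move=> t; rewrite -(mulrA (normc c * C)) HF.
have [iRe iIm] := edom_integrable eH.
rewrite -(range_logistic z0); split.
  split.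
  - apply: (integrable_subst incr der cdg dg0 cRe).
    by rewrite (_ : (fun x => _) = (fun v => (re (H v))%:E))//; apply/funext => v; rewrite HRe.
  - apply: (integrable_subst incr der cdg dg0 cIm).
    by rewrite (_ : (fun x => _) = (fun v => (im (H v))%:E))//; apply/funext => v; rewrite HIm.
transitivity (Cintegral setT H).
  rewrite /Cintegral /Rintegral; congr (fine _ +i* fine _).
  - rewrite (integral_subst incr der cdg dg0 cRe).
    by apply: eq_integral => v _; rewrite HRe.
  - rewrite (integral_subst incr der cdg dg0 cIm).
    by apply: eq_integral => v _; rewrite HIm.
rewrite /H (@Cintegral_Fubini _ (fun v t => c * frac_double z r g v t) _ eta eta0 _ HF); last first.
  by apply: CmeasM; [exact: Cmeas_cst|exact: Cmeas_frac_double].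
rewrite -CintegralZ; last exact: (mellin_ebd k_gt0 sig_gt K_hol).
congr Cintegral; apply/funext => t.
rewrite -mulrA -frac_double_inner// CintegralZ//.
exists (C * expR (- (eta * `|t|))), eta; split => //.
  exact: (Cmeas_comp (Cmeas_frac_double z r gb) (pair2_measurable t)).
by move=> v; rewrite (le_trans (HB v t))// le_eqVlt; apply/orP; left; apply/eqP; ring.
Qed.

Lemma mellin_RL (f : R -> R[i]) (c : R[i]) g (alpha : R) :
  g < be -> 0 < alpha < 2 ->
  (forall u, 0 < u -> f u = c * mellin g 1 u) ->
  RL_derivable_pos alpha f /\
  forall z, 0 < z -> RL_derive alpha f z = c * mellin g (1 - alpha) z.
Proof.
move=> gb /andP[al0 al2] fE.
have al0' : 0 <= alpha by exact: ltW.
have /andP[n1 n2] := truncn_itv al0'.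
rewrite /RL_derivable_pos /RL_derive; case: ifPn => [/eqP aE|aN].
  split; first exact: (mellin_Cderivable k_gt0 sig_gt K_hol gb fE).
  move=> z z0; rewrite /Cderive (mellin_derive1n k_gt0 sig_gt K_hol _ gb fE)//.
  by rewrite -aE.
set n := (Num.truncn alpha).+1 in n2 *.
pose r := n%:R - alpha; have r0 : 0 < r by rewrite /r subr_gt0.
(* The line goes to an abscissa at most 0 for the fractional integral and returns to [g] by
   [mellin_shift] at the end. *)
pose g' := Num.min g 0.
have g'b : g' < be by rewrite gt_min gb.
have g'0 : g' <= 0 by rewrite ge_min lexx orbT.
have fE' u : 0 < u -> f u = c * mellin g' 1 u.
  by move=> u0; rewrite fE// (mellin_shift k_gt0 sig_gt K_hol _ _ gb g'b).
have J z (z0 : 0 < z) := mellin_frac_integral g'b g'0 r0 z0 fE'.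
have JE z : 0 < z -> Cintegral `]0, z[%classic (RL_integrand (r - 1) f z) =
    (c * Gamma_int r%:C) * mellin g' (1 + r) z by move=> /J[].
split.
  split; first by move=> z /J[].
  exact: (mellin_Cderivable k_gt0 sig_gt K_hol g'b JE).
move=> z z0; rewrite /Cderive (mellin_derive1n k_gt0 sig_gt K_hol _ g'b JE)//.
have -> : 1 + r - n%:R = 1 - alpha by rewrite /r; ring.
rewrite (mellin_shift k_gt0 sig_gt K_hol _ _ gb g'b) Gamma_pos// -/r.
have gr : Gamma_int r%:C != 0.
  by rewrite Gamma_int_real; apply/eqP => -[] /eqP; rewrite gt_eqF// rGamma_gt0.
by rewrite -mulrA mulrCA mulKf.
Qed.

End fractional.

(** * Fox H-functions and the equations *)

Section fox.
Context {R : realType}.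
Implicit Types (K : R[i] -> R[i]) (k be g z b : R) (s : R[i]).

Definition decaying K k be := exists2 sig, k * (pi / 2) < sig &
  forall a b, b < be -> hol K a b (- sig).

(** The last factor is b^(-s), split off the power of z^(-k) / b; the power of [z] belongs to
    [mellin_integrand]. *)
Definition fox_kernel (B : seq R[i]) b s :=
  (\prod_(x <- B) Gamma (x - s)) * Cexp ((- ln b)%:C * s).

Lemma hol_gamma_prod (B : seq R[i]) be a b th : b < be -> 0 <= th < pi / 2 ->
  {in B, forall x, be <= re x} ->
  hol (fun s => \prod_(x <- B) Gamma (x - s)) a b (- ((size B)%:R * th)).
Proof.
move=> bb thb; elim: B => [|x B IH] HB.
  have -> : (fun s => \prod_(x <- [::]) Gamma (x - s)) = (fun=> 1 : R[i]).
    by apply/funext => s; rewrite big_nil.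
  by rewrite /= mul0r oppr0; exact: hol_cst.
have -> : (fun s => \prod_(y <- x :: B) Gamma (y - s)) =
    (fun s => Gamma (x - (1 : R)%:C * s) * \prod_(y <- B) Gamma (y - s)).
  by apply/funext => s; rewrite big_cons rmorph1 mul1r.
have -> : - ((size (x :: B))%:R * th) = 1 * - th + - ((size B)%:R * th).
  by rewrite /= -natr1; ring.
apply: hol_mul; last by apply: IH => y yB; apply: HB; rewrite inE yB orbT.
apply: hol_affine => //; apply: hol_Gamma => //.
by have := HB x (mem_head _ _); lra.
Qed.

Lemma decaying_fox (B : seq R[i]) b k be : 0 < k < (size B)%:R ->
  {in B, forall x, be <= re x} -> decaying (fox_kernel B b) k be.
Proof.
move=> /andP[k0 kB] HB; set n := (size B)%:R in kB *.
have p0 := @pihalf_gt0 R.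
have n0 : 0 < n by exact: lt_trans kB.
(* The midpoint: [n * th] is the mean of [k * (pi / 2)] and [n * (pi / 2)], so it exceeds the former
   while [th] stays below [pi / 2]. *)
pose th := (k / n + 1) / 2 * (pi / 2).
have kn0 : 0 < k / n by rewrite divr_gt0.
have kn1 : k / n < 1 by rewrite ltr_pdivrMr// mul1r.
have thb : 0 <= th < pi / 2.
  rewrite /th mulr_ge0 ?(ltW p0)//=; last by rewrite divr_ge0//; lra.
  by rewrite -[ltRHS]mul1r ltr_pM2r//; lra.
exists (n * th).
  have -> : n * th = (k + n) / 2 * (pi / 2) by rewrite /th; field; rewrite gt_eqF.
  by rewrite ltr_pM2r//; lra.
move=> a b' bb; rewrite -[- _]addr0.
by apply: hol_mul; [exact: hol_gamma_prod bb thb HB|exact: hol_exp].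
Qed.

Lemma fox_integrandE (B : seq R[i]) k b z s : 0 < b -> 0 < z ->
  FoxH_integrand (size B) [:: (1, k)] [seq (x, 1) | x <- B]
    (powR z (- k) / b)%:C s = mellin_integrand (fox_kernel B b) k 1 z s.
Proof.
move=> b0 z0; rewrite /FoxH_integrand.
have sB : size B = size [seq (x, 1 : R) | x <- B] by rewrite size_map.
rewrite {1}sB take_size drop_oversize ?size_map// big_nil big_seq1 mulr1 big_map /=.
have pz : 0 < powR z (- k) by exact: powR_gt0.
rewrite CpowR ?divr_gt0// ln_div ?posrE// ln_powR.
rewrite /mellin_integrand /mellin_coef /fox_kernel rmorph1.
under eq_bigr do rewrite mul1r.
have -> : Cexp (s * (- k * ln z - ln b)%:C) =
    Cexp ((- ln b)%:C * s) * Cexp ((1 - 1 - k%:C * s) * (ln z)%:C).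
  by rewrite -CexpD; congr Cexp; ring.
ring.
Qed.

(** The leftmost pole of Gamma (x - s) is the one of index 0, at [s = x]. *)
Lemma fox_line_lt (B : seq R[i]) g : FoxH_line (size B) [seq (x, 1) | x <- B] g ->
  {in B, forall x, g < re x}.
Proof.
move=> H x xB; have := H (x, 1) _ 0%N x; rewrite /= mul1r subrr oppr0; apply => //.
by rewrite take_oversize ?size_map//; apply/mapP; exists x.
Qed.

Lemma fox_abscissa (B : seq R[i]) g : {in B, forall x, g < re x} ->
  exists2 be, g < be & {in B, forall x, be <= re x}.
Proof.
elim: B => [|x B IH] H; first by exists (g + 1) => //; rewrite ltrDl.
have [|be gb HB] := IH; first by move=> y yB; apply: H; rewrite inE yB orbT.
exists (Num.min (re x) be); first by rewrite lt_min gb H// mem_head.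
move=> y; rewrite inE => /predU1P[->|yB]; rewrite ge_min ?lexx//.
by rewrite HB ?orbT.
Qed.

Definition fox_const : R[i] := (2 * pi%:C * (0 +i* 1))^-1 * (0 +i* 1).

Lemma foxE (B : seq R[i]) k b g z : 0 < b -> 0 < z ->
  FoxH (size B) [:: (1, k)] [seq (x, 1) | x <- B] g (powR z (- k) / b)%:C =
  fox_const * mellin (fox_kernel B b) k g 1 z.
Proof.
move=> b0 z0; rewrite /FoxH /fox_const -[RHS]mulrA; congr (_ * (_ * Cintegral _ _)).
by apply/funext => t; rewrite fox_integrandE.
Qed.

Lemma fox_cvg (B : seq R[i]) k be b g z : 0 < k -> 0 < b -> 0 < z ->
  decaying (fox_kernel B b) k be -> g < be ->
  FoxH_cvg (size B) [:: (1, k)] [seq (x, 1) | x <- B] g (powR z (- k) / b)%:C.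
Proof.
move=> k0 b0 z0 [sig sk HK] gb; rewrite /FoxH_cvg.
rewrite (_ : (fun t => _) = (fun t => mellin_integrand (fox_kernel B b) k 1 z (g +i* t))).
  by apply: ebd_integrable; exact: (mellin_ebd k0 sk HK).
by apply/funext => t; rewrite fox_integrandE.
Qed.

Lemma decaying_shift K k be d : decaying K k be ->
  decaying (fun s => K (s - d%:C)) k (be + d).
Proof.
move=> [sig sk HK]; exists sig => // a b bb.
have -> : (fun s => K (s - d%:C)) = (fun s => K (s + (- d)%:C)).
  by apply/funext => s; rewrite rmorphN.
by apply: hol_shift; apply: HK; lra.
Qed.

Lemma mellin_kernel_shift K k g d z :
  mellin K k g (1 - k * d) z = mellin (fun s => K (s - d%:C)) k (g + d) 1 z.
Proof.
congr Cintegral; apply/funext => t; rewrite /mellin_integrand /mellin_coef.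
have -> : (g + d) +i* t - d%:C = g +i* t.
  by apply: complex_ext; rewrite !RIE/=; ring.
have e : (1 - k * d)%:C - k%:C * (g +i* t) = (1 : R)%:C - k%:C * ((g + d) +i* t).
  by apply: complex_ext; rewrite !RIE/=; ring.
have F (p p' q q' : R[i]) : p = p' -> q = q' ->
    K (g +i* t) / Gamma p * Cexp (q * (ln z)%:C) =
    K (g +i* t) / Gamma p' * Cexp (q' * (ln z)%:C) by move=> -> ->.
have e' : (1 - k * d)%:C - 1 - k%:C * (g +i* t) =
    (1 : R)%:C - 1 - k%:C * ((g + d) +i* t).
  by rewrite addrAC e addrAC.
exact: F e e'.
Qed.

(* Shifting the contour by [d] turns the fractional derivative of the left-hand
   side into a differential expression with symbol [A0 - A1 k s + A2 k s (k s + 1)]. *)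
Lemma mellin_equation K K2 k be be2 d g g2 z (A0 A1 A2 : R[i]) :
  0 < k -> 0 < z -> decaying K k be -> decaying K2 k be2 ->
  g < be -> g2 < be2 -> be2 <= be + d ->
  (forall s, re s < be2 -> K (s - d%:C) =
     (A0 - A1 * (k%:C * s) + A2 * (k%:C * s * (k%:C * s + 1))) * K2 s) ->
  mellin K k g (1 - k * d) z = A0 * mellin K2 k g2 1 z +
    A1 * z%:C * mellin K2 k g2 (1 - 1%:R) z +
    A2 * z%:C ^+ 2 * mellin K2 k g2 (1 - 2%:R) z.
Proof.
move=> k0 z0 dK [sig2 sk2 HK2] gb gb2 bb KE.
have [sig sk HK] := decaying_shift d dK.
rewrite mellin_kernel_shift.
have gd : g + d < be + d by rewrite ltrD2r.
have g2d : g2 < be + d by exact: lt_le_trans bb.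
rewrite (mellin_shift k0 sk HK _ _ gd g2d).
have I0 := mellin_ebd k0 sk2 HK2 1 z gb2.
have I1 := mellin_ebd k0 sk2 HK2 (1 - 1%:R) z gb2.
have I2 := mellin_ebd k0 sk2 HK2 (1 - 2%:R) z gb2.
rewrite -(CintegralZ A0 I0) -(CintegralZ (A1 * z%:C) I1) -(CintegralZ (A2 * z%:C ^+ 2) I2).
rewrite -(CintegralD (ebdZ A0 I0) (ebdZ (A1 * z%:C) I1)).
rewrite -(CintegralD (ebdD (ebdZ A0 I0) (ebdZ (A1 * z%:C) I1)) (ebdZ (A2 * z%:C ^+ 2) I2)).
congr Cintegral; apply/funext => t; set s := g2 +i* t.
have zn : z%:C != 0 :> R[i] by rewrite (fmorph_eq0 (real_complex R)) gt_eqF.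
have E2 : 1 - 2%:R = (1 - 1%:R) - 1 :> R by ring.
rewrite E2 !mellin_integrandB1//.
rewrite /mellin_integrand /mellin_coef KE//.
rewrite (_ : (1 - 1%:R)%:C = 0 :> R[i]); last by rewrite subrr.
rewrite !rmorph1; move: zn.
move: (Cexp _) (Gamma _)^-1 (z%:C) => X G zc zn.
by field.
Qed.

End fox.

(** * Symbols of the three equations *)

Section equations.
Context {R : realType}.
Implicit Types (k b g z : R).

Lemma gamma_step (B : R[i]) s : re s < re B ->
  Gamma (B - (s - 1)) = (B - s) * Gamma (B - s).
Proof.
move=> sB; have -> : B - (s - 1) = (B - s) + 1 by ring.
by rewrite Gamma_rec// ReD ReN subr_gt0.
Qed.

Lemma fox_kernel_exp b (d : R) s :
  Cexp ((- ln b)%:C * (s - d%:C)) = (expR (d * ln b))%:C * Cexp ((- ln b)%:C * s).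
Proof. by rewrite -CexpR -CexpD; congr Cexp; ring. Qed.

Lemma fox_kernel1 (x : R[i]) b s :
  fox_kernel [:: x] b s = Gamma (x - s) * Cexp ((- ln b)%:C * s).
Proof. by rewrite /fox_kernel big_cons big_nil mulr1. Qed.

Lemma fox_kernel2 (x y : R[i]) b s : fox_kernel [:: x; y] b s =
  Gamma (x - s) * Gamma (y - s) * Cexp ((- ln b)%:C * s).
Proof. by rewrite /fox_kernel !big_cons big_nil mulr1. Qed.

End equations.

Theorem proposition3p3 (R : realType) :
  (forall (alpha a b : R), 0 < alpha < 1 -> 0 < b ->
    let sbar : R := - (a / b) in
    let A : seq (R[i] * R) := [:: (1, alpha)] in
    let B : seq (R[i] * R) := [:: ((- sbar)%:C, 1)] in
    let w (z : R) : R[i] := (powR z (- alpha) / b)%:C in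
    forall (gamma : R) (c1 : R[i]), FoxH_line 1 B gamma ->
    let phi (z : R) : R[i] := c1 * FoxH 1 A B gamma (w z) in
    [/\ (forall z : R, 0 < z -> FoxH_cvg 1 A B gamma (w z)),
        RL_derivable_pos alpha phi,
        Cderivable_pos 1 phi
      & forall z : R, 0 < z ->
          RL_derive alpha phi z
            = a%:C * phi z + (b / alpha * z)%:C * Cderive 1 phi z])
  /\
  (forall (alpha a b c : R), 0 < alpha < 2 -> 0 < c ->
    let D : R := 1 / alpha ^+ 2 - 2 * b / (alpha * c) + b ^+ 2 / c ^+ 2
                 - 4 * a / c in
    let s1 : R[i] := 2^-1 * ((1 / alpha - b / c)%:C + sqrtC D%:C) in
    let s2 : R[i] := 2^-1 * ((1 / alpha - b / c)%:C - sqrtC D%:C) in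
    let A : seq (R[i] * R) := [:: (1, alpha)] in
    let B : seq (R[i] * R) := [:: (- s1, 1); (- s2, 1)] in
    let w (z : R) : R[i] := (powR z (- alpha) / c)%:C in
    forall (gamma : R) (c1 : R[i]), FoxH_line 2 B gamma ->
    let phi (z : R) : R[i] := c1 * FoxH 2 A B gamma (w z) in
    [/\ (forall z : R, 0 < z -> FoxH_cvg 2 A B gamma (w z)),
        RL_derivable_pos alpha phi,
        Cderivable_pos 2 phi
      & forall z : R, 0 < z ->
          RL_derive alpha phi z
            = a%:C * phi z + (b / alpha * z)%:C * Cderive 1 phi z
              + (c / alpha ^+ 2 * z ^+ 2)%:C * Cderive 2 phi z])
  /\
  (forall (alpha a1 a2 b1 b2 : R), 0 < alpha < 1 -> 0 < b1 * b2 ->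
    let s1 : R := - (a1 / b1) in
    let s2 : R := - (a2 / b2) in
    let A : seq (R[i] * R) := [:: (1, 2 * alpha)] in
    let B : seq (R[i] * R) :=
      [:: ((1 / 2 - s1 / 2)%:C, 1); ((- (s2 / 2))%:C, 1)] in
    let B' : seq (R[i] * R) :=
      [:: ((- (s1 / 2))%:C, 1); ((1 / 2 - s2 / 2)%:C, 1)] in
    let w (z : R) : R[i] := (powR z (- (2 * alpha)) / (4 * b1 * b2))%:C in
    forall (gamma gamma' : R) (c1 : R[i]),
      FoxH_line 2 B gamma -> FoxH_line 2 B' gamma' ->
    let phi (z : R) : R[i] :=
      c1 * (Num.sg b1)%:C * FoxH 2 A B gamma (w z) in
    let psi (z : R) : R[i] :=
      c1 * (Num.sqrt (b2 / b1))%:C * FoxH 2 A B' gamma' (w z) in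
    [/\ (forall z : R, 0 < z ->
           FoxH_cvg 2 A B gamma (w z) /\ FoxH_cvg 2 A B' gamma' (w z)),
        RL_derivable_pos alpha phi /\ RL_derivable_pos alpha psi,
        Cderivable_pos 1 phi /\ Cderivable_pos 1 psi
      & forall z : R, 0 < z ->
          RL_derive alpha phi z
            = a1%:C * psi z + (b1 / alpha * z)%:C * Cderive 1 psi z
          /\
          RL_derive alpha psi z
            = a2%:C * phi z + (b2 / alpha * z)%:C * Cderive 1 phi z]).
Proof.
split; last split.
- move=> alpha a b /andP[al0 al1] b0 sbar A B w g c1 line phi.
  pose B1 : R[i] := (- sbar)%:C.
  have lt1 := @fox_line_lt _ [:: B1] g line.
  have [be gbe HB] := fox_abscissa lt1.
  have kB : 0 < alpha < (size [:: B1])%:R by rewrite al0 al1.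
  have dK := decaying_fox b kB HB; have [sig sk HK] := dK.
  have phiE z : 0 < z -> phi z = c1 * fox_const * mellin (fox_kernel [:: B1] b) alpha g 1 z.
    by move=> z0; rewrite /phi (foxE [:: B1])// mulrA.
  clearbody phi.
  have al2 : 0 < alpha < 2 by apply/andP; split; lra.
  have [RL1 RL2] := mellin_RL al0 sk HK gbe al2 phiE.
  split.
  + by move=> z z0; exact: (fox_cvg al0 b0 z0 dK gbe).
  + exact: RL1.
  + exact: (mellin_Cderivable al0 sk HK gbe phiE).
  + move=> z z0; rewrite RL2// /Cderive (mellin_derive1n al0 sk HK 1 gbe phiE z0) phiE//.
    rewrite -[X in mellin _ _ _ (1 - X)]mulr1.
    (* The step of b^(-s) gives [b] and that of Gamma gives [a / b - s]; their product is
       [a - b / alpha * (alpha * s)]. *)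
    rewrite (mellin_equation (d := 1) (A0 := a%:C) (A1 := (b / alpha)%:C) (A2 := 0) al0 z0 dK dK gbe gbe) //.
    * by ring.
    * by rewrite lerDl.
    * move=> s sbe; rewrite !fox_kernel1 fox_kernel_exp.
      rewrite rmorph1 gamma_step; last by rewrite (lt_le_trans sbe)// HB// mem_head.
      rewrite mul1r lnK ?posrE// /B1 /sbar.
      have an : alpha%:C != 0 :> R[i] by rewrite (fmorph_eq0 (real_complex R)) gt_eqF.
      have bn : b%:C != 0 :> R[i] by rewrite (fmorph_eq0 (real_complex R)) gt_eqF.
      have e1 : (- - (a / b))%:C = a%:C / b%:C :> R[i] by rewrite opprK -(fmorphV (real_complex R)) -rmorphM.
      have e2 : (b / alpha)%:C = b%:C / alpha%:C :> R[i] by rewrite -(fmorphV (real_complex R)) -rmorphM.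
      rewrite e1 e2; move: (Gamma _) (Cexp _) => G X.
      by field; rewrite an bn.
- move=> alpha a b c al2 c0 D s1 s2 A B w g c1 line phi.
  have /andP[al0 al2'] := al2.
  have lt1 := @fox_line_lt _ [:: - s1; - s2] g line.
  have [be gbe HB] := fox_abscissa lt1.
  have kB : 0 < alpha < (size [:: - s1; - s2])%:R by [].
  have dK := decaying_fox c kB HB; have [sig sk HK] := dK.
  have phiE z : 0 < z -> phi z = c1 * fox_const * mellin (fox_kernel [:: - s1; - s2] c) alpha g 1 z.
    by move=> z0; rewrite /phi (foxE [:: - s1; - s2])// mulrA.
  clearbody phi.
  have [RL1 RL2] := mellin_RL al0 sk HK gbe al2 phiE.
  split.
  + by move=> z z0; exact: (fox_cvg al0 c0 z0 dK gbe).
  + exact: RL1.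
  + exact: (mellin_Cderivable al0 sk HK gbe phiE).
  + move=> z z0; rewrite RL2// /Cderive.
    rewrite (mellin_derive1n al0 sk HK 1 gbe phiE z0) (mellin_derive1n al0 sk HK 2 gbe phiE z0) phiE//.
    rewrite -[X in mellin _ _ _ (1 - X)]mulr1.
    rewrite (mellin_equation (d := 1) (A0 := a%:C) (A1 := (b / alpha)%:C)
      (A2 := (c / alpha ^+ 2)%:C) al0 z0 dK dK gbe gbe) //.
    * by ring.
    * by rewrite lerDl.
    * move=> s sbe; rewrite !fox_kernel2 fox_kernel_exp rmorph1.
      rewrite !gamma_step; last 2 first.
      - by rewrite (lt_le_trans sbe)// HB// !inE eqxx orbT.
      - by rewrite (lt_le_trans sbe)// HB// !inE eqxx.
      rewrite mul1r lnK ?posrE//.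
      have an : alpha%:C != 0 :> R[i] by rewrite (fmorph_eq0 (real_complex R)) gt_eqF.
      have cn : c%:C != 0 :> R[i] by rewrite (fmorph_eq0 (real_complex R)) gt_eqF.
      have DE : D%:C = (1 / alpha%:C - b%:C / c%:C) ^+ 2 - 4 * a%:C / c%:C :> R[i].
        have -> : D = (1 / alpha - b / c) ^+ 2 - 4 * a / c.
          by rewrite /D; field; rewrite !gt_eqF.
        rewrite rmorphB rmorphXn rmorphB !rmorphM !(fmorphV (real_complex R)) rmorph1.
        by rewrite rmorph_nat.
      have sq := sqrtCK D%:C.
      (* Multiplied by [c], this is the symbol [a - b / alpha * (alpha * s) + c / alpha ^+ 2 *
         (alpha * s * (alpha * s + 1))]. The root enters only through its square, which covers both
         signs of [D]. *)
      have prod : (- s1 - s) * (- s2 - s) = s ^+ 2 + (1 / alpha%:C - b%:C / c%:C) * s + a%:C / c%:C.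
        have u : (1 / alpha - b / c)%:C = 1 / alpha%:C - b%:C / c%:C :> R[i].
          by rewrite rmorphB !rmorphM !(fmorphV (real_complex R)) rmorph1.
        rewrite /s1 /s2 u; move: sq; rewrite DE; move: (sqrtC _) => q sq.
        have -> : (- (2^-1 * (1 / alpha%:C - b%:C / c%:C + q)) - s) *
          (- (2^-1 * (1 / alpha%:C - b%:C / c%:C - q)) - s) =
          s ^+ 2 + (1 / alpha%:C - b%:C / c%:C) * s +
          ((1 / alpha%:C - b%:C / c%:C) ^+ 2 - q ^+ 2) / 4 by field; rewrite an cn.
        rewrite sq; by field; rewrite an cn.
      have e2 : (b / alpha)%:C = b%:C / alpha%:C :> R[i] by rewrite -(fmorphV (real_complex R)) -rmorphM.
      have e3 : (c / alpha ^+ 2)%:C = c%:C / alpha%:C ^+ 2 :> R[i].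
        by rewrite -(rmorphXn (real_complex R)) -(fmorphV (real_complex R)) -rmorphM.
      rewrite e2 e3.
      have F (P1 P2 G1 G2 X : R[i]) : P1 * G1 * (P2 * G2) * (c%:C * X) =
        c%:C * (P1 * P2) * (G1 * G2 * X) by ring.
      rewrite F prod; move: (Gamma _) (Gamma _) (Cexp _) => G1 G2 X.
      by field; rewrite an cn.
- move=> alpha a1 a2 b1 b2 /andP[al0 al1] bb s1 s2 A B B' w g g' c1 line line' phi psi.
  pose b := 4 * b1 * b2.
  have b0 : 0 < b by rewrite /b -mulrA mulr_gt0.
  have b1n : b1 != 0 by apply/eqP => E; rewrite E mul0r ltxx in bb.
  have b2n : b2 != 0 by apply/eqP => E; rewrite E mulr0 ltxx in bb.
  pose L := [:: (1 / 2 - s1 / 2)%:C; (- (s2 / 2))%:C : R[i]].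
  pose L' := [:: (- (s1 / 2))%:C; (1 / 2 - s2 / 2)%:C : R[i]].
  have lt1 := @fox_line_lt _ L g line.
  have lt2 := @fox_line_lt _ L' g' line'.
  (* Explicit minima, because [mellin_equation] has to compare the abscissas of the two kernels:
     each is at most the other plus 1 / 2. *)
  pose be := Num.min (1 / 2 - s1 / 2) (- (s2 / 2)).
  pose be' := Num.min (- (s1 / 2)) (1 / 2 - s2 / 2).
  have gbe : g < be.
    by rewrite lt_min (lt1 (1 / 2 - s1 / 2)%:C) ?(lt1 (- (s2 / 2))%:C)// !inE eqxx ?orbT.
  have gbe' : g' < be'.
    by rewrite lt_min (lt2 (- (s1 / 2))%:C) ?(lt2 (1 / 2 - s2 / 2)%:C)// !inE eqxx ?orbT.
  have HB : {in L, forall x, be <= re x}.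
    by move=> x; rewrite !inE => /predU1P[->|/eqP ->]; rewrite ge_min lexx ?orbT.
  have HB' : {in L', forall x, be' <= re x}.
    by move=> x; rewrite !inE => /predU1P[->|/eqP ->]; rewrite ge_min lexx ?orbT.
  have k0 : 0 < 2 * alpha by rewrite mulr_gt0.
  have kB : 0 < 2 * alpha < (size L)%:R by rewrite k0/=; lra.
  have dK := decaying_fox b kB HB; have [sig sk HK] := dK.
  have dK' := decaying_fox b (kB : 0 < 2 * alpha < (size L')%:R) HB'; have [sig' sk' HK'] := dK'.
  have phiE z : 0 < z -> phi z = c1 * (Num.sg b1)%:C * fox_const * mellin (fox_kernel L b) (2 * alpha) g 1 z.
    by move=> z0; rewrite /phi (foxE L)// mulrA.
  have psiE z : 0 < z -> psi z = c1 * (Num.sqrt (b2 / b1))%:C * fox_const * mellin (fox_kernel L' b) (2 * alpha) g' 1 z.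
    by move=> z0; rewrite /psi (foxE L')// mulrA.
  clearbody phi psi.
  have al2 : 0 < alpha < 2 by apply/andP; split; lra.
  have [RL1 RL2] := mellin_RL k0 sk HK gbe al2 phiE.
  have [RL1' RL2'] := mellin_RL k0 sk' HK' gbe' al2 psiE.
  pose S := Num.sqrt (b1 * b2).
  (* The factor by which half a step multiplies b^(-s). *)
  have e1 : expR (1 / 2 * ln b) = 2 * S.
    apply/eqP; rewrite -(@eqrXn2 _ 2) ?expR_ge0 ?mulr_ge0 ?sqrtr_ge0//.
    rewrite -expRM_natl exprMn sqr_sqrtr ?ltW// (_ : 2 * (1 / 2 * ln b) = ln b); last by field.
    by rewrite lnK ?posrE// /b; apply/eqP; ring.
  have sgb : Num.sg b1 / b1 = `|b1|^-1.
    rewrite {2}(numEsg b1) invfM mulrA mulfV ?mul1r//.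
    by rewrite sgr_eq0.
  (* This and [sgE'] match the constants of the two unknowns, one for each equation. *)
  have sgE : Num.sqrt (b2 / b1) = Num.sg b1 / b1 * S.
    rewrite sgb (_ : b2 / b1 = `|b1|^-1 ^+ 2 * (b1 * b2)); last first.
      by rewrite exprVn real_normK ?num_real//; field.
    by rewrite sqrtrM ?sqr_ge0// sqrtr_sqr ger0_norm// invr_ge0.
  have sgE' : Num.sqrt (b2 / b1) * S = Num.sg b1 * b2.
    have SS : S * S = b1 * b2 by rewrite -expr2 sqr_sqrtr ?ltW.
    by rewrite sgE -[LHS]mulrA SS; field.
  have ahalf : 1 - alpha = 1 - 2 * alpha * (1 / 2) by field.
  have aC : alpha%:C != 0 :> R[i] by rewrite (fmorph_eq0 (real_complex R)) gt_eqF.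
  have b1C : b1%:C != 0 :> R[i] by rewrite (fmorph_eq0 (real_complex R)).
  have b2C : b2%:C != 0 :> R[i] by rewrite (fmorph_eq0 (real_complex R)).
  have vC (x y : R) : (x / y)%:C = x%:C / y%:C :> R[i].
    by rewrite -(fmorphV (real_complex R)) -rmorphM.
  have MC (x y : R) : (x * y)%:C = x%:C * y%:C :> R[i] by exact: rmorphM.
  have NC (x : R) : (- x)%:C = - x%:C :> R[i] by exact: rmorphN.
  have BC (x y : R) : (x - y)%:C = x%:C - y%:C :> R[i] by exact: rmorphB.
  have nC n : (n%:R : R)%:C = n%:R :> R[i] by exact: rmorph_nat.
  have s1C : s1%:C = - (a1%:C / b1%:C) :> R[i] by rewrite NC vC.
  have s2C : s2%:C = - (a2%:C / b2%:C) :> R[i] by rewrite NC vC.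
  have hC : (1 / 2)%:C = 1 / 2 :> R[i] by rewrite vC (nC 1%N) nC.
  have bbe : be' <= be + 1 / 2.
    by rewrite /be /be' -lerBlDr le_min !lerBlDr !ge_min; apply/andP; split; apply/orP; [left|right]; lra.
  have bbe' : be <= be' + 1 / 2.
    by rewrite /be /be' -lerBlDr le_min !lerBlDr !ge_min; apply/andP; split; apply/orP; [left|right]; lra.
  split.
  + by move=> z z0; split; [exact: (fox_cvg k0 b0 z0 dK gbe)|exact: (fox_cvg k0 b0 z0 dK' gbe')].
  + by split.
  + by split; [exact: (mellin_Cderivable k0 sk HK gbe phiE)|exact: (mellin_Cderivable k0 sk' HK' gbe' psiE)].
  + move=> z z0; rewrite RL2// RL2'// /Cderive ahalf.
    rewrite (mellin_derive1n k0 sk HK 1 gbe phiE z0) (mellin_derive1n k0 sk' HK' 1 gbe' psiE z0).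
    rewrite phiE// psiE//; split.
    * rewrite (mellin_equation (A0 := (a1 / b1 * S)%:C) (A1 := (S / alpha)%:C) (A2 := 0)
        k0 z0 dK dK' gbe gbe' bbe).
        rewrite sgE !(MC, vC).
        by move: (mellin _ _ _ _ _) (mellin _ _ _ _ _) => M0 M1; field; rewrite aC b1C.
      move=> s sbe; rewrite !fox_kernel2 fox_kernel_exp.
      (* The half step puts this factor one full step above its counterpart in [L'], to be lowered
         by [gamma_step], while the other factor becomes its counterpart exactly. *)
      have -> : (1 / 2 - s1 / 2)%:C - (s - (1 / 2)%:C) = (- (s1 / 2))%:C - (s - 1) :> R[i].
        by rewrite BC NC hC; field.
      have -> : (- (s2 / 2))%:C - (s - (1 / 2)%:C) = (1 / 2 - s2 / 2)%:C - s :> R[i].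
        by rewrite BC NC; ring.
      rewrite gamma_step; last by rewrite (lt_le_trans sbe)// HB'// !inE eqxx.
      rewrite e1 NC !(MC, vC) s1C nC.
      move: (Gamma _) (Gamma _) (Cexp _) (S%:C) => G1 G2 X SC.
      by field; rewrite aC b1C.
    * rewrite (mellin_equation (A0 := (a2 / b2 * S)%:C) (A1 := (S / alpha)%:C) (A2 := 0)
        k0 z0 dK' dK gbe' gbe bbe').
        have sC : (Num.sqrt (b2 / b1))%:C = (Num.sg b1)%:C * b2%:C / S%:C :> R[i].
          rewrite -MC -sgE' MC mulfK// (fmorph_eq0 (real_complex R)).
          by rewrite gt_eqF// sqrtr_gt0.
        have SC : S%:C != 0 :> R[i] by rewrite (fmorph_eq0 (real_complex R)) gt_eqF// sqrtr_gt0.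
        rewrite sC !(MC, vC).
        by move: (mellin _ _ _ _ _) (mellin _ _ _ _ _) => M0 M1; field; rewrite aC b2C SC.
      move=> s sbe; rewrite !fox_kernel2 fox_kernel_exp.
      have -> : (1 / 2 - s2 / 2)%:C - (s - (1 / 2)%:C) = (- (s2 / 2))%:C - (s - 1) :> R[i].
        by rewrite BC NC hC; field.
      have -> : (- (s1 / 2))%:C - (s - (1 / 2)%:C) = (1 / 2 - s1 / 2)%:C - s :> R[i].
        by rewrite BC NC; ring.
      rewrite (gamma_step (B := (- (s2 / 2))%:C)); last first.
        by rewrite (lt_le_trans sbe)// HB// !inE eqxx ?orbT.
      rewrite e1 NC !(MC, vC) s2C nC.
      move: (Gamma _) (Gamma _) (Cexp _) (S%:C) => G1 G2 X SC.
      by field; rewrite aC b2C.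
Qed.
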